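(* There is an algorithm which, for every instance of metric UFTRA with uniform requirements (i.e. $r_j = r$ for all $j\in\mathcal{C}$, for some positive integer $r$), outputs a feasible solution whose total cost is at most $1.5186$ times the minimum total cost of a feasible solution of that instance, and which runs in time $O(n^{3}\max_{j} r_j)$, where $n = |\mathcal{F}|+|\mathcal{C}|$.
   Context: An instance of UFTRA (Unconstrained Fault-Tolerant Resource Allocation) consists of a finite set $\mathcal{F}$ of sites, a finite set $\mathcal{C}$ of clients, an opening cost $f_i\ge 0$ for each $i\in\mathcal{F}$, a connection cost $c_{ij}\ge 0$ for each $i\in\mathcal{F}$, $j\in\mathcal{C}$, and a positive integer requirement $r_j$ for each $j\in\mathcal{C}$. A feasible solution is a choice of nonnegative integers $y_i$ ($i\in\mathcal{F}$; the number of facilities opened at site $i$) and $x_{ij}$ ($i\in\mathcal{F}$, $j\in\mathcal{C}$; the number of connections between $j$ and facilities at $i$) such that $\sum_{i\in\mathcal{F}} x_{ij}\ge r_j$ for all $j$ and $x_{ij}\le y_i$ for all $i,j$. Its total cost is $\sum_{i} f_i y_i + \sum_{i,j} c_{ij}x_{ij}$. The instance is metric if the connection costs satisfy $c_{ij}\le c_{ij'}+c_{i'j'}+c_{i'j}$ for all $i,i'\in\mathcal{F}$, $j,j'\in\mathcal{C}$ (they come from distances in a metric space containing sites and clients). *)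

(* Defs.v *)
From mathcomp Require Import all_boot all_order all_algebra.
From mathcomp Require Import reals.
Set Implicit Arguments. Unset Strict Implicit. Unset Printing Implicit Defensive.
Import Order.TTheory GRing.Theory Num.Theory.
Local Open Scope ring_scope.

Section UFTRA.
Variables (R : realType) (nF nC : nat).

Definition feasible (rq : 'I_nC -> nat) (y : 'I_nF -> nat)
    (x : 'I_nF -> 'I_nC -> nat) : Prop :=
  (forall j : 'I_nC, (rq j <= \sum_(i < nF) x i j)%N) /\
  (forall (i : 'I_nF) (j : 'I_nC), (x i j <= y i)%N).

Definition total_cost (f : 'I_nF -> R) (c : 'I_nF -> 'I_nC -> R)
    (y : 'I_nF -> nat) (x : 'I_nF -> 'I_nC -> nat) : R :=
  \sum_(i < nF) f i * (y i)%:R + \sum_(i < nF) \sum_(j < nC) c i j * (x i j)%:R.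

Definition metric_costs (c : 'I_nF -> 'I_nC -> R) : Prop :=
  forall (i i' : 'I_nF) (j j' : 'I_nC), c i j <= c i j' + c i' j' + c i' j.

End UFTRA.

(* A real-RAM machine model, used to express "algorithm" and running time.  *)
(* Two unbounded memories: nat cells N[.] and real cells X[.]; unit cost per *)
(* instruction.  Natural-number operations: constants, +, truncated -,       *)
(* comparison, indirect addressing.  Real operations: +, -, *, /, comparison,*)
(* indirect addressing, conversion nat -> real.  (No floor / real -> nat.)   *)

Inductive instr : Type :=
| NConst (a k : nat)
| NAdd (a b c : nat)
| NSub (a b c : nat)        (* N[a] := N[b] - N[c] (truncated)    *)
| NLoad (a b : nat)
| NStore (a b : nat)
| XConst (a k : nat)
| XOfNat (a b : nat)
| XAdd (a b c : nat)
| XSub (a b c : nat)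
| XMul (a b c : nat)
| XDiv (a b c : nat)        (* X[a] := X[b] / X[c]  (x/0 = 0)     *)
| XLoad (a b : nat)
| XStore (a b : nat)
| JmpNLt (b c t : nat)
| JmpXLt (b c t : nat)
| Jmp (t : nat)
| Halt.                     (* stop (also: pc outside program)    *)

Record mstate (R : realType) : Type :=
  MState { pc : nat; nmem : nat -> nat; xmem : nat -> R }.

Section Machine.
Variable R : realType.

Definition upd {T : Type} (m : nat -> T) (a : nat) (v : T) : nat -> T :=
  fun k => if k == a then v else m k.

Definition step (P : seq instr) (s : mstate R) : option (mstate R) :=
  let N := nmem s in let X := xmem s in let p := (pc s).+1 in
  match nth Halt P (pc s) with
  | NConst a k => Some (MState p (upd N a k) X)
  | NAdd a b c => Some (MState p (upd N a (N b + N c)%N) X)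
  | NSub a b c => Some (MState p (upd N a (N b - N c)%N) X)
  | NLoad a b => Some (MState p (upd N a (N (N b))) X)
  | NStore a b => Some (MState p (upd N (N a) (N b)) X)
  | XConst a k => Some (MState p N (upd X a k%:R))
  | XOfNat a b => Some (MState p N (upd X a (N b)%:R))
  | XAdd a b c => Some (MState p N (upd X a (X b + X c)))
  | XSub a b c => Some (MState p N (upd X a (X b - X c)))
  | XMul a b c => Some (MState p N (upd X a (X b * X c)))
  | XDiv a b c => Some (MState p N (upd X a (X b / X c)))
  | XLoad a b => Some (MState p N (upd X a (X (N b))))
  | XStore a b => Some (MState p N (upd X (N a) (X b)))
  | JmpNLt b c t => Some (MState (if (N b < N c)%N then t else p) N X)
  | JmpXLt b c t => Some (MState (if X b < X c then t else p) N X)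
  | Jmp t => Some (MState t N X)
  | Halt => None
  end.

Fixpoint exec (P : seq instr) (T : nat) (s : mstate R) : mstate R :=
  match T with
  | 0 => s
  | T'.+1 => match step P s with None => s | Some s' => exec P T' s' end
  end.

Definition halted (P : seq instr) (s : mstate R) : bool :=
  if nth Halt P (pc s) is Halt then true else false.

(* Input encoding of a uniform-requirement instance:
   N[0] = nF, N[1] = nC, N[2] = r, all other nat cells 0;
   X[i] = f_i (i < nF), X[nF + i*nC + j] = c_ij, all other real cells 0. *)
Definition init_state (nF nC r : nat) (f : 'I_nF -> R)
    (c : 'I_nF -> 'I_nC -> R) : mstate R :=
  MState 0
    (fun k => if k == 0%N then nF else if k == 1%N then nC
              else if k == 2%N then r else 0%N)
    (fun k => if (k < nF)%N then odflt 0 (omap f (insub k))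
              else if (k - nF < nF * nC)%N then
                odflt 0 (omap (fun i : 'I_nF =>
                          odflt 0 (omap (c i) (insub ((k - nF) %% nC)%N)))
                        (insub ((k - nF) %/ nC)%N))
              else 0).

Definition out_y (nF : nat) (s : mstate R) : 'I_nF -> nat :=
  fun i => nmem s (3 + i)%N.
Definition out_x (nF nC : nat) (s : mstate R) : 'I_nF -> 'I_nC -> nat :=
  fun i j => nmem s (3 + nF + i * nC + j)%N.

End Machine.

Arguments out_y {R} nF s i.
Arguments out_x {R} nF nC s i j.
Arguments init_state {R} nF nC r f c.

(* Main.v *)
Require Import Defs.
From mathcomp Require Import all_boot all_order all_algebra.
From mathcomp Require Import reals topology sequences exp zify ring lra.
Set Implicit Arguments. Unset Strict Implicit. Unset Printing Implicit Defensive.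
Import Order.TTheory GRing.Theory Num.Theory.
Local Open Scope ring_scope.

(* Copying a solution of the instance with one connection per client r times multiplies its cost
   by r, while a solution of the given instance is a superposition of stars (a site together with a
   set of clients).  So it is enough to run the facility location algorithm of Mahdian, Ye and Zhang
   once and to bound its cost star by star.  The greedy algorithm of Jain, Mahdian and Saberi, run
   with facility costs scaled by 38/25, pays for its solution by connection times al j whose sum
   over every star is at most 1.0995 times the (scaled) facility cost plus 1.788 times the connection
   cost: weak duality for the factor-revealing linear program.  Greedy augmentation then decreases
   connection cost at the expense of facility cost; this gives the factors
   1.0995 + ln (38/25) <= 1.5186 and 1 + 0.788 / (38/25) <= 1.5186. *)

(** * A factor-revealing bound for stars *)

(** Two obstacles shape the proof. A star may have any number of clients, but a certificate is
    finite. Summed over all pairs of clients from two blocks, the linearised constraints see each of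
    the three sequences (connection times, distances, lower bounds [A]) only through two triangular
    moments per block. This leaves a linear program with six unknowns per block, whatever the size
    of the star, which [lra] settles. The second obstacle is the cubic running time. A greedy round
    needs the next moment at which some site is paid for. This is a minimum of quotients over pairs
    of a site and a client, and their numerators and denominators are kept in tables. Updating the
    tables after a client connects takes quadratic time, but each client connects only once, so the
    sum stays cubic although four loops are nested. The requirement [r] is only a number written to
    the output and does not affect the running time. The scale 38/25 is where the two final factors
    nearly coincide (about 1.5182 and 1.5184): a larger scale increases the logarithm, a smaller one
    increases the quotient 0.788 / scale. *)

Section TriangularMoments.
Variable R : realType.

(* The diagonal counts half, so that tri t u + tri u t = 1. *)
Definition tri (t u : nat) : R := (t < u)%N%:R + (t == u)%:R / 2%:R.
(** [mom0] gives the early positions of [[a, b)] more weight and [mom1] the late ones. Summing over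
    the pairs [j < i] of one block a term that depends only on [j], or only on [i], produces exactly
    these two moments. *)
Definition mom0 (a b : nat) (x : nat -> R) : R :=
  \sum_(a <= t < b) \sum_(a <= u < b) tri t u * x t.
Definition mom1 (a b : nat) (x : nat -> R) : R :=
  \sum_(a <= t < b) \sum_(a <= u < b) tri t u * x u.

Lemma tri_ge0 t u : 0 <= tri t u.
Proof. by rewrite addr_ge0 // mulr_ge0 // invr_ge0. Qed.

Lemma triC t u : tri t u + tri u t = 1.
Proof. by rewrite /tri; case: (ltngtP t u) => _ /=; lra. Qed.

(** By [triC], the weights of the pairs [(t, u)] and [(u, t)] add up to 1. *)
Lemma mom01 a b x : mom0 a b x + mom1 a b x = (b - a)%:R * \sum_(a <= t < b) x t.
Proof.
have -> : mom1 a b x = \sum_(a <= t < b) \sum_(a <= u < b) tri u t * x t.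
  by rewrite /mom1 exchange_big.
rewrite /mom0 -big_split /= mulr_sumr; apply: eq_bigr => t _.
rewrite -big_split /= -[RHS]mulr1 -{2}(triC t t).
under eq_bigr do rewrite -mulrDl triC mul1r.
by rewrite triC mulr1 sumr_const_nat mulr_natl.
Qed.

Lemma ler_mom0 a b x y : (forall t, (a <= t < b)%N -> x t <= y t) -> mom0 a b x <= mom0 a b y.
Proof.
move=> h; apply: ler_sum_nat => t ht; apply: ler_sum_nat => u _.
by rewrite ler_wpM2l ?tri_ge0 ?h.
Qed.

Lemma ler_mom1 a b x y : (forall t, (a <= t < b)%N -> x t <= y t) -> mom1 a b x <= mom1 a b y.
Proof.
move=> h; apply: ler_sum_nat => t _; apply: ler_sum_nat => u hu.
by rewrite ler_wpM2l ?tri_ge0 ?h.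
Qed.

Lemma momC a b c : mom0 a b (fun=> c) = c * (b - a)%:R ^+ 2 / 2%:R.
Proof.
have e : mom0 a b (fun=> c) = mom1 a b (fun=> c) by [].
have := mom01 a b (fun=> c); rewrite -e sumr_const_nat -[c *+ _]mulr_natl => h.
by lra.
Qed.

Lemma mom0D a b x y : mom0 a b (fun t => x t + y t) = mom0 a b x + mom0 a b y.
Proof.
rewrite /mom0 -big_split; apply: eq_bigr => t _; rewrite -big_split.
by apply: eq_bigr => u _; rewrite mulrDr.
Qed.

Lemma mom1D a b x y : mom1 a b (fun t => x t + y t) = mom1 a b x + mom1 a b y.
Proof.
rewrite /mom1 -big_split; apply: eq_bigr => t _; rewrite -big_split.
by apply: eq_bigr => u _; rewrite mulrDr.
Qed.

Lemma mom01_nondecr a b x :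
  (forall t u, (a <= t)%N -> (t <= u)%N -> (u < b)%N -> x t <= x u) ->
  mom0 a b x <= mom1 a b x.
Proof.
move=> h; apply: ler_sum_nat => t ht; apply: ler_sum_nat => u hu.
rewrite /tri; case: (ltngtP t u) => htu /=; last by rewrite htu.
- by rewrite ler_wpM2l ?h //; [rewrite addr_ge0 // mulr_ge0 // invr_ge0|lia..].
- by rewrite mul0r add0r !mul0r.
Qed.

Lemma mom10_nonincr a b x :
  (forall t u, (a <= t)%N -> (t <= u)%N -> (u < b)%N -> x u <= x t) ->
  mom1 a b x <= mom0 a b x.
Proof.
move=> h; apply: ler_sum_nat => t ht; apply: ler_sum_nat => u hu.
rewrite /tri; case: (ltngtP t u) => htu /=; last by rewrite htu.
- by rewrite ler_wpM2l ?h //; [rewrite addr_ge0 // mulr_ge0 // invr_ge0|lia..].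
- by rewrite mul0r add0r !mul0r.
Qed.

End TriangularMoments.

Section StarBound.
Variable R : realType.

Definition pospart (x : R) := Num.max x 0.

Lemma pospart_ge0 x : 0 <= pospart x.
Proof. by rewrite /pospart le_max lexx orbT. Qed.

Lemma le_pospart x : x <= pospart x.
Proof. by rewrite /pospart le_max lexx. Qed.

(** This linearises the constraints: each positive part is replaced by a fixed fraction of its
    argument, and the fractions are part of the dual solution. *)
Lemma pospartZ w x : 0 <= w <= 1 -> w * x <= pospart x.
Proof.
move=> /andP[w0 w1]; have := pospart_ge0 x; have := le_pospart x.
by move: (pospart x) => y; nra.
Qed.

Lemma ler_pospart x y : x <= y -> pospart x <= pospart y.
Proof. by move=> h; rewrite /pospart ge_max !le_max h lexx orbT. Qed.

Lemma sum_nat_split (P : nat -> nat) (m : nat) (F : nat -> R) :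
  (forall i, (P i <= P i.+1)%N) ->
  \sum_(P 0%N <= j < P m) F j = \sum_(0 <= J < m) \sum_(P J <= j < P J.+1) F j.
Proof.
move=> h; elim: m => [|m IH]; first by rewrite !big_geq.
rewrite big_nat_recr //= -IH -big_cat_nat //.
by elim: m {IH} => // m IH; apply: leq_trans IH (h _).
Qed.

(* A piecewise constant solution of the dual of the factor-revealing linear program, found
   numerically.  The clients of a star, in order of connection time, are cut at the fractions
   block_bounds / 20; in the constraint of a client of block B the clients of block J are used with
   weight near_table / 100 if they come earlier and far_table / 100 if they come later.  The
   constraints of the last block are not used. *)
Definition block_bounds : seq nat := [:: 0; 2; 4; 6; 14; 15; 16; 20]%N.
Definition block_len B := nth 0%N [:: 2; 2; 2; 8; 1; 1; 4]%N B.
Definition near_table : seq (seq nat) := [:: [:: 50]; [:: 83; 50]; [:: 79; 87; 55];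
  [:: 92; 97; 100; 100]; [:: 56; 64; 100; 100; 29]; [:: 65; 77; 100; 100; 8; 17]]%N.
Definition far_table : seq (seq nat) := [:: [:: 100; 100; 100; 100; 100; 100; 0];
  [:: 100; 100; 100; 100; 100; 100; 0];  [:: 100; 100; 100; 100; 100; 100; 77];
  [:: 100; 100; 100; 100; 100; 100; 100]; [:: 100; 100; 100; 100; 100; 100; 100];
  [:: 100; 100; 100; 100; 100; 100; 100]]%N.
Definition near_weight B J : R := (nth 0%N (nth [::] near_table B) J)%:R / 100%:R.
Definition far_weight B J : R := (nth 0%N (nth [::] far_table B) J)%:R / 100%:R.

Lemma near_weight01 B J : 0 <= near_weight B J <= 1.
Proof.
rewrite /near_weight divr_ge0 //= ler_pdivrMr ?mul1r ?ltr0n // ler_nat.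
by move: B J; do 7![case=> //]; do 7![case=> //]; move=> *; rewrite nth_default.
Qed.

Lemma far_weight01 B J : 0 <= far_weight B J <= 1.
Proof.
rewrite /far_weight divr_ge0 //= ler_pdivrMr ?mul1r ?ltr0n // ler_nat.
by move: B J; do 8![case=> //]; do 8![case=> //]; move=> *; rewrite nth_default.
Qed.

End StarBound.

(** * The finite linear program over seven blocks *)

Section Blocks.
Variable R : realType.

(** Linearised payment of the clients of block [J] in the constraint of an average client of block
    [B], divided by the scale [k]. Distinct blocks enter through their averages alone. In the
    diagonal block the pairs [j < i] see the late moment of [A] and the early moment of [d]; the
    other pairs see the early moment of [al] and the late moment of [d]. *)
Definition contrib (a0 a1 A0 A1 d0 d1 : nat -> R) B J : R :=
  if (J < B)%N then near_weight R B J * (block_len J)%:R * ((A0 B + A1 B) / 2%:R - d0 J - d1 J)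
  else if (B < J)%N then
    far_weight R B J * (block_len J)%:R * ((a0 B + a1 B) / 2%:R - (d0 J + d1 J) / 2%:R)
  else near_weight R B B * (block_len B)%:R * (A1 B / 2%:R - d0 B)
       + far_weight R B B * (block_len B)%:R * ((a0 B - d1 B) / 2%:R).

(** The order hypotheses say what monotonicity leaves on the level of moments: inside a block the
    early moment precedes the late one, and across a boundary the late moment of a block precedes
    the early moment of the next. With the weights fixed everything is linear, so [lra] finds the
    multipliers. *)
Lemma dual_certificate (a0 a1 A0 A1 d0 d1 : nat -> R) (phi : R) :
  0 <= a0 0%N -> 0 <= A1 6%N -> 0 <= phi ->
  (forall B, (B < 7)%N -> a0 B <= a1 B /\ A1 B <= A0 B) ->
  (forall B, (B < 6)%N -> a1 B <= a0 B.+1 /\ A0 B.+1 <= A1 B) ->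
  (forall B, (B < 7)%N -> a0 B <= A0 B + d0 B /\ a1 B <= A1 B + d1 B) ->
  (forall B, (B < 7)%N -> 0 <= d0 B /\ 0 <= d1 B) ->
  (forall B, (B < 6)%N -> \sum_(0 <= J < 7) contrib a0 a1 A0 A1 d0 d1 B J <= phi) ->
  \sum_(0 <= B < 7) (block_len B)%:R * ((a0 B + a1 B) / 2%:R)
    <= 2199%:R / 2000%:R * phi
     + 447%:R / 250%:R * \sum_(0 <= B < 7) (block_len B)%:R * ((d0 B + d1 B) / 2%:R).
Proof.
move=> pa pA pphi h1 h2 h3 h4 h5.
move: (h1 0%N erefl) => /= [? ?]; move: (h1 1%N erefl) => /= [? ?]; move: (h1 2%N erefl) => /= [? ?].
move: (h1 3%N erefl) => /= [? ?]; move: (h1 4%N erefl) => /= [? ?]; move: (h1 5%N erefl) => /= [? ?].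
move: (h1 6%N erefl) => /= [? ?].
move: (h2 0%N erefl) => /= [? ?]; move: (h2 1%N erefl) => /= [? ?]; move: (h2 2%N erefl) => /= [? ?].
move: (h2 3%N erefl) => /= [? ?]; move: (h2 4%N erefl) => /= [? ?]; move: (h2 5%N erefl) => /= [? ?].
move: (h3 0%N erefl) => /= [? ?]; move: (h3 1%N erefl) => /= [? ?]; move: (h3 2%N erefl) => /= [? ?].
move: (h3 3%N erefl) => /= [? ?]; move: (h3 4%N erefl) => /= [? ?]; move: (h3 5%N erefl) => /= [? ?].
move: (h3 6%N erefl) => /= [? ?].
move: (h4 0%N erefl) => /= [? ?]; move: (h4 1%N erefl) => /= [? ?]; move: (h4 2%N erefl) => /= [? ?].
move: (h4 3%N erefl) => /= [? ?]; move: (h4 4%N erefl) => /= [? ?]; move: (h4 5%N erefl) => /= [? ?].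
move: (h4 6%N erefl) => /= [? ?].
have H0 := h5 0%N erefl; have H1 := h5 1%N erefl; have H2 := h5 2%N erefl.
have H3 := h5 3%N erefl; have H4 := h5 4%N erefl; have H5 := h5 5%N erefl.
clear h1 h2 h3 h4 h5.
rewrite /contrib /near_weight /far_weight /block_len /index_iota in H0 H1 H2 H3 H4 H5.
cbn in H0, H1, H2, H3, H4, H5.
rewrite !big_cons !big_nil /= in H0 H1 H2 H3 H4 H5.
rewrite /block_len /index_iota [iota _ _]/= !big_cons !big_nil.
rewrite ![nth _ _ _]/=.
do ?[match goal with H : is_true (_ <= _) |- _ => revert H end].
clear.
move: (a0 0%N) (a0 1%N) (a0 2%N) (a0 3%N) (a0 4%N) (a0 5%N) (a0 6%N) (a1 0%N) (a1 1%N) (a1 2%N) (a1 3%N) (a1 4%N) (a1 5%N) (a1 6%N) (A0 0%N) (A0 1%N) (A0 2%N) (A0 3%N) (A0 4%N) (A0 5%N) (A0 6%N) (A1 0%N) (A1 1%N) (A1 2%N) (A1 3%N) (A1 4%N) (A1 5%N) (A1 6%N) (d0 0%N) (d0 1%N) (d0 2%N) (d0 3%N) (d0 4%N) (d0 5%N) (d0 6%N) (d1 0%N) (d1 1%N) (d1 2%N) (d1 3%N) (d1 4%N) (d1 5%N) (d1 6%N).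
clear => *.
lra.
Qed.

End Blocks.

(** * From sequences of [20 * k] clients to block moments *)

Section Blocks2.
Variable R : realType.
Variables (k : nat) (al d A : nat -> R).
Hypothesis k_gt0 : (0 < k)%N.

(** The default 20 keeps the boundaries nondecreasing beyond the last block, as [sum_nat_split]
    requires. *)
Definition block_start B := (nth 20 block_bounds B * k)%N.
(** The divisor is the moment of the constant 1, so a normalised moment is a weighted average and
    bounds on the values of [x] carry over to it. *)
Definition nrm0 B x : R := mom0 (block_start B) (block_start B.+1) x / ((block_len B * k)%:R ^+ 2 / 2%:R).
Definition nrm1 B x : R := mom1 (block_start B) (block_start B.+1) x / ((block_len B * k)%:R ^+ 2 / 2%:R).
(* A i - d j is a lower bound on the connection cost of an earlier client j at time al i. *)
Definition pay i j : R :=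
  if (j < i)%N then pospart (A i - 2%:R * d j) else pospart (al i - d j).

Lemma block_startS B : (B < 7)%N -> block_start B.+1 = (block_start B + block_len B * k)%N.
Proof. by rewrite /block_start -mulnDl => hB; congr (_ * _)%N; move: B hB; do 7![case=> //]. Qed.

Lemma block_len_gt0 B : (B < 7)%N -> (0 < block_len B)%N.
Proof. by move: B; do 7![case=> //]. Qed.

Lemma half_sq_gt0 B : (B < 7)%N -> 0 < (block_len B * k)%:R ^+ 2 / 2%:R :> R.
Proof.
move=> hB; have h := block_len_gt0 hB; rewrite divr_gt0 // exprn_gt0 // ltr0n.
by rewrite muln_gt0 h.
Qed.

Lemma nrm_sum B x : (B < 7)%N ->
  \sum_(block_start B <= t < block_start B.+1) x t = (block_len B * k)%:R * ((nrm0 B x + nrm1 B x) / 2%:R).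
Proof.
move=> hB; have h := half_sq_gt0 hB.
rewrite /nrm0 /nrm1 -mulrDl mom01.
have -> : (block_start B.+1 - block_start B)%N = (block_len B * k)%N by rewrite block_startS //; lia.
move: h; move: (_%:R) (\sum_(_ <= _ < _) _) => l S h.
have l0 : l != 0 by apply/eqP => e; move: h; rewrite e expr0n /= mul0r ltxx.
by field.
Qed.

Lemma mom_nrm0 B x : (B < 7)%N ->
  mom0 (block_start B) (block_start B.+1) x = (block_len B * k)%:R ^+ 2 / 2%:R * nrm0 B x.
Proof. by move=> hB; rewrite mulrC /nrm0 divfK // gt_eqF // half_sq_gt0. Qed.

Lemma mom_nrm1 B x : (B < 7)%N ->
  mom1 (block_start B) (block_start B.+1) x = (block_len B * k)%:R ^+ 2 / 2%:R * nrm1 B x.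
Proof. by move=> hB; rewrite mulrC /nrm1 divfK // gt_eqF // half_sq_gt0. Qed.

Lemma block_start_mono B C : (B <= C)%N -> (C <= 7)%N -> (block_start B <= block_start C)%N.
Proof.
move=> BC C7; rewrite leq_mul2r; apply/orP; right.
by apply: (@sorted_leq_nth _ leq leq_trans leqnn 20 block_bounds) => //; rewrite inE /=; lia.
Qed.

Lemma block_lt B i : (B < 7)%N -> (block_start B <= i < block_start B.+1)%N -> (i < 20 * k)%N.
Proof.
move=> hB /andP[_ hi]; apply: leq_trans hi _.
by rewrite -[(20 * k)%N]/(block_start 7) block_start_mono.
Qed.

Local Notation cc := (contrib (nrm0^~ al) (nrm1^~ al) (nrm0^~ A) (nrm1^~ A) (nrm0^~ d) (nrm1^~ d)).

Hypothesis A_al : forall i, (i < 20 * k)%N -> A i <= al i + d i.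

Lemma sum_pair a b a' b' (F G : nat -> R) (x y : R) :
  \sum_(a <= i < b) \sum_(a' <= j < b') (x * F i - y * G j) =
  x * (b' - a')%:R * \sum_(a <= i < b) F i - y * (b - a)%:R * \sum_(a' <= j < b') G j.
Proof.
under eq_bigr do rewrite sumrB sumr_const_nat -mulr_sumr.
rewrite sumrB sumr_const_nat; congr (_ - _); last by rewrite -mulr_natl; ring.
by rewrite mulr_sumr; apply: eq_bigr => i _; rewrite -[LHS]mulr_natl; ring.
Qed.

(** Each payment is bounded below by [pospartZ], with [near_weight] if [j < i] and [far_weight]
    otherwise. Different blocks are entirely on one side; in a diagonal block both forms occur,
    separated by [tri]. *)
Lemma pay_block B J : (B < 7)%N -> (J < 7)%N ->
  (block_len B * k)%:R * k%:R * cc B J <=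
  \sum_(block_start B <= i < block_start B.+1) \sum_(block_start J <= j < block_start J.+1) pay i j.
Proof.
move=> hB hJ; rewrite /contrib.
have eB : (block_start B.+1 - block_start B)%N = (block_len B * k)%N by rewrite block_startS //; lia.
have eJ : (block_start J.+1 - block_start J)%N = (block_len J * k)%N by rewrite block_startS //; lia.
case: ltngtP => hJB.
- have hp : (block_start J.+1 <= block_start B)%N by apply: block_start_mono; lia.
  have le : \sum_(block_start B <= i < block_start B.+1) \sum_(block_start J <= j < block_start J.+1)
      (near_weight R B J * A i - (near_weight R B J * 2%:R) * d j) <=
      \sum_(block_start B <= i < block_start B.+1) \sum_(block_start J <= j < block_start J.+1) pay i j.
    apply: ler_sum_nat => i hi; apply: ler_sum_nat => j hj.
    rewrite /pay ifT; last by lia.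
    by rewrite -mulrA -mulrBr pospartZ // near_weight01.
  apply: le_trans le; rewrite sum_pair eB eJ !nrm_sum // !natrM.
  by rewrite le_eqVlt; apply/orP; left; apply/eqP; field.
- have hp : (block_start B.+1 <= block_start J)%N by apply: block_start_mono; lia.
  have le : \sum_(block_start B <= i < block_start B.+1) \sum_(block_start J <= j < block_start J.+1)
      (far_weight R B J * al i - (far_weight R B J) * d j) <=
      \sum_(block_start B <= i < block_start B.+1) \sum_(block_start J <= j < block_start J.+1) pay i j.
    apply: ler_sum_nat => i hi; apply: ler_sum_nat => j hj.
    rewrite /pay ifF; last by lia.
    by rewrite -mulrBr pospartZ // far_weight01.
  apply: le_trans le; rewrite sum_pair eB eJ !nrm_sum // !natrM.
  by rewrite le_eqVlt; apply/orP; left; apply/eqP; field.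
- subst J.
  have le : \sum_(block_start B <= i < block_start B.+1) \sum_(block_start B <= j < block_start B.+1)
      (tri R j i * (near_weight R B B * (A i - 2%:R * d j)) + tri R i j * (far_weight R B B * (al i - d j))) <=
      \sum_(block_start B <= i < block_start B.+1) \sum_(block_start B <= j < block_start B.+1) pay i j.
    apply: ler_sum_nat => i hi; apply: ler_sum_nat => j hj.
    have W1 := pospartZ (A i - 2%:R * d j) (near_weight01 R B B).
    have V1 := pospartZ (al i - d j) (far_weight01 R B B).
    rewrite /tri /pay [j == i]eq_sym; case: (ltngtP i j) => hij /=; rewrite ?mul0r ?add0r ?addr0 ?mul1r ?mul0r ?add0r ?addr0 //.
    (* On the diagonal [tri] gives each form weight one half, while [pay i i] is of the far form. So
       the near form must also lie below it, which is [A i <= al i + d i]. *)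
    subst j; have hn := block_lt hB hi.
    have W2 : pospart (A i - 2%:R * d i) <= pospart (al i - d i).
      by apply: ler_pospart; have := A_al hn; lra.
    by rewrite ?mul1r; lra.
  apply: le_trans le.
  have -> : \sum_(block_start B <= i < block_start B.+1) \sum_(block_start B <= j < block_start B.+1)
      (tri R j i * (near_weight R B B * (A i - 2%:R * d j)) + tri R i j * (far_weight R B B * (al i - d j))) =
      near_weight R B B * (mom1 (block_start B) (block_start B.+1) A - 2%:R * mom0 (block_start B) (block_start B.+1) d) +
      far_weight R B B * (mom0 (block_start B) (block_start B.+1) al - mom1 (block_start B) (block_start B.+1) d).
    have -> : mom1 (block_start B) (block_start B.+1) A =
      \sum_(block_start B <= i < block_start B.+1) \sum_(block_start B <= j < block_start B.+1) tri R j i * A i.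
      by rewrite /mom1 exchange_big.
    have -> : mom0 (block_start B) (block_start B.+1) d =
      \sum_(block_start B <= i < block_start B.+1) \sum_(block_start B <= j < block_start B.+1) tri R j i * d j.
      by rewrite /mom0 exchange_big.
    rewrite /mom0 /mom1 !mulrBr !mulr_sumr -!sumrB -big_split /=; apply: eq_bigr => i _.
    rewrite !mulr_sumr -!sumrB -big_split /=; apply: eq_bigr => j _; ring.
  rewrite !mom_nrm0 // !mom_nrm1 // !natrM.
  by rewrite le_eqVlt; apply/orP; left; apply/eqP; field.
Qed.

Hypotheses
  (al_ge0 : forall i, (i < 20 * k)%N -> 0 <= al i)
  (d_ge0 : forall i, (i < 20 * k)%N -> 0 <= d i)
  (A_ge0 : forall i, (i < 20 * k)%N -> 0 <= A i)
  (al_nondecr : forall i j, (i <= j)%N -> (j < 20 * k)%N -> al i <= al j)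
  (A_nonincr : forall i j, (i <= j)%N -> (j < 20 * k)%N -> A j <= A i)
  (al_A : forall i, (i < 20 * k)%N -> al i <= A i + d i).
Variable g : R.
Hypothesis pay_le : forall i, (i < 20 * k)%N -> \sum_(0 <= j < 20 * k) pay i j <= g.

Lemma blocks_sum (F : nat -> R) :
  \sum_(0 <= j < 20 * k) F j = \sum_(0 <= J < 7) \sum_(block_start J <= j < block_start J.+1) F j.
Proof.
rewrite -[RHS](@sum_nat_split _ block_start) // => B.
have [hB|hB] := ltnP B 7; first by apply: block_start_mono.
rewrite /block_start [nth 20 block_bounds B.+1]nth_default //.
by have -> : nth 20 block_bounds B = 20 by move: B hB; do 8![case=> //] => *; rewrite nth_default.
Qed.

Lemma nrm0_const B c : (B < 7)%N -> nrm0 B (fun=> c) = c.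
Proof.
move=> hB; apply: (@mulfI _ ((block_len B * k)%:R ^+ 2 / 2%:R)); first by rewrite gt_eqF // half_sq_gt0.
rewrite -mom_nrm0 // momC; have -> : (block_start B.+1 - block_start B)%N = (block_len B * k)%N by rewrite block_startS //; lia.
by field.
Qed.

Lemma ler_nrm0 B x y : (B < 7)%N ->
  (forall t, (block_start B <= t < block_start B.+1)%N -> x t <= y t) -> nrm0 B x <= nrm0 B y.
Proof. by move=> hB h; rewrite ler_pM2r ?invr_gt0 ?half_sq_gt0 // ler_mom0. Qed.

Lemma ler_nrm1 B x y : (B < 7)%N ->
  (forall t, (block_start B <= t < block_start B.+1)%N -> x t <= y t) -> nrm1 B x <= nrm1 B y.
Proof. by move=> hB h; rewrite ler_pM2r ?invr_gt0 ?half_sq_gt0 // ler_mom1. Qed.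

Lemma nrm1_const B c : (B < 7)%N -> nrm1 B (fun=> c) = c.
Proof. by move=> hB; rewrite -[RHS](@nrm0_const B). Qed.

(** Averaging the constraints of the clients of a block and dividing by [k] gives the hypothesis of
    [dual_certificate] with [phi = g / k]. *)
Lemma star_blocks :
  \sum_(0 <= i < 20 * k) al i <=
  2199%:R / 2000%:R * g + 447%:R / 250%:R * \sum_(0 <= i < 20 * k) d i.
Proof.
have kR : 0 < k%:R :> R by rewrite ltr0n.
have bound t B : (B < 7)%N -> (block_start B <= t < block_start B.+1)%N -> (t < 20 * k)%N by exact: block_lt.
have sumE x : \sum_(0 <= i < 20 * k) x i =
    k%:R * \sum_(0 <= B < 7) (block_len B)%:R * ((nrm0 B x + nrm1 B x) / 2%:R).
  rewrite blocks_sum mulr_sumr; apply: eq_big_nat => B hB.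
  by rewrite nrm_sum // natrM; ring.
have boundary B : (B < 6)%N -> block_start B.+1 = (block_start B.+1).-1.+1.
  move=> hB; rewrite prednK //; have := @block_startS B; have := @block_len_gt0 B.
  by move=> /(_ (ltnW hB)) h1 /(_ (ltnW hB)) ->; rewrite addn_gt0 muln_gt0 h1 k_gt0 orbT.
have last_in B : (B < 6)%N -> ((block_start B.+1).-1 < 20 * k)%N.
  move=> hB; rewrite -(boundary B hB) -[(20 * k)%N]/(block_start 7).
  by apply: block_start_mono; lia.
rewrite !sumE; set X := \sum_(_ <= _ < _) _; set Y := \sum_(_ <= _ < _) _.
suff : X <= 2199%:R / 2000%:R * (g / k%:R) + 447%:R / 250%:R * Y.
  move=> h; have : k%:R * X <= k%:R * (2199%:R / 2000%:R * (g / k%:R) + 447%:R / 250%:R * Y).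
    by rewrite ler_pM2l.
  move/le_trans; apply; rewrite le_eqVlt; apply/orP; left; apply/eqP.
  by field; rewrite gt_eqF.
rewrite /X /Y; apply: (@dual_certificate R (nrm0^~ al) (nrm1^~ al) (nrm0^~ A) (nrm1^~ A) (nrm0^~ d) (nrm1^~ d)).
- by rewrite -[0](@nrm0_const 0%N) // ler_nrm0 // => t /bound h; rewrite al_ge0 // h.
- by rewrite -[0](@nrm1_const 6%N) // ler_nrm1 // => t /bound h; rewrite A_ge0 // h.
- rewrite divr_ge0 ?ler0n //.
  apply: le_trans (pay_le (i := 0) _); last by lia.
  apply: sumr_ge0 => j _; rewrite /pay.
  rewrite ltn0. exact: pospart_ge0.
- move=> B hB; split; rewrite ler_pM2r ?invr_gt0 ?half_sq_gt0 //.
    apply: mom01_nondecr => t u h1 h2 h3; apply: al_nondecr => //.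
    by apply: (@bound _ B) => //; lia.
  apply: mom10_nonincr => t u h1 h2 h3; apply: A_nonincr => //.
  by apply: (@bound _ B) => //; lia.
- move=> B hB; have hB7 : (B < 7)%N by lia.
  have e := boundary B hB; split.
    (* The value at the last client of block [B] separates the averages of the two adjacent
       blocks. *)
    apply: (@le_trans _ _ (al (block_start B.+1).-1)).
      rewrite -[leRHS](@nrm1_const B) // ler_nrm1 // => t ht.
      by apply: al_nondecr; [lia|exact: last_in].
    rewrite -[leLHS](@nrm0_const B.+1) // ler_nrm0 // => t ht.
    by apply: al_nondecr; [lia|exact: bound ht].
  apply: (@le_trans _ _ (A (block_start B.+1).-1)).
    rewrite -[leRHS](@nrm0_const B.+1) // ler_nrm0 // => t ht.
    by apply: A_nonincr; [lia|exact: bound ht].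
  rewrite -[leLHS](@nrm1_const B) // ler_nrm1 // => t ht.
  by apply: A_nonincr; [lia|exact: last_in].
- move=> B hB; rewrite /nrm0 /nrm1 -!mulrDl -mom0D -mom1D.
  by split; [apply: ler_nrm0|apply: ler_nrm1] => // t ht; apply: al_A; exact: bound ht.
- move=> B hB; split.
    by rewrite -[0](@nrm0_const B) // ler_nrm0 // => t /bound h; rewrite d_ge0 // h.
  by rewrite -[0](@nrm1_const B) // ler_nrm1 // => t /bound h; rewrite d_ge0 // h.
- move=> B hB; have hB7 : (B < 7)%N by lia.
  have l0 : 0 < (block_len B * k)%:R :> R by rewrite ltr0n muln_gt0 block_len_gt0.
  rewrite ler_pdivlMr // -(ler_pM2l l0).
  set S := \sum_(_ <= _ < _) _; have -> : (block_len B * k)%:R * (S * k%:R) = (block_len B * k)%:R * k%:R * S by ring.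
  rewrite mulr_sumr.
  apply: (@le_trans _ _ (\sum_(block_start B <= i < block_start B.+1) g)); last first.
    by rewrite sumr_const_nat block_startS // addKn mulr_natl.
  apply: (@le_trans _ _ (\sum_(block_start B <= i < block_start B.+1) \sum_(0 <= J < 7) \sum_(block_start J <= j < block_start J.+1) pay i j)); last first.
    by apply: ler_sum_nat => i hi; rewrite -blocks_sum pay_le //; exact: bound hi.
  rewrite exchange_big_nat /=; apply: ler_sum_nat => J hJ.
  exact: pay_block.
Qed.
End Blocks2.

Lemma sum_divn (R : realType) m k (F : nat -> R) : (0 < m)%N ->
  \sum_(0 <= j < m * k) F (j %/ m)%N = m%:R * \sum_(0 <= j < k) F j.
Proof.
move=> m0; elim: k => [|k IH]; first by rewrite muln0 !big_geq // mulr0.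
rewrite (@big_cat_nat _ _ _ (m * k)) //=; last by rewrite leq_mul2l leqnSn orbT.
rewrite IH big_nat_recr //= mulrDr; congr (_ + _).
rewrite (@eq_big_nat _ _ _ _ _ _ (fun=> F k)) => [|j hj].
  by rewrite sumr_const_nat mulnS addnK mulr_natl.
by congr F; move: hj; rewrite mulnS; nia.
Qed.

(* Replacing every client by 20 copies makes the block boundaries integral. *)
Lemma star_bound (R : realType) (k : nat) (al d A : nat -> R) (f : R) :
  0 <= f ->
  (forall i, (i < k)%N -> 0 <= al i) ->
  (forall i, (i < k)%N -> 0 <= d i) ->
  (forall i, (i < k)%N -> 0 <= A i) ->
  (forall i j, (i <= j)%N -> (j < k)%N -> al i <= al j) ->
  (forall i j, (i <= j)%N -> (j < k)%N -> A j <= A i) ->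
  (forall i, (i < k)%N -> al i <= A i + d i) ->
  (forall i, (i < k)%N -> A i <= al i + d i) ->
  (forall i, (i < k)%N -> \sum_(0 <= j < k) pay al d A i j <= f) ->
  \sum_(0 <= i < k) al i <=
    2199%:R / 2000%:R * f + 447%:R / 250%:R * \sum_(0 <= i < k) d i.
Proof.
move=> f0 al0 d0 A0 alM AM alA Aal payf.
have [->|kn] := posnP k; first by rewrite !big_geq // mulr0 addr0 mulr_ge0 // divr_ge0.
have dv i : (i < 20 * k)%N -> (i %/ 20 < k)%N by rewrite ltn_divLR // mulnC.
have := @star_blocks R k (fun i => al (i %/ 20)%N) (fun i => d (i %/ 20)%N)
  (fun i => A (i %/ 20)%N) kn (fun i h => Aal _ (dv i h)) (fun i h => al0 _ (dv i h))
  (fun i h => d0 _ (dv i h)) (fun i h => A0 _ (dv i h))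
  (fun i j h1 h2 => alM _ _ (leq_div2r 20 h1) (dv j h2))
  (fun i j h1 h2 => AM _ _ (leq_div2r 20 h1) (dv j h2))
  (fun i h => alA _ (dv i h)) (20%:R * f).
rewrite !sum_divn // => h.
suff : 20%:R * \sum_(0 <= i < k) al i <= 2199%:R / 2000%:R * (20%:R * f) +
    447%:R / 250%:R * (20%:R * \sum_(0 <= i < k) d i) by lra.
apply: h => i hi.
apply: le_trans (_ : 20%:R * \sum_(0 <= j < k) pay al d A (i %/ 20)%N j <= _); last first.
  by rewrite ler_pM2l ?ltr0n // payf // dv.
rewrite -sum_divn //; apply: ler_sum_nat => j hj; rewrite /pay.
case: (ltnP j i) => ji; case: (ltnP (j %/ 20) (i %/ 20)) => ji' //.
(* Two copies of one client: the copies use the near form, the original constraint the far form,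
   which is at least as large. *)
- have e : (j %/ 20 = i %/ 20)%N by apply/eqP; rewrite eqn_leq ji' andbT leq_div2r // ltnW.
  by rewrite e; apply: ler_pospart; have := Aal _ (dv i hi); lra.
- by move: (leq_div2r 20 ji); lia.
Qed.

(** * The greedy phase *)

Lemma sum_le0_term (R : realType) n (F : nat -> R) j : (j < n)%N ->
  (forall i, (i < n)%N -> 0 <= F i) -> \sum_(0 <= i < n) F i <= 0 -> F j <= 0.
Proof.
move=> hj F0; apply: le_trans.
rewrite big_mkord (bigD1 (Ordinal hj)) //= lerDl.
by apply: sumr_ge0 => i _; apply: F0.
Qed.

(** * The moment at which growing offers reach a given sum *)

Section Threshold.
Variables (R : realType) (n : nat) (U : nat -> bool) (x : nat -> R) (B : R).

Definition below_sum j : R := \sum_(0 <= k < n) (if U k && (x k <= x j) then x k else 0).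
Definition below_cnt j : R := \sum_(0 <= k < n) (if U k && (x k <= x j) then 1 else 0).

Lemma below_cnt_gt0 j : (j < n)%N -> U j -> 0 < below_cnt j.
Proof.
move=> hj Uj; rewrite /below_cnt big_mkord (bigD1 (Ordinal hj)) //= Uj lexx /=.
rewrite ltr_wpDr // ?ltr01 //.
by apply: sumr_ge0 => i _; case: ifP.
Qed.

Lemma below_gap j t :
  \sum_(0 <= k < n) (if U k && (x k <= x j) then t - x k else 0) =
  t * below_cnt j - below_sum j.
Proof.
rewrite /below_cnt /below_sum mulr_sumr -sumrB; apply: eq_bigr => k _.
by case: ifP; rewrite ?mulr1 ?mulr0 ?subr0.
Qed.

Lemma threshold_le t : 0 <= B ->
  (forall j, (j < n)%N -> U j -> t <= (B + below_sum j) / below_cnt j) ->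
  \sum_(0 <= k < n) (if U k then pospart (t - x k) else 0) <= B.
Proof.
move=> B0 ht.
have [/existsP[j0 h0]|/existsPn none] := boolP [exists j : 'I_n, U j && (x j < t)].
  case: (@arg_maxP _ _ _ j0 [pred j : 'I_n | U j && (x j < t)] (fun j => x j) h0).
  move=> j /andP[Uj xj] mx.
  have := ht j (ltn_ord j) Uj.
  rewrite ler_pdivlMr ?below_cnt_gt0 // -lerBlDr -below_gap; apply: le_trans.
  apply: ler_sum_nat => k /= hk; case: ifP => //= Uk.
  case: (leP (x k) (x j)) => hx.
    by rewrite /pospart max_l // subr_ge0; apply: le_trans hx (ltW xj).
  rewrite /pospart ge_max lexx andbT subr_le0 leNgt; apply/negP => hl.
  by have := mx (Ordinal hk); rewrite /= Uk hl => /(_ isT); rewrite leNgt hx.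
apply: le_trans B0; rewrite big_mkord; apply: sumr_le0 => k _.
case: ifP => // Uk; rewrite /pospart ge_max lexx andbT subr_le0 leNgt.
by have := none k; rewrite Uk.
Qed.

Lemma threshold_eq t j : (j < n)%N -> U j ->
  t = (B + below_sum j) / below_cnt j ->
  \sum_(0 <= k < n) (if U k && (x k <= x j) then t - x k else 0) = B.
Proof.
move=> hj Uj ->; rewrite below_gap divfK; first by ring.
by rewrite gt_eqF // below_cnt_gt0.
Qed.

End Threshold.

(** * The rounds of the greedy algorithm and their invariant *)

Section JMS.
Variables (R : realType) (nF nC : nat) (g : nat -> R) (c : nat -> nat -> R).

(** [rr] is the current connection cost of a connected client and [fp] the price still asked by a
    site, 0 once it is open. *)
Record jstate := JState {
  conn : nat -> bool; rr : nat -> R; fp : nat -> R; opn : nat -> bool }.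

Definition residual (s : jstate) i : R :=
  fp s i - \sum_(0 <= j < nC) (if conn s j then pospart (rr s j - c i j) else 0).

(** The time at which the unconnected clients not farther from [i] than [j], each offering time
    minus distance, together pay the residual price. An open site has residual 0 under the
    invariant, and its least candidate is the distance to its nearest unconnected client. So
    connecting to an open site is an event of the same kind as opening a site. *)
Definition candidate (s : jstate) i j : R :=
  (residual s i + below_sum nC (fun k => ~~ conn s k) (c i) j)
  / below_cnt nC (fun k => ~~ conn s k) (c i) j.

Definition selected (s : jstate) t ib :=
  [/\ (ib < nF)%N,
      (forall i j, (i < nF)%N -> (j < nC)%N -> ~~ conn s j -> t <= candidate s i j)
    & exists j, [/\ (j < nC)%N, ~~ conn s j & t = candidate s ib j]].

Definition jstep (s : jstate) t ib : jstate := JState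
  (fun j => conn s j || (c ib j <= t))
  (fun j => if conn s j then (if c ib j < rr s j then c ib j else rr s j)
            else if c ib j <= t then c ib j else rr s j)
  (fun i => if i == ib then 0 else fp s i)
  (fun i => (i == ib) || opn s i).

(* al j is the time at which client j is connected, rk j the round in which this happens, and
   h u j the connection cost of j just before round u. *)
Record jinv (L : nat) (s : jstate) (tl : R) (al : nat -> R) (rk : nat -> nat)
    (h : nat -> nat -> R) : Prop := JInv {
  tl_ge0 : 0 <= tl;
  conn_le : forall j, (j < nC)%N -> conn s j -> [/\ rr s j <= al j, 0 <= al j, al j <= tl & (rk j < L)%N];
  offers : forall i, (i < nF)%N -> \sum_(0 <= j < nC)
    (if conn s j then pospart (rr s j - c i j) else pospart (tl - c i j)) <= fp s i;
  nearest : forall j, (j < nC)%N -> conn s j -> exists i, [/\ (i < nF)%N, opn s i & rr s j = c i j];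
  fpE : forall i, fp s i = if opn s i then 0 else g i;
  payment : \sum_(0 <= j < nC) (if conn s j then al j else 0) =
    \sum_(0 <= i < nF) (if opn s i then g i else 0) +
    \sum_(0 <= j < nC) (if conn s j then rr s j else 0);
  al_mono : forall j m, (j < nC)%N -> (m < nC)%N -> conn s j -> conn s m ->
    (rk j <= rk m)%N -> al j <= al m;
  al_tri : forall j m i, (j < nC)%N -> (m < nC)%N -> (i < nF)%N -> conn s j -> conn s m ->
    (rk j < rk m)%N -> al m <= h (rk m) j + c i j + c i m;
  h_mono : forall j u v, (j < nC)%N -> conn s j -> (rk j < u)%N -> (u <= v)%N -> (v < L)%N ->
    h v j <= h u j;
  rr_h : forall j u, (j < nC)%N -> conn s j -> (rk j < u)%N -> (u < L)%N -> rr s j <= h u j;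
  h_al : forall j u, (j < nC)%N -> conn s j -> (rk j < u)%N -> (u < L)%N -> h u j <= al j;
  h_offers : forall m i, (m < nC)%N -> (i < nF)%N -> conn s m ->
    \sum_(0 <= j < nC) (if conn s j && (rk j < rk m)%N then pospart (h (rk m) j - c i j)
                        else pospart (al m - c i j)) <= g i }.

Hypothesis g_ge0 : forall i, (i < nF)%N -> 0 <= g i.
Hypothesis c_ge0 : forall i j, (i < nF)%N -> (j < nC)%N -> 0 <= c i j.
Hypothesis c_metric : forall i i' j j', (i < nF)%N -> (i' < nF)%N -> (j < nC)%N -> (j' < nC)%N ->
  c i j <= c i j' + c i' j' + c i' j.

Definition jinit : jstate := JState (fun=> false) (fun=> 0) g (fun=> false).

Lemma jinv_init al rk h : jinv 0 jinit 0 al rk h.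
Proof.
split=> //=; last by rewrite !big1 // addr0.
move=> i hi; rewrite big_mkord; apply: le_trans (g_ge0 hi); apply: sumr_le0 => j _.
by rewrite /pospart ge_max lexx andbT sub0r oppr_le0 c_ge0.
Qed.

Variables (L : nat) (s : jstate) (tl : R) (al : nat -> R) (rk : nat -> nat) (h : nat -> nat -> R).
Variables (t : R) (ib : nat).
Hypothesis inv : jinv L s tl al rk h.
Hypothesis sel : selected s t ib.

Lemma offers_split x i :
  \sum_(0 <= j < nC) (if conn s j then pospart (rr s j - c i j) else pospart (x - c i j)) =
  \sum_(0 <= j < nC) (if conn s j then pospart (rr s j - c i j) else 0) +
  \sum_(0 <= j < nC) (if ~~ conn s j then pospart (x - c i j) else 0).
Proof.
rewrite -big_split /=; apply: eq_bigr => j _.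
by case: ifP => _ /=; rewrite ?addr0 ?add0r.
Qed.

Lemma residual_ge i : (i < nF)%N ->
  \sum_(0 <= j < nC) (if ~~ conn s j then pospart (tl - c i j) else 0) <= residual s i.
Proof. by move=> hi; rewrite /residual lerBrDl -offers_split; apply: (offers inv). Qed.

Lemma residual_ge0 i : (i < nF)%N -> 0 <= residual s i.
Proof.
move=> /residual_ge; apply: le_trans; apply: sumr_ge0 => j _.
by case: ifP => // _; apply: pospart_ge0.
Qed.

Lemma offers_at_t i : (i < nF)%N -> \sum_(0 <= j < nC)
  (if conn s j then pospart (rr s j - c i j) else pospart (t - c i j)) <= fp s i.
Proof.
move=> hi; rewrite offers_split -lerBrDl; case: sel => _ ht _.
by apply: (@threshold_le _ _ _ (c i)); [exact: residual_ge0|move=> j hj Uj; exact: ht].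
Qed.

Lemma offers_eq :
  \sum_(0 <= j < nC) (if ~~ conn s j then pospart (t - c ib j) else 0) = residual s ib.
Proof.
case: sel => hib ht [j [hj Uj et]]; apply/eqP; rewrite eq_le; apply/andP; split.
  by have := offers_at_t hib; rewrite offers_split /residual lerBrDl.
rewrite -(@threshold_eq _ _ (fun k => ~~ conn s k) (c ib) _ _ _ hj Uj et).
apply: ler_sum_nat => k hk; case: (conn s k) => //=; case: ifP => _; first exact: le_pospart.
exact: pospart_ge0.
Qed.

(** At the minimiser the linear function [below_gap] has positive slope. Its value at [tl] is at
    most the offers at [tl], hence at most the residual, which is its value at [t]. *)
Lemma tl_le_t : tl <= t.
Proof.
case: sel => hib ht [j [hj Uj et]].
have e := @threshold_eq _ _ (fun k => ~~ conn s k) (c ib) _ _ _ hj Uj et.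
have n0 := @below_cnt_gt0 _ _ (fun k => ~~ conn s k) (c ib) _ hj Uj.
rewrite -(ler_pM2r n0) -(lerD2r (- below_sum nC (fun k => ~~ conn s k) (c ib) j)).
rewrite -!below_gap e; apply: le_trans (residual_ge hib); apply: ler_sum_nat => k _.
case: (conn s k) => //=; case: ifP => _; first exact: le_pospart.
exact: pospart_ge0.
Qed.

(** If all unconnected clients were farther than [t], the sum defining the minimising candidate
    would be negative, but it equals the nonnegative residual. This bounds the number of rounds by
    the number of clients. *)
Lemma jstep_progress : exists j, [/\ (j < nC)%N, ~~ conn s j & c ib j <= t].
Proof.
case: sel => hib ht [j [hj Uj et]].
have e := @threshold_eq _ _ (fun k => ~~ conn s k) (c ib) _ _ _ hj Uj et.
have [/existsP[k /andP[Uk ck]]|/existsPn none] :=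
  boolP [exists k : 'I_nC, ~~ conn s k && (c ib k <= t)]; first by exists k; split.
have cj : t < c ib j by have := none (Ordinal hj); rewrite Uj /= -ltNge.
have : \sum_(0 <= k < nC)
  (if ~~ conn s k && (c ib k <= c ib j) then t - c ib k else 0) < 0.
  rewrite big_mkord (bigD1 (Ordinal hj)) //= Uj lexx /=.
  apply: (@lt_le_trans _ _ (0 + \sum_(i < nC | i != Ordinal hj) 0)); last by rewrite big1 ?addr0.
  apply: ltr_leD; first by rewrite subr_lt0.
  apply: ler_sum => k _; case: ifP => // /andP[Uk _].
  by have := none k; rewrite Uk /= -ltNge => /ltW; rewrite subr_le0.
by rewrite e ltNge residual_ge0.
Qed.

(** The clients connected in this round get time [t] and round number [L]; the history is extended
    by the connection costs before the round, [rr s]. *)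
Lemma jinv_step :
  jinv L.+1 (jstep s t ib) t
    (fun j => if conn s j then al j else t)
    (fun j => if conn s j then rk j else L)
    (fun u => if (u < L)%N then h u else rr s).
Proof.
have hib : (ib < nF)%N by case: sel.
have tt := tl_le_t; have t0 : 0 <= t := le_trans (tl_ge0 inv) tt.
have rr_le j : (j < nC)%N -> conn s j -> rr (jstep s t ib) j <= rr s j.
  by move=> hj Cj; rewrite /= Cj; case: ltP => // /ltW.
split => //=.
- move=> j hj; case Cj: (conn s j) => /=.
    move=> _; have [h1 h2 h3 h4] := conn_le inv hj Cj; split=> //; last by lia.
      by apply: le_trans h1; have := rr_le _ hj Cj; rewrite /= Cj.
    exact: le_trans tt.
  by move=> hc; rewrite hc; split=> //; lia.
- move=> i hi; case: eqP => [->|_].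
    (* The chosen site now has price 0 and receives no offers: connected clients pay at most their
       distance to it, and the others are farther away than [t]. *)
    have pos0 x : x <= 0 -> pospart x <= 0 by move=> hx; rewrite /pospart ge_max hx lexx.
    rewrite big_mkord; apply: sumr_le0 => j _.
    case Cj: (conn s j) => /=; first by case: ltP => hh; apply: pos0; rewrite subr_le0.
    by case: (leP (c ib j) t) => hh; apply: pos0; rewrite subr_le0 // ltW.
  apply: le_trans (offers_at_t hi); apply: ler_sum_nat => j /= hj.
  case Cj: (conn s j) => /=.
    by apply: ler_pospart; rewrite lerD2r; have := rr_le _ hj Cj; rewrite /= Cj.
  by case: (leP (c ib j) t) => h1 //; apply: ler_pospart; rewrite lerD2r.
- move=> j hj; case Cj: (conn s j) => /=.
    move=> _; case: ltP => _; first by exists ib; rewrite eqxx; split.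
    have [i [h1 h2 h3]] := nearest inv hj Cj.
    by exists i; rewrite h2 orbT; split.
  by move=> ->; exists ib; rewrite eqxx; split.
- move=> i; case: eqP => //= _; exact: fpE inv i.
- have P := payment inv; have E := offers_eq; rewrite /residual in E.
  (* A new client splits [t] into its offer [t - c ib j] and its connection cost. By [offers_eq] the
     offers sum to the price of [ib] minus what the connected clients save by switching to it; if
     [ib] is already open, that price is 0. *)
  have -> : \sum_(0 <= j < nC) (if conn s j || (c ib j <= t) then if conn s j then al j else t else 0)
    = \sum_(0 <= j < nC) (if conn s j then al j else 0) +
      (\sum_(0 <= j < nC) (if ~~ conn s j then pospart (t - c ib j) else 0)
      + \sum_(0 <= j < nC) (if ~~ conn s j && (c ib j <= t) then c ib j else 0)).
    rewrite -!big_split /=; apply: eq_bigr => j _; case: (conn s j) => /=; first by rewrite !addr0.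
    rewrite add0r /pospart; case: leP => hh; last by rewrite max_r ?addr0 // subr_le0 ltW.
    by rewrite max_l ?subr_ge0 // subrK.
  rewrite P E.
  have -> : \sum_(0 <= i < nF) (if (i == ib) || opn s i then g i else 0) =
    \sum_(0 <= i < nF) (if opn s i then g i else 0) + fp s ib.
    rewrite !big_mkord (bigD1 (Ordinal hib)) //= eqxx /= [X in _ = X + _](bigD1 (Ordinal hib)) //=.
    rewrite (fpE inv) addrAC; congr (_ + _); first by case: ifP; rewrite ?addr0 ?add0r.
    by apply: eq_bigr => i /negPf hi; rewrite -val_eqE /= in hi; rewrite hi.
  have -> : \sum_(0 <= j < nC) (if conn s j || (c ib j <= t) then
       if conn s j then if c ib j < rr s j then c ib j else rr s j
       else if c ib j <= t then c ib j else rr s j else 0) =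
    \sum_(0 <= j < nC) (if conn s j then rr s j else 0)
    - \sum_(0 <= j < nC) (if conn s j then pospart (rr s j - c ib j) else 0)
    + \sum_(0 <= j < nC) (if ~~ conn s j && (c ib j <= t) then c ib j else 0).
    rewrite -sumrB -big_split /=; apply: eq_bigr => j _; case: (conn s j) => /=.
      rewrite addr0 /pospart; case: ltP => hh; last by rewrite max_r ?subr0 // subr_le0.
      by rewrite max_l ?subr_ge0 ?ltW // subKr.
    by rewrite subr0 add0r; case: (c ib j <= t).
  by ring.
- move=> j m hj hm; case Cj: (conn s j); case Cm: (conn s m) => //= h1 h2 h3.
  + exact: al_mono inv _ _ hj hm Cj Cm h3.
  + by have [_ _ h4 _] := conn_le inv hj Cj; apply: le_trans tt.
  + by have [_ _ _ h4] := conn_le inv hm Cm; lia.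
- move=> j m i hj hm hi; case Cj: (conn s j); case Cm: (conn s m) => //= h1 h2 h3.
  + by have [_ _ _ h4] := conn_le inv hm Cm; rewrite h4; exact: al_tri inv _ _ _ hj hm hi Cj Cm h3.
  (* The site [i0] serving [j] is open and asks nothing, so its offers vanish and [t <= c i0 m]. The
     path from [i0] through [j] and [i] to [m] then gives the bound. *)
  + rewrite ltnn; have [i0 [hi0 oi0 ->]] := nearest inv hj Cj.
    have e : fp s i0 = 0 by rewrite (fpE inv) oi0.
    have := offers_at_t hi0; rewrite e => /(sum_le0_term hm); rewrite Cm => hh.
    apply: le_trans (c_metric hi0 hi hm hj).
    rewrite -subr_le0; apply: le_trans (le_pospart _) _; apply: hh => k _.
    by case: ifP => _; exact: pospart_ge0.
  + by have [_ _ _ h4] := conn_le inv hm Cm; lia.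
  + by lia.
- move=> j u v hj; case Cj: (conn s j) => /= h1 h2 h3 h4; last by lia.
  case: (ltnP v L) => hv; first by rewrite (leq_ltn_trans h3 hv); exact: h_mono inv _ _ _ hj Cj h2 h3 hv.
  by case: ifP => hu //; exact: rr_h inv _ _ hj Cj h2 hu.
- move=> j u hj; case Cj: (conn s j) => /= h1 h2 h3; last by lia.
  have := rr_le _ hj Cj; rewrite /= Cj => h4; apply: le_trans h4 _.
  by case: ifP => hu //; exact: rr_h inv _ _ hj Cj h2 hu.
- move=> j u hj; case Cj: (conn s j) => /= h1 h2 h3; last by lia.
  case: ifP => hu; first exact: h_al inv _ _ hj Cj h2 hu.
  by have [] := conn_le inv hj Cj.
- move=> m i hm hi; case Cm: (conn s m) => /= h1.
    have [_ _ _ h4] := conn_le inv hm Cm; rewrite h4.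
    apply: le_trans (h_offers inv hm hi Cm); apply: ler_sum_nat => j /= hj.
    case Cj: (conn s j) => //=; case: ifP => // /andP[_]; lia.
  rewrite ltnn; apply: (@le_trans _ _ (fp s i)); last by rewrite (fpE inv); case: ifP => // _; exact: g_ge0.
  apply: le_trans (offers_at_t hi); apply: ler_sum_nat => j /= hj.
  case Cj: (conn s j) => //=; last by rewrite ltnn andbF.
  by have [_ _ _ ->] := conn_le inv hj Cj.
Qed.

End JMS.

(** * From the greedy invariant to the bound on every star *)

Section Bifactor.
Variables (R : realType) (nF nC : nat) (g : nat -> R) (c : nat -> nat -> R).
Hypothesis g_ge0 : forall i, (i < nF)%N -> 0 <= g i.
Hypothesis c_ge0 : forall i j, (i < nF)%N -> (j < nC)%N -> 0 <= c i j.
Variables (L : nat) (s : jstate R) (tl : R) (al : nat -> R) (rk : nat -> nat) (h : nat -> nat -> R).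
Hypothesis inv : jinv nF nC g c L s tl al rk h.
Hypothesis all_conn : forall j, (j < nC)%N -> conn s j.

(** The clients of the star are listed by round of connection, which also makes their times
    nondecreasing, and the constraints [h_offers] are restricted to the star and weakened to the
    form [pay]. *)
Lemma star_dual_bound (i : nat) (S : pred nat) : (i < nF)%N ->
  \sum_(0 <= j < nC | S j) al j <=
  2199%:R / 2000%:R * g i + 447%:R / 250%:R * \sum_(0 <= j < nC | S j) c i j.
Proof.
move=> hi.
pose js := sort (fun a b => (rk a <= rk b)%N) [seq j <- index_iota 0 nC | S j].
pose k := size js; pose q := nth 0%N js.
have sumE (F : nat -> R) : \sum_(0 <= j < nC | S j) F j = \sum_(0 <= m < k) F (q m).
  rewrite -big_filter (perm_big js) /=; first exact: big_nth.
  by rewrite perm_sym perm_sort.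
have q_lt m : (m < k)%N -> (q m < nC)%N.
  move=> hm; have : q m \in js by apply: mem_nth.
  by rewrite mem_sort mem_filter mem_index_iota => /andP[_ /andP[]].
have q_rk a b : (a <= b)%N -> (b < k)%N -> (rk (q a) <= rk (q b))%N.
  move=> ab bk; apply: (@sorted_leq_nth _ (fun a b => (rk a <= rk b)%N)) => //.
  - by move=> x y z; exact: leq_trans.
  - by apply: sort_sorted => x y; exact: leq_total.
  - by rewrite inE; exact: leq_ltn_trans bk.
pose gain m := al (q m) - c i (q m).
(* Every later client [u] bounds the connection cost of an earlier client from below through the
   triangle inequality. The maximum over [u >= m] keeps all these bounds and makes [A]
   nonincreasing; starting it at 0 makes [A] nonnegative. *)
pose A m := \big[Num.max/0]_(m <= u < k) gain u.
have A_ge m u : (m <= u)%N -> (u < k)%N -> gain u <= A m.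
  by move=> h1 h2; apply: le_bigmax_seq => //; rewrite mem_index_iota h1.
have A_le m x : 0 <= x -> (forall u, (m <= u)%N -> (u < k)%N -> gain u <= x) -> A m <= x.
  move=> x0 hx; rewrite /A big_seq; apply: bigmax_le => // u.
  by rewrite mem_index_iota => /andP[h1 h2]; exact: hx.
have A0 m : 0 <= A m by exact: bigmax_ge_id.
have cl m (hm : (m < k)%N) := conn_le inv (q_lt m hm) (all_conn (q_lt m hm)).
have al0 m : (m < k)%N -> 0 <= al (q m) by move=> /cl[].
have c0 m : (m < k)%N -> 0 <= c i (q m) by move=> /q_lt; exact: c_ge0.
have al_eq a b : (a < k)%N -> (b < k)%N -> rk (q a) = rk (q b) -> al (q a) = al (q b).
  move=> ha hb e; apply/eqP; rewrite eq_le.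
  by rewrite !(al_mono inv) ?q_lt ?all_conn ?q_lt ?e.
have tri3 a b u : (a < k)%N -> (b < k)%N -> (u < k)%N ->
    (rk (q a) < rk (q b))%N -> (rk (q b) <= rk (q u))%N ->
    gain u <= h (rk (q b)) (q a) + c i (q a).
  move=> ha hb hu ab bu.
  have := al_tri inv (q_lt _ ha) (q_lt _ hu) hi (all_conn (q_lt _ ha)) (all_conn (q_lt _ hu)) (leq_trans ab bu).
  have [_ _ _ hr] := cl u hu.
  have := h_mono inv (q_lt _ ha) (all_conn (q_lt _ ha)) ab bu hr.
  by rewrite /gain; lra.
have tri2 a b u : (a < k)%N -> (b < k)%N -> (u < k)%N ->
    rk (q a) = rk (q b) -> (rk (q b) <= rk (q u))%N -> gain u <= al (q b) + c i (q a).
  move=> ha hb hu ab bu; move: (bu); rewrite leq_eqVlt => /orP[/eqP e|lt].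
    by rewrite (al_eq b u) // /gain; have := c0 _ ha; have := c0 _ hu; lra.
  have lt' : (rk (q a) < rk (q u))%N by rewrite ab.
  have := al_tri inv (q_lt _ ha) (q_lt _ hu) hi (all_conn (q_lt _ ha)) (all_conn (q_lt _ hu)) lt'.
  have [_ _ _ hr] := cl u hu.
  have := h_al inv (q_lt _ ha) (all_conn (q_lt _ ha)) lt' hr.
  by rewrite (al_eq a b) // /gain; lra.
rewrite !sumE; apply: (@star_bound _ _ _ _ A) => //.
- exact: g_ge0.
- by move=> a b ab bk; rewrite (al_mono inv) ?all_conn ?q_lt ?q_rk //; exact: leq_ltn_trans bk.
- move=> a b ab bk; apply: A_le => // u h1 h2; apply: A_ge => //; exact: leq_trans h1.
- by move=> m hm; have := A_ge m m (leqnn m) hm; rewrite /gain; lra.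
- move=> m hm; apply: A_le => [|u h1 h2]; first by rewrite addr_ge0 ?al0 ?c0.
  by apply: tri2 => //; exact: q_rk.
- move=> m hm; apply: le_trans (h_offers inv (q_lt m hm) hi (all_conn (q_lt m hm))).
  have -> : \sum_(0 <= j < nC) (if conn s j && (rk j < rk (q m))%N
      then pospart (h (rk (q m)) j - c i j) else pospart (al (q m) - c i j)) =
     \sum_(0 <= j < nC | S j) (if conn s j && (rk j < rk (q m))%N
      then pospart (h (rk (q m)) j - c i j) else pospart (al (q m) - c i j)) +
     \sum_(0 <= j < nC | ~~ S j) (if conn s j && (rk j < rk (q m))%N
      then pospart (h (rk (q m)) j - c i j) else pospart (al (q m) - c i j)).
    by rewrite (bigID S).
  apply: (@le_trans _ _ (\sum_(0 <= j < nC | S j) (if conn s j && (rk j < rk (q m))%N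
      then pospart (h (rk (q m)) j - c i j) else pospart (al (q m) - c i j)))); last first.
    by rewrite lerDl; apply: sumr_ge0 => j _; case: ifP => _; exact: pospart_ge0.
  rewrite sumE; apply: ler_sum_nat => a /= ha; rewrite all_conn ?q_lt //= /pay.
  case: (ltnP a m) => am; last first.
    by rewrite ltnNge q_rk.
  have := q_rk a m (ltnW am) hm; rewrite leq_eqVlt => /orP[/eqP e|lt].
    (* Clients of the same round count as unconnected in [h_offers], so here the bound is against
       [al] instead of [h]. *)
    rewrite e ltnn; apply: ler_pospart.
    suff : A m <= al (q m) + c i (q a) by lra.
    apply: A_le => [|u h1 h2]; first by rewrite addr_ge0 ?al0 ?c0.
    by apply: tri2 => //; exact: q_rk.
  rewrite lt; case: (leP 0 (h (rk (q m)) (q a) + c i (q a))) => hh.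
    apply: ler_pospart; suff : A m <= h (rk (q m)) (q a) + c i (q a) by lra.
    by apply: A_le => // u h1 h2; apply: tri3 => //; exact: q_rk.
  (* The invariant does not record the sign of [h]. If this sum is negative, every gain from [m] on
     is negative, so [A m = 0] and [pay] is 0. *)
  apply: (@le_trans _ _ 0); last exact: pospart_ge0.
  have lt0 : A m = 0.
    apply/eqP; rewrite eq_le A0 andbT; apply: A_le => // u h1 h2.
    by apply: le_trans (ltW hh); apply: tri3 => //; exact: q_rk.
  by rewrite lt0 sub0r /pospart ge_max lexx andbT oppr_le0 mulr_ge0 // c0.
Qed.

End Bifactor.

(** * Greedy augmentation *)

Section Potential.
Variable R : realType.

(** For [D <= F] the function [F * u + D * expR (- u)] of [u >= 0] is least at 0; for positive [D]
    this is [1 - u <= expR (- u)]. *)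
Lemma potential_end (F D u : R) : 0 <= F -> D <= F -> 0 <= u ->
  D <= F * u + D * expR (- u).
Proof.
move=> F0 DF u0; have h1 := expR_ge1Dx (- u); have h2 := expR_gt0 (- u).
case: (leP D 0) => D0; last by nra.
have h3 : expR (- u) <= 1 by rewrite -[leRHS]expR0 ler_expR oppr_le0.
by nra.
Qed.

(** Lowering [D] by [s] lowers the least value of [F * u + D * expR (- u)] by at least [f], because
    the step is at least as efficient as the ratio [D / F]. The witness [u'] is the smaller of [u]
    and the minimiser, which is [ln (D / F)], or 0 if [D <= F]. *)
Lemma potential_step (F D f s u : R) : 0 <= F -> 0 <= f -> f <= s -> f * D <= s * F -> 0 <= u ->
  exists2 u', 0 <= u' & f + F * u' + (D - s) * expR (- u') <= F * u + D * expR (- u).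
Proof.
move=> F0 f0 fs fD u0; case: (leP D F) => DF.
  exists 0 => //; rewrite oppr0 expR0.
  by have := potential_end F0 DF u0; lra.
have D0 : 0 < D by apply: le_lt_trans DF.
have e0 := expR_gt0 (- u).
have ee : expR u * expR (- u) = 1 by rewrite -expRD subrr expR0.
case: (leP (F * expR u) D) => FD.
  exists u => //; suff : f <= s * expR (- u) by lra.
  have s0 : 0 <= s by exact: le_trans fs.
  have : F <= D * expR (- u) by rewrite -[F]mulr1 -ee mulrA ler_pM2r.
  move=> h; rewrite -(ler_pM2r D0); apply: le_trans fD _.
  by rewrite -mulrA [expR _ * D]mulrC ler_wpM2l.
have F1 : 0 < F by have := expR_gt0 u; nra.
have q0 : 0 < D / F by rewrite divr_gt0.
have hq : 1 <= D / F by rewrite ler_pdivlMr // mul1r ltW.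
exists (ln (D / F)); first by rewrite ln_ge0.
rewrite [expR (- ln _)]expRN lnK ?posrE // invf_div.
(* The inequality [1 + x <= expR x] at [x = ln (D / F) - u] says that [ln (D / F)] is the
   minimiser. *)
have h1 : 1 + (ln (D / F) - u) <= D / F * expR (- u).
  by rewrite -{2}[D / F]lnK ?posrE // -expRD; exact: expR_ge1Dx.
have h2 : F * (1 + (ln (D / F) - u)) <= D * expR (- u).
  by rewrite mulrC -ler_pdivlMr // mulrAC.
have h3 : (D - s) * (F / D) = F - s * F / D by field; rewrite gt_eqF.
have h4 : f <= s * F / D by rewrite ler_pdivlMr.
by rewrite h3; lra.
Qed.


Lemma expR_ge_partial (x : R) n : 0 <= x -> \sum_(0 <= i < n) x ^+ i / i`!%:R <= expR x.
Proof.
move=> x0; rewrite /expR.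
apply: (@nondecreasing_cvgn_le R (series (exp_coeff x)) _ _ n).
  by apply: nondecreasing_series => i _ _; rewrite /exp_coeff /= divr_ge0 // exprn_ge0.
exact: is_cvg_series_exp_coeff.
Qed.

(** Five terms of the exponential series at 0.419 already exceed 38/25. *)
Lemma ln_scale : ln (38%:R / 25%:R : R) <= 419%:R / 1000%:R.
Proof.
rewrite -ler_expR lnK ?posrE ?divr_gt0 //.
apply: le_trans (@expR_ge_partial _ 5 _); last by rewrite divr_ge0.
pose x : R := 419%:R / 1000%:R; rewrite -/x.
do 5![rewrite big_ltn; last by []]; rewrite big_geq; last by [].
have -> : x ^+ 0 / 0`!%:R + (x ^+ 1 / 1`!%:R + (x ^+ 2 / 2`!%:R + (x ^+ 3 / 3`!%:R +
  (x ^+ 4 / 4`!%:R + 0)))) = 1 + x + x ^+ 2 / 2%:R + x ^+ 3 / 6%:R + x ^+ 4 / 24%:R.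
  by rewrite -[0`!]/1%N -[1`!]/1%N -[2`!]/2%N -[3`!]/6%N -[4`!]/24%N; field.
clear; rewrite /x; lra.
Qed.

End Potential.

(** * The cost of greedy augmentation against any feasible solution *)

Section Augmentation.
Variables (R : realType) (nF nC r : nat) (f : nat -> R) (c : nat -> nat -> R).
Hypothesis r_gt0 : (0 < r)%N.
Hypothesis f_ge0 : forall i, (i < nF)%N -> 0 <= f i.
Hypothesis c_ge0 : forall i j, (i < nF)%N -> (j < nC)%N -> 0 <= c i j.

Definition nat_feasible (y : nat -> nat) (x : nat -> nat -> nat) : Prop :=
  (forall j, (j < nC)%N -> (r <= \sum_(0 <= i < nF) x i j)%N) /\
  (forall i j, (i < nF)%N -> (j < nC)%N -> (x i j <= y i)%N).
Definition fac_cost (y : nat -> nat) : R := \sum_(0 <= i < nF) f i * (y i)%:R.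
Definition con_cost (x : nat -> nat -> nat) : R :=
  \sum_(0 <= i < nF) \sum_(0 <= j < nC) c i j * (x i j)%:R.
Definition open_cost (opn : nat -> bool) : R := \sum_(0 <= i < nF) (if opn i then f i else 0).
Definition saving (rr : nat -> R) i : R := \sum_(0 <= j < nC) pospart (rr j - c i j).
Definition rr_cost (rr : nat -> R) : R := \sum_(0 <= j < nC) rr j.

Section Solution.
Variables (y : nat -> nat) (x : nat -> nat -> nat).
Hypothesis feas : nat_feasible y x.

(* A solution is the superposition, over sites i and levels l < y i, of the stars formed by i and
   the clients j with l < x i j. *)
Lemma star_cover (al g : nat -> R) (gf gc : R) :
  (forall j, (j < nC)%N -> 0 <= al j) ->
  (forall i (S : pred nat), (i < nF)%N -> \sum_(0 <= j < nC | S j) al j <=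
     gf * g i + gc * \sum_(0 <= j < nC | S j) c i j) ->
  r%:R * \sum_(0 <= j < nC) al j <= gf * \sum_(0 <= i < nF) g i * (y i)%:R + gc * con_cost x.
Proof.
move=> al0 hS; have [feas1 feas2] := feas.
have levels i j (a : R) : (i < nF)%N -> (j < nC)%N ->
    \sum_(0 <= l < y i) (if (l < x i j)%N then a else 0) = a * (x i j)%:R.
  move=> hi hj; rewrite (@big_cat_nat _ _ _ (x i j)) ?feas2 //=.
  rewrite (@eq_big_nat _ _ _ _ _ _ (fun=> a)); last by move=> l /andP[_ ->].
  rewrite (@eq_big_nat _ _ _ (x i j) _ _ (fun=> 0)); last by move=> l /andP[h _]; rewrite ltnNge h.
  by rewrite !sumr_const_nat mul0rn addr0 subn0 mulr_natr.
apply: (@le_trans _ _ (\sum_(0 <= i < nF) \sum_(0 <= j < nC) al j * (x i j)%:R)).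
  rewrite exchange_big_nat /= mulr_sumr; apply: ler_sum_nat => j /= hj.
  rewrite -mulr_sumr -natr_sum mulrC ler_wpM2l ?al0 // ler_nat; exact: feas1.
rewrite /con_cost !mulr_sumr -big_split /=; apply: ler_sum_nat => i /= hi.
apply: (@le_trans _ _ (\sum_(0 <= l < y i) \sum_(0 <= j < nC | (l < x i j)%N) al j)).
  under [leRHS]eq_bigr do rewrite big_mkcond /=.
  by rewrite exchange_big_nat /=; apply: ler_sum_nat => j hj; rewrite levels.
apply: (@le_trans _ _ (\sum_(0 <= l < y i) (gf * g i + gc * \sum_(0 <= j < nC | (l < x i j)%N) c i j))).
  by apply: ler_sum_nat => l _; exact: hS.
rewrite big_split /= sumr_const_nat subn0 -[gf * g i *+ _]mulr_natr -mulrA lerD2l -mulr_sumr.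
under [X in gc * X <= _]eq_bigr do rewrite big_mkcond /=.
rewrite exchange_big_nat /= le_eqVlt; apply/orP; left; apply/eqP; congr (_ * _).
by apply: eq_big_nat => j hj; rewrite levels.
Qed.

(** Moving the [r] copies of every client to the connections of [x] saves at least the left side,
    and a site [i] can account for at most [saving rr i] per facility. *)
Lemma savings_lower (rr : nat -> R) : (forall j, (j < nC)%N -> 0 <= rr j) ->
  r%:R * rr_cost rr - con_cost x <= \sum_(0 <= i < nF) saving rr i * (y i)%:R.
Proof.
move=> rr0; have [feas1 feas2] := feas.
apply: (@le_trans _ _ (\sum_(0 <= i < nF) \sum_(0 <= j < nC) (rr j - c i j) * (x i j)%:R)).
  rewrite lerBlDr /con_cost -big_split /=.
  have -> : \sum_(0 <= i < nF) (\sum_(0 <= j < nC) (rr j - c i j) * (x i j)%:R +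
     \sum_(0 <= j < nC) c i j * (x i j)%:R) = \sum_(0 <= i < nF) \sum_(0 <= j < nC) rr j * (x i j)%:R.
    by apply: eq_bigr => i _; rewrite -big_split; apply: eq_bigr => j _; rewrite /=; ring.
  rewrite exchange_big_nat /= /rr_cost mulr_sumr; apply: ler_sum_nat => j /= hj.
  by rewrite -mulr_sumr -natr_sum mulrC ler_wpM2l ?rr0 // ler_nat; exact: feas1.
apply: ler_sum_nat => i /= hi; rewrite /saving mulr_suml; apply: ler_sum_nat => j /= hj.
apply: (@le_trans _ _ (pospart (rr j - c i j) * (x i j)%:R)).
  by rewrite ler_wpM2r ?ler0n // le_pospart.
by rewrite ler_wpM2l ?pospart_ge0 // ler_nat feas2.
Qed.

Lemma fac_cost_ge0 : 0 <= fac_cost y.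
Proof.
by rewrite /fac_cost big_mkord; apply: sumr_ge0 => i _; rewrite mulr_ge0 ?f_ge0.
Qed.

End Solution.

Definition approx : R := 15186%:R / 10000%:R.

(* With D := r * rr_cost rr - con_cost x, the minimum over u >= 0 of F * u + D * exp (- u) bounds
   what greedy augmentation still has to pay on top of the cost already accounted for. *)
Definition on_track (opn : nat -> bool) (rr : nat -> R) : Prop :=
  forall y x, nat_feasible y x -> exists2 u, 0 <= u &
    r%:R * open_cost opn + fac_cost y * u
    + (r%:R * rr_cost rr - con_cost x) * expR (- u) + con_cost x
    <= approx * (fac_cost y + con_cost x).

(** Dividing the star bound by 38/25 leaves the connection cost with coefficient 25/38, which is
    [expR (- u)] at [u = ln (38/25)]. *)
Lemma on_track_init opn rr (al : nat -> R) :
  (forall j, (j < nC)%N -> 0 <= al j) ->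
  (forall i (S : pred nat), (i < nF)%N -> \sum_(0 <= j < nC | S j) al j <=
     2199%:R / 2000%:R * (38%:R / 25%:R * f i) + 447%:R / 250%:R * \sum_(0 <= j < nC | S j) c i j) ->
  \sum_(0 <= j < nC) al j = 38%:R / 25%:R * open_cost opn + rr_cost rr ->
  on_track opn rr.
Proof.
move=> al0 hS pay y x feas; exists (ln (38%:R / 25%:R)).
  by rewrite ln_ge0 // ler_pdivlMr ?mul1r ?ltr0n // ler_nat.
have h1 := star_cover feas al0 hS; have h2 := ln_scale R; have F0 := fac_cost_ge0 y.
have C0 : 0 <= con_cost x.
  rewrite /con_cost big_mkord; apply: sumr_ge0 => i _; rewrite big_mkord.
  by apply: sumr_ge0 => j _; rewrite mulr_ge0 ?c_ge0.
have e : \sum_(0 <= i < nF) 38%:R / 25%:R * f i * (y i)%:R = 38%:R / 25%:R * fac_cost y.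
  by rewrite /fac_cost mulr_sumr; apply: eq_bigr => i _; rewrite mulrA.
rewrite e pay in h1; rewrite expRN lnK ?posrE ?divr_gt0 ?ltr0n // invf_div.
have h3 : fac_cost y * ln (38%:R / 25%:R) <= fac_cost y * (419%:R / 1000%:R) by rewrite ler_wpM2l.
move: h1 h3 F0 C0; rewrite /approx; move: (fac_cost y) (con_cost x) (open_cost opn) (rr_cost rr) (ln _) (r%:R).
by move=> F C O D l q; lra.
Qed.

Lemma on_track_step opn rr b : on_track opn rr -> (b < nF)%N ->
  (forall j, (j < nC)%N -> 0 <= rr j) ->
  f b <= saving rr b ->
  (forall i, (i < nF)%N -> saving rr i * f b <= saving rr b * f i) ->
  on_track (fun i => (i == b) || opn i) (fun j => if c b j < rr j then c b j else rr j).
Proof.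
move=> ot hb rr0 fs best y x feas; have [u u0 hu] := ot y x feas.
have q0 : 0 < r%:R :> R by rewrite ltr0n.
have fb0 := f_ge0 hb.
(* The best ratio of saving to price is at least the average ratio over the facilities of [y], and
   [savings_lower] bounds that average. *)
have key : r%:R * f b * (r%:R * rr_cost rr - con_cost x) <= r%:R * saving rr b * fac_cost y.
  rewrite -!mulrA ler_pM2l //.
  apply: (@le_trans _ _ (f b * \sum_(0 <= i < nF) saving rr i * (y i)%:R)).
    by rewrite ler_wpM2l // savings_lower.
  rewrite /fac_cost !mulr_sumr; apply: ler_sum_nat => i /= hi.
  by rewrite !mulrA ler_wpM2r ?ler0n // mulrC best.
have [|u' u'0 hu'] := potential_step (fac_cost_ge0 y) (mulr_ge0 (ltW q0) fb0) _ key u0.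
  by rewrite ler_pM2l.
exists u' => //.
have hF : open_cost (fun i => (i == b) || opn i) <= open_cost opn + f b.
  have -> : f b = \sum_(0 <= i < nF) (if i == b then f i else 0).
    rewrite big_mkord (bigD1 (Ordinal hb)) //= eqxx big1 ?addr0 // => i hi.
    by rewrite -val_eqE /= in hi; rewrite (negPf hi).
  rewrite /open_cost -big_split /=; apply: ler_sum_nat => i /= hi.
  by case: eqP => _ /=; case: (opn i); rewrite ?add0r ?addr0 ?lerDr ?f_ge0.
have hC : rr_cost (fun j => if c b j < rr j then c b j else rr j) = rr_cost rr - saving rr b.
  rewrite /rr_cost /saving -sumrB; apply: eq_bigr => j _; rewrite /pospart.
  case: ltP => hh; first by rewrite max_l ?subr_ge0 ?ltW // subKr.
  by rewrite max_r ?subr0 // subr_le0.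
have hF' : r%:R * open_cost (fun i => (i == b) || opn i) <= r%:R * open_cost opn + r%:R * f b.
  by rewrite -mulrDr ler_pM2l.
have e : r%:R * (rr_cost rr - saving rr b) - con_cost x = r%:R * rr_cost rr - con_cost x - r%:R * saving rr b by ring.
by rewrite hC e; lra.
Qed.

Lemma on_track_end opn rr : on_track opn rr ->
  (forall j, (j < nC)%N -> 0 <= rr j) ->
  (forall i, (i < nF)%N -> saving rr i <= f i) ->
  forall y x, nat_feasible y x ->
    r%:R * (open_cost opn + rr_cost rr) <= approx * (fac_cost y + con_cost x).
Proof.
move=> ot rr0 le y x feas; have [u u0 hu] := ot y x feas.
have DF : r%:R * rr_cost rr - con_cost x <= fac_cost y.
  apply: le_trans (savings_lower feas rr0) _; rewrite /fac_cost; apply: ler_sum_nat => i /= hi.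
  by rewrite ler_wpM2r ?ler0n // le.
by have := potential_end (fac_cost_ge0 y) DF u0; rewrite mulrDr; lra.
Qed.

End Augmentation.

(** * A structured language compiled to the machine *)

(** [N] commands act on natural-number registers, [X] commands on real ones. [Get] reads and [Set]
    writes a cell of array [k]; [For a b c] runs [c] with [a] counting from 0 up to register [b]. *)
Inductive cmd : Type :=
| Skip
| NC (a k : nat)
| NA (a b c : nat)
| XC (a k : nat)
| XA (a b c : nat)
| XS (a b c : nat)
| XM (a b c : nat)
| XD (a b c : nat)
| NGet (a k b : nat)
| NSet (k a b : nat)
| XGet (a k b : nat)
| XSet (k a b : nat)
| Seq (c1 c2 : cmd)
| IfN (a b : nat) (c1 c2 : cmd)
| IfX (a b : nat) (c1 c2 : cmd)
| For (a b : nat) (c : cmd).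

Section Semantics.
Variable R : realType.

Record hst := HS { nr : nat -> nat; xr : nat -> R;
  na : nat -> nat -> nat; xa : nat -> nat -> R; clk : nat }.

Definition upd2 {T : Type} (m : nat -> nat -> T) k i v : nat -> nat -> T :=
  fun k' i' => if (k' == k) && (i' == i) then v else m k' i'.
Definition tick n s := HS (nr s) (xr s) (na s) (xa s) (clk s + n).
Definition set_nr a v s := HS (upd (nr s) a v) (xr s) (na s) (xa s) (clk s).
Definition set_xr a v s := HS (nr s) (upd (xr s) a v) (na s) (xa s) (clk s).
Definition set_na k i v s := HS (nr s) (xr s) (upd2 (na s) k i v) (xa s) (clk s).
Definition set_xa k i v s := HS (nr s) (xr s) (na s) (upd2 (xa s) k i v) (clk s).

Definition incr_nr a s := set_nr a (nr s a + 1)%N s.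

(** The ticks are exact counts of executed machine instructions: 7 for an array access, and 4 per
    iteration plus 3 per loop for the loop control. *)
Fixpoint heval (c : cmd) (s : hst) : hst :=
  match c with
  | Skip => s
  | NC a k => tick 1 (set_nr a k s)
  | NA a b c => tick 1 (set_nr a (nr s b + nr s c)%N s)
  | XC a k => tick 1 (set_xr a k%:R s)
  | XA a b c => tick 1 (set_xr a (xr s b + xr s c) s)
  | XS a b c => tick 1 (set_xr a (xr s b - xr s c) s)
  | XM a b c => tick 1 (set_xr a (xr s b * xr s c) s)
  | XD a b c => tick 1 (set_xr a (xr s b / xr s c) s)
  | NGet a k b => tick 7 (set_nr a (na s k (nr s b)) s)
  | NSet k a b => tick 7 (set_na k (nr s a) (nr s b) s)
  | XGet a k b => tick 7 (set_xr a (xa s k (nr s b)) s)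
  | XSet k a b => tick 7 (set_xa k (nr s a) (xr s b) s)
  | Seq c1 c2 => heval c2 (heval c1 s)
  | IfN a b c1 c2 => if (nr s a < nr s b)%N then heval c1 (tick 1 s) else tick 1 (heval c2 (tick 1 s))
  | IfX a b c1 c2 => if xr s a < xr s b then heval c1 (tick 1 s) else tick 1 (heval c2 (tick 1 s))
  | For a b c => tick 2 (iter (nr s b) (fun s' => incr_nr a (tick 4 (heval c s')))
                   (tick 1 (set_nr a 0%N s)))
  end.

Fixpoint writes (c : cmd) : seq nat :=
  match c with
  | NC a _ | NA a _ _ | NGet a _ _ => [:: a]
  | Seq c1 c2 | IfN _ _ c1 c2 | IfX _ _ c1 c2 => writes c1 ++ writes c2
  | For a _ c => a :: writes c
  | _ => [::]
  end.

(** Natural-number registers from 60 on are reserved for address computation. A loop body writes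
    neither the counter nor the limit, so the number of iterations is fixed on entry, as [heval]
    assumes. *)
Fixpoint wf (c : cmd) : bool :=
  match c with
  | Skip => true
  | NC a _ => (a < 60)%N
  | NA a b c => [&& a < 60, b < 60 & c < 60]%N
  | XC a _ => (a < 64)%N
  | XA a b c | XS a b c | XM a b c | XD a b c => [&& a < 64, b < 64 & c < 64]%N
  | NGet a k b | NSet k a b => [&& k < 8, a < 60 & b < 60]%N
  | XGet a k b => [&& k < 8, a < 64 & b < 60]%N
  | XSet k a b => [&& k < 8, a < 60 & b < 64]%N
  | Seq c1 c2 => wf c1 && wf c2
  | IfN a b c1 c2 => [&& a < 60, b < 60, wf c1 & wf c2]%N
  | IfX a b c1 c2 => [&& a < 64, b < 64, wf c1 & wf c2]%N
  | For a b c => [&& a < 60, b < 60, a != b, a \notin writes c, b \notin writes c & wf c]%N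
  end.

Lemma nr_heval c s a : a \notin writes c -> nr (heval c s) a = nr s a.
Proof.
elim: c s => //=.
- by move=> b k s; rewrite inE /upd => /negPf ->.
- by move=> b k l s; rewrite inE /upd => /negPf ->.
- by move=> b k l s; rewrite inE /upd => /negPf ->.
- by move=> c1 IH1 c2 IH2 s; rewrite mem_cat negb_or => /andP[h1 h2]; rewrite IH2 // IH1.
- move=> b d c1 IH1 c2 IH2 s; rewrite mem_cat negb_or => /andP[h1 h2].
  by case: ifP => _ /=; rewrite ?IH1 ?IH2.
- move=> b d c1 IH1 c2 IH2 s; rewrite mem_cat negb_or => /andP[h1 h2].
  by case: ifP => _ /=; rewrite ?IH1 ?IH2.
- move=> b d c IH s; rewrite inE negb_or => /andP[/negPf h1 h2].
  elim: (nr s d) => [|n IHn] /=; first by rewrite /upd h1.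
  by rewrite /upd h1 IH.
Qed.

Lemma for_inv (I : nat -> hst -> Prop) a b c s :
  a \notin writes c -> b \notin writes c -> a != b ->
  I 0%N (tick 1 (set_nr a 0%N s)) ->
  (forall i s', (i < nr s b)%N -> I i s' -> nr s' a = i -> nr s' b = nr s b ->
     I i.+1 (incr_nr a (tick 4 (heval c s')))) ->
  exists s', [/\ heval (For a b c) s = tick 2 s', I (nr s b) s', nr s' a = nr s b & nr s' b = nr s b].
Proof.
move=> ha hb ab I0 IS; rewrite /=.
set F := fun s' => incr_nr a _; set s0 := tick 1 _.
exists (iter (nr s b) F s0); split => //.
all: have H : forall n, (n <= nr s b)%N ->
  [/\ I n (iter n F s0), nr (iter n F s0) a = n & nr (iter n F s0) b = nr s b].
1,3,5: elim=> [|n IH] hn; first by split=> //=; rewrite /upd ?eqxx // eq_sym (negPf ab).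
1,2,3: have [h1 h2 h3] := IH (ltnW hn); split; first exact: IS.
1,3,5: by rewrite iterS {1}/F /= /upd eqxx nr_heval // h2 addn1.
1,2,3: by rewrite iterS {1}/F /= /upd eq_sym (negPf ab) nr_heval.
all: by have [] := H _ (leqnn _).
Qed.

(** The machine cannot multiply naturals, so [8 * i] comes from three doublings. Interleaving eight
    arrays with stride 8 lets each of them be unbounded. *)
Definition addr k b : seq instr :=
  [:: NAdd 61 b b; NAdd 61 61 61; NAdd 61 61 61; NAdd 61 61 60; NConst 62 k; NAdd 61 61 62].

Fixpoint csize (c : cmd) : nat :=
  match c with
  | Skip => 0
  | NGet _ _ _ | NSet _ _ _ | XGet _ _ _ | XSet _ _ _ => 7
  | Seq c1 c2 => csize c1 + csize c2
  | IfN _ _ c1 c2 | IfX _ _ c1 c2 => 2 + csize c2 + csize c1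
  | For _ _ c => 6 + csize c
  | _ => 1
  end.

Fixpoint comp (p : nat) (c : cmd) : seq instr :=
  match c with
  | Skip => [::]
  | NC a k => [:: NConst a k]
  | NA a b c => [:: NAdd a b c]
  | XC a k => [:: XConst a k]
  | XA a b c => [:: XAdd a b c]
  | XS a b c => [:: XSub a b c]
  | XM a b c => [:: XMul a b c]
  | XD a b c => [:: XDiv a b c]
  | NGet a k b => addr k b ++ [:: NLoad a 61]
  | NSet k a b => addr k a ++ [:: NStore 61 b]
  | XGet a k b => addr k b ++ [:: XLoad a 61]
  | XSet k a b => addr k a ++ [:: XStore 61 b]
  | Seq c1 c2 => comp p c1 ++ comp (p + csize c1) c2
  | IfN a b c1 c2 => [:: JmpNLt a b (p + 2 + csize c2)] ++ comp (p + 1) c2 ++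
      [:: Jmp (p + 2 + csize c2 + csize c1)] ++ comp (p + 2 + csize c2) c1
  | IfX a b c1 c2 => [:: JmpXLt a b (p + 2 + csize c2)] ++ comp (p + 1) c2 ++
      [:: Jmp (p + 2 + csize c2 + csize c1)] ++ comp (p + 2 + csize c2) c1
  | For a b c => [:: NConst a 0; JmpNLt a b (p + 3); Jmp (p + 6 + csize c)] ++
      comp (p + 3) c ++ [:: NConst 61 1; NAdd a a 61; Jmp (p + 1)]
  end.

Lemma size_comp p c : size (comp p c) = csize c.
Proof.
elim: c p => //=.
- by move=> c1 IH1 c2 IH2 p; rewrite size_cat IH1 IH2.
- by move=> a b c1 IH1 c2 IH2 p; rewrite size_cat /= IH1 IH2; lia.
- by move=> a b c1 IH1 c2 IH2 p; rewrite size_cat /= IH1 IH2; lia.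
- by move=> a b c IH p; rewrite size_cat /= IH; lia.
Qed.

Definition code_at (P : seq instr) p (code : seq instr) : Prop :=
  forall i, (i < size code)%N -> nth Halt P (p + i) = nth Halt code i.

Lemma code_at_cons P p i code : code_at P p (i :: code) ->
  nth Halt P p = i /\ code_at P p.+1 code.
Proof.
move=> h; split; first by have := h 0%N isT; rewrite addn0.
by move=> j hj; rewrite addSnnS; exact: (h j.+1).
Qed.

Lemma code_at_cat P p c1 c2 : code_at P p (c1 ++ c2) ->
  code_at P p c1 /\ code_at P (p + size c1) c2.
Proof.
move=> h; split=> i hi.
  by rewrite h ?nth_cat ?hi // size_cat; lia.
by rewrite -addnA h ?size_cat ?ltn_add2l // nth_cat ltnNge leq_addr addKn.
Qed.

(** Quantifying over the remaining steps [u] makes runs compose and gives the result for every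
    larger time bound. *)
Definition runs (P : seq instr) T (s s' : mstate R) : Prop :=
  forall u, exec P (T + u)%N s = exec P u s'.

Lemma runs_trans P T1 T2 s1 s2 s3 : runs P T1 s1 s2 -> runs P T2 s2 s3 -> runs P (T1 + T2)%N s1 s3.
Proof. by move=> h1 h2 u; rewrite -addnA h1 h2. Qed.

Lemma runs1 P s s' : step P s = Some s' -> runs P 1 s s'.
Proof. by move=> h u; rewrite add1n /= h. Qed.

Lemma runsS P T s1 s2 s3 : step P s1 = Some s2 -> runs P T s2 s3 -> runs P T.+1 s1 s3.
Proof. by move=> h1 h2; rewrite -add1n; apply: runs_trans h2; exact: runs1. Qed.

(* Cell i of array k is stored at address off + 8 * i + k; the natural-number registers 60, 61 and 62
   hold off and two scratch values. *)
Definition represents off (s : hst) (N : nat -> nat) (X : nat -> R) : Prop :=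
  [/\ (forall a, (a < 60)%N -> N a = nr s a) /\ N 60%N = off,
      forall a, (a < 64)%N -> X a = xr s a,
      forall k i, (k < 8)%N -> N (off + 8 * i + k)%N = na s k i
    & forall k i, (k < 8)%N -> X (off + 8 * i + k)%N = xa s k i].

Variables (P : seq instr) (off : nat).
Hypothesis off_ge : (64 <= off)%N.

Lemma rep_tick n s N X : represents off s N X -> represents off (tick n s) N X.
Proof. by []. Qed.

Lemma rep_nr s N X a v N' : represents off s N X -> (a < 60)%N ->
  N' a = v -> (forall b, b != a -> b != 61%N -> b != 62%N -> N' b = N b) ->
  represents off (set_nr a v s) N' X.
Proof.
move=> [[h1 h1'] h2 h3 h4] ha e1 e2; split=> //=.
- split; last by rewrite e2 //; lia.
  move=> b hb; rewrite /upd; case: eqP => [->//|/eqP hba].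
  by rewrite e2 ?h1 //; lia.
- by move=> k i hk; rewrite e2 ?h3 //; lia.
Qed.

Lemma rep_scratch s N X N' : represents off s N X ->
  (forall b, b != 61%N -> b != 62%N -> N' b = N b) -> represents off s N' X.
Proof.
move=> [[h1 h1'] h2 h3 h4] e2; split=> //=.
- split; last by rewrite e2.
  by move=> b hb; rewrite e2 ?h1 //; lia.
- by move=> k i hk; rewrite e2 ?h3 //; lia.
Qed.

Lemma rep_xr s N X a v : represents off s N X -> (a < 64)%N ->
  represents off (set_xr a v s) N (upd X a v).
Proof.
move=> [[h1 h1'] h2 h3 h4] ha; split=> //=.
- by move=> b hb; rewrite /upd; case: eqP => // _; exact: h2.
- by move=> k i hk; rewrite /upd ifF ?h4 //; apply/eqP; lia.
Qed.

Lemma rep_na s N X k i v : represents off s N X -> (k < 8)%N ->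
  represents off (set_na k i v s) (upd N (off + 8 * i + k)%N v) X.
Proof.
move=> [[h1 h1'] h2 h3 h4] hk; split=> //=.
- split; last by rewrite /upd ifF // ; apply/eqP; lia.
  by move=> b hb; rewrite /upd ifF ?h1 //; apply/eqP; lia.
- move=> k' i' hk'; rewrite /upd /upd2.
  case: (boolP ((k' == k) && (i' == i))) => [/andP[/eqP -> /eqP ->]|h]; first by rewrite eqxx.
  rewrite ifF ?h3 //; apply/eqP => e; move/negP: h; apply; apply/andP; split; apply/eqP; lia.
Qed.

Lemma rep_xa s N X k i v : represents off s N X -> (k < 8)%N ->
  represents off (set_xa k i v s) N (upd X (off + 8 * i + k)%N v).
Proof.
move=> [[h1 h1'] h2 h3 h4] hk; split=> //=.
- by move=> b hb; rewrite /upd ifF ?h2 //; apply/eqP; lia.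
- move=> k' i' hk'; rewrite /upd /upd2.
  case: (boolP ((k' == k) && (i' == i))) => [/andP[/eqP -> /eqP ->]|h]; first by rewrite eqxx.
  rewrite ifF ?h4 //; apply/eqP => e; move/negP: h; apply; apply/andP; split; apply/eqP; lia.
Qed.

Lemma runs_addr p k b s N X : represents off s N X -> (k < 8)%N -> (b < 60)%N ->
  code_at P p (addr k b) ->
  exists N', [/\ represents off s N' X, N' 61%N = (off + 8 * nr s b + k)%N,
     runs P 6 (MState p N X) (MState (p + 6) N' X) & forall a, (a < 60)%N -> N' a = nr s a].
Proof.
move=> hr hk hb.
case/code_at_cons=> i1 /code_at_cons[i2 /code_at_cons[i3 /code_at_cons[i4 /code_at_cons[i5 /code_at_cons[i6 _]]]]].
have [[r1 r1'] _ _ _] := hr.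
pose N1 := upd N 61 (N b + N b)%N; pose N2 := upd N1 61 (N1 61 + N1 61)%N.
pose N3 := upd N2 61 (N2 61 + N2 61)%N; pose N4 := upd N3 61 (N3 61 + N3 60)%N.
pose N5 := upd N4 62 k; pose N6 := upd N5 61 (N5 61 + N5 62)%N.
have fr a : a != 61%N -> a != 62%N -> N6 a = N a.
  by move=> /negPf h1 /negPf h2; rewrite /N6 /N5 /N4 /N3 /N2 /N1 /upd h1 h2.
have hr' := rep_scratch hr fr.
exists N6; split=> //.
- by rewrite /N6 /N5 /N4 /N3 /N2 /N1 /upd /= r1 // r1'; lia.
- rewrite addnS addnS addnS addnS addnS addnS addn0.
  apply: (@runsS _ _ _ (MState p.+1 N1 X)); first by rewrite /step /= i1.
  apply: (@runsS _ _ _ (MState p.+2 N2 X)); first by rewrite /step /= i2.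
  apply: (@runsS _ _ _ (MState p.+3 N3 X)); first by rewrite /step /= i3.
  apply: (@runsS _ _ _ (MState p.+4 N4 X)); first by rewrite /step /= i4.
  apply: (@runsS _ _ _ (MState p.+4.+1 N5 X)); first by rewrite /step /= i5.
  by apply: runs1; rewrite /step /= i6.
- by case: hr' => [[]].
Qed.

(** The same [T] counts machine steps and clock ticks, so a bound on [clk] is a bound on the running
    time. *)
Theorem comp_correct c p s N X : wf c -> code_at P p (comp p c) -> represents off s N X ->
  exists N' X' T, [/\ represents off (heval c s) N' X', clk (heval c s) = (clk s + T)%N
    & runs P T (MState p N X) (MState (p + csize c) N' X')].
Proof.
elim: c p s N X.
- by move=> p s N X _ _ hr; exists N, X, 0%N; rewrite /= !addn0.
- move=> a k p s N X /= ha /code_at_cons[i1 _] hr; exists (upd N a k), X, 1%N; split=> //.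
    by apply: rep_tick; apply: rep_nr hr _ _ _; rewrite // /upd ?eqxx // => b /negPf ->.
  by apply: runs1; rewrite /step /= i1 addn1.
- move=> a b c p s N X /= /and3P[ha hb hc] /code_at_cons[i1 _] hr.
  have [[r1 _] _ _ _] := hr.
  exists (upd N a (N b + N c)%N), X, 1%N; split=> //.
    apply: rep_tick; apply: rep_nr hr _ _ _; rewrite // /upd ?eqxx ?r1 //.
    by move=> d /negPf ->.
  by apply: runs1; rewrite /step /= i1 addn1.
- move=> a k p s N X /= ha /code_at_cons[i1 _] hr; exists N, (upd X a k%:R), 1%N; split=> //.
    by apply: rep_tick; exact: rep_xr.
  by apply: runs1; rewrite /step /= i1 addn1.
- move=> a b c p s N X /= /and3P[ha hb hc] /code_at_cons[i1 _] hr.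
  have [_ r1 _ _] := hr; exists N, (upd X a (X b + X c)), 1%N; split=> //.
    by rewrite !r1 //; apply: rep_tick; exact: rep_xr.
  by apply: runs1; rewrite /step /= i1 addn1.
- move=> a b c p s N X /= /and3P[ha hb hc] /code_at_cons[i1 _] hr.
  have [_ r1 _ _] := hr; exists N, (upd X a (X b - X c)), 1%N; split=> //.
    by rewrite !r1 //; apply: rep_tick; exact: rep_xr.
  by apply: runs1; rewrite /step /= i1 addn1.
- move=> a b c p s N X /= /and3P[ha hb hc] /code_at_cons[i1 _] hr.
  have [_ r1 _ _] := hr; exists N, (upd X a (X b * X c)), 1%N; split=> //.
    by rewrite !r1 //; apply: rep_tick; exact: rep_xr.
  by apply: runs1; rewrite /step /= i1 addn1.
- move=> a b c p s N X /= /and3P[ha hb hc] /code_at_cons[i1 _] hr.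
  have [_ r1 _ _] := hr; exists N, (upd X a (X b / X c)), 1%N; split=> //.
    by rewrite !r1 //; apply: rep_tick; exact: rep_xr.
  by apply: runs1; rewrite /step /= i1 addn1.
- move=> a k b p s N X /and3P[hk ha hb] /(@code_at_cat _ _ (addr k b))[h1 /code_at_cons[h2 _]] hr.
  have [N1 [r1 e1 run1 _]] := runs_addr hr hk hb h1.
  have [_ _ r2 _] := r1; exists (upd N1 a (N1 (N1 61%N))), X, 7%N; split=> //.
    rewrite e1 r2 //=; apply: rep_tick; apply: rep_nr r1 _ _ _; rewrite // /upd ?eqxx //.
    by move=> d /negPf ->.
  rewrite -[7%N]/(6 + 1)%N; apply: (runs_trans run1); apply: runs1; rewrite /step /= h2 /=.
  by congr (Some (MState _ _ _)); lia.
- move=> k a b p s N X /and3P[hk ha hb] /(@code_at_cat _ _ (addr k a))[h1 /code_at_cons[h2 _]] hr.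
  have [N1 [r1 e1 run1 n1]] := runs_addr hr hk ha h1.
  exists (upd N1 (N1 61%N) (N1 b)), X, 7%N; split=> //.
    by rewrite e1 n1 //=; apply: rep_tick; exact: rep_na.
  rewrite -[7%N]/(6 + 1)%N; apply: (runs_trans run1); apply: runs1; rewrite /step /= h2 /=.
  by congr (Some (MState _ _ _)); lia.
- move=> a k b p s N X /and3P[hk ha hb] /(@code_at_cat _ _ (addr k b))[h1 /code_at_cons[h2 _]] hr.
  have [N1 [r1 e1 run1 n1]] := runs_addr hr hk hb h1.
  have [_ _ _ r2] := r1; exists N1, (upd X a (X (N1 61%N))), 7%N; split=> //.
    by rewrite e1 r2 //=; apply: rep_tick; exact: rep_xr.
  rewrite -[7%N]/(6 + 1)%N; apply: (runs_trans run1); apply: runs1; rewrite /step /= h2 /=.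
  by congr (Some (MState _ _ _)); lia.
- move=> k a b p s N X /and3P[hk ha hb] /(@code_at_cat _ _ (addr k a))[h1 /code_at_cons[h2 _]] hr.
  have [N1 [r1 e1 run1 n1]] := runs_addr hr hk ha h1.
  have [_ r2 _ _] := r1; exists N1, (upd X (N1 61%N) (X b)), 7%N; split=> //.
    by rewrite e1 r2 //=; apply: rep_tick; exact: rep_xa.
  rewrite -[7%N]/(6 + 1)%N; apply: (runs_trans run1); apply: runs1; rewrite /step /= h2 /=.
  by congr (Some (MState _ _ _)); lia.
- move=> c1 IH1 c2 IH2 p s N X /andP[w1 w2] /code_at_cat[h1]; rewrite size_comp => h2 hr.
  have [N1 [X1 [T1 [r1 k1 run1]]]] := IH1 _ _ _ _ w1 h1 hr.
  have [N2 [X2 [T2 [r2 k2 run2]]]] := IH2 _ _ _ _ w2 h2 r1.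
  exists N2, X2, (T1 + T2)%N; split=> //=; first by rewrite k2 k1 addnA.
  by rewrite addnA; exact: runs_trans run2.
- move=> a b c1 IH1 c2 IH2 p s N X /and4P[ha hb w1 w2] /code_at_cons[i1] /code_at_cat[h2].
  rewrite size_comp -addn1 => /code_at_cons[i3 h1] hr.
  have [[r0 _] _ _ _] := hr; rewrite -addn1 in h2.
  have h1' : code_at P (p + 2 + csize c2) (comp (p + 2 + csize c2) c1).
    by move: h1; congr code_at; lia.
  case: (boolP (nr s a < nr s b)%N) => hab.
    have [N1 [X1 [T1 [r1 k1 run1]]]] := IH1 _ _ _ _ w1 h1' (rep_tick 1 hr).
    exists N1, X1, T1.+1; rewrite /= hab; split=> //; first by rewrite k1 /=; lia.
    apply: (@runsS _ _ _ (MState (p + 2 + csize c2) N X)); first by rewrite /step /= i1 !r0 // hab.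
    by move: run1; congr runs; congr MState; lia.
  have [N1 [X1 [T1 [r1 k1 run1]]]] := IH2 _ _ _ _ w2 h2 (rep_tick 1 hr).
  exists N1, X1, (T1.+2)%N; rewrite /= (negPf hab); split=> //; first by rewrite /= k1 /=; lia.
  apply: (@runsS _ _ _ (MState (p + 1) N X)); first by rewrite /step /= i1 !r0 // (negPf hab) addn1.
  rewrite -addn1; apply: (runs_trans run1); apply: runs1; rewrite /step /= i3.
  by congr (Some (MState _ _ _)); lia.
- move=> a b c1 IH1 c2 IH2 p s N X /and4P[ha hb w1 w2] /code_at_cons[i1] /code_at_cat[h2].
  rewrite size_comp -addn1 => /code_at_cons[i3 h1] hr.
  have [_ r0 _ _] := hr; rewrite -addn1 in h2.
  have h1' : code_at P (p + 2 + csize c2) (comp (p + 2 + csize c2) c1).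
    by move: h1; congr code_at; lia.
  case: (boolP (xr s a < xr s b)) => hab.
    have [N1 [X1 [T1 [r1 k1 run1]]]] := IH1 _ _ _ _ w1 h1' (rep_tick 1 hr).
    exists N1, X1, T1.+1; rewrite /= hab; split=> //; first by rewrite k1 /=; lia.
    apply: (@runsS _ _ _ (MState (p + 2 + csize c2) N X)); first by rewrite /step /= i1 !r0 // hab.
    by move: run1; congr runs; congr MState; lia.
  have [N1 [X1 [T1 [r1 k1 run1]]]] := IH2 _ _ _ _ w2 h2 (rep_tick 1 hr).
  exists N1, X1, (T1.+2)%N; rewrite /= (negPf hab); split=> //; first by rewrite /= k1 /=; lia.
  apply: (@runsS _ _ _ (MState (p + 1) N X)); first by rewrite /step /= i1 !r0 // (negPf hab) addn1.
  rewrite -addn1; apply: (runs_trans run1); apply: runs1; rewrite /step /= i3.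
  by congr (Some (MState _ _ _)); lia.
- move=> a b c IH p s N X /and5P[ha hb ab na1 /andP[nb1 w]].
  case/code_at_cons=> i1 /code_at_cons[i2 /code_at_cons[i3 /code_at_cat[h]]].
  rewrite size_comp => /code_at_cons[i4 /code_at_cons[i5 /code_at_cons[i6 _]]] hr.
  have {}h : code_at P (p + 3) (comp (p + 3) c) by move: h; congr code_at; lia.
  set F := fun s' => incr_nr a (tick 4 (heval c s')).
  (* Induction on the number [m] of iterations left, with an arbitrary counter, because the machine
     reenters at the test. *)
  have loop m s1 N1 X1 : represents off s1 N1 X1 -> (nr s1 a + m = nr s1 b)%N ->
    exists N2 X2 T, [/\ represents off (iter m F s1) N2 X2, clk (tick 2 (iter m F s1)) = (clk s1 + T)%N
      & runs P T (MState p.+1 N1 X1) (MState (p + (6 + csize c)) N2 X2)].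
    elim: m s1 N1 X1 => [|m IHm] s1 N1 X1 hr1 hm.
      have [[r0 _] _ _ _] := hr1; exists N1, X1, 2%N; split=> //=.
      apply: (@runsS _ _ _ (MState p.+2 N1 X1)).
        by rewrite /step /= i2 !r0 // ifF //; lia.
      by apply: runs1; rewrite /step /= i3; congr (Some (MState _ _ _)); lia.
    have [[r0 _] _ _ _] := hr1.
    have [N2 [X2 [T2 [r2 k2 run2]]]] := IH _ _ _ _ w h hr1.
    have [[r0' _] _ _ _] := r2.
    have ea : nr (heval c s1) a = nr s1 a by rewrite nr_heval.
    have eb : nr (heval c s1) b = nr s1 b by rewrite nr_heval.
    pose N3 := upd (upd N2 61 1%N) a (N2 a + 1)%N.
    have r3 : represents off (F s1) N3 X2.
      rewrite /F /incr_nr; apply: rep_nr (rep_tick 4 r2) _ _ _ => //.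
        by rewrite /N3 /upd eqxx /= r0'.
      by move=> d /negPf h1 /negPf h2 _; rewrite /N3 /upd h1 h2.
    have hm' : (nr (F s1) a + m = nr (F s1) b)%N.
      by rewrite /F /= /upd eqxx eq_sym (negPf ab) ea eb; lia.
    have [N4 [X4 [T4 [r4 k4 run4]]]] := IHm _ _ _ r3 hm'.
    exists N4, X4, (1 + (T2 + (3 + T4)))%N; rewrite iterSr; split=> //.
      by rewrite k4 /= k2; lia.
    apply: runs_trans; first by apply: (@runs1 _ _ (MState (p + 3) N1 X1)); rewrite /step /= i2 !r0 // ifT //; lia.
    apply: (runs_trans run2).
    have q1 : (p + 3 + csize c = (p.+3 + csize c))%N by lia.
    rewrite q1; apply: runs_trans run4.
    apply: (@runsS _ _ _ (MState (p.+3 + csize c).+1 (upd N2 61 1%N) X2)); first by rewrite /step /= i4.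
    apply: (@runsS _ _ _ (MState (p.+3 + csize c).+2 N3 X2)).
      rewrite /step /= i5 /N3; congr (Some (MState _ _ _)).
      by rewrite /upd /= [in LHS](_ : a == 61%N = false) //; lia.
    by apply: runs1; rewrite /step /= i6; congr (Some (MState _ _ _)); lia.
  have hr0 : represents off (tick 1 (set_nr a 0%N s)) (upd N a 0%N) X.
    by apply: rep_tick; apply: rep_nr hr _ _ _; rewrite // /upd ?eqxx // => d /negPf ->.
  have [|N2 [X2 [T [r2 k2 run2]]]] := loop (nr s b) _ _ _ hr0.
    by rewrite /= /upd eqxx eq_sym (negPf ab).
  exists N2, X2, (1 + T)%N; split; first exact: rep_tick.
    by move: k2; rewrite /= -/F => ->; lia.
  apply: runs_trans run2; apply: runs1; by rewrite /step /= i1.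
Qed.

End Semantics.

(** * Frame conditions and static time bounds *)

Fixpoint xwrites (c : cmd) : seq nat :=
  match c with
  | XC a _ | XA a _ _ | XS a _ _ | XM a _ _ | XD a _ _ | XGet a _ _ => [:: a]
  | Seq c1 c2 | IfN _ _ c1 c2 | IfX _ _ c1 c2 => xwrites c1 ++ xwrites c2
  | For _ _ c => xwrites c
  | _ => [::]
  end.

Fixpoint nawrites (c : cmd) : seq nat :=
  match c with
  | NSet k _ _ => [:: k]
  | Seq c1 c2 | IfN _ _ c1 c2 | IfX _ _ c1 c2 => nawrites c1 ++ nawrites c2
  | For _ _ c => nawrites c
  | _ => [::]
  end.

Fixpoint xawrites (c : cmd) : seq nat :=
  match c with
  | XSet k _ _ => [:: k]
  | Seq c1 c2 | IfN _ _ c1 c2 | IfX _ _ c1 c2 => xawrites c1 ++ xawrites c2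
  | For _ _ c => xawrites c
  | _ => [::]
  end.

Fixpoint limits (c : cmd) : seq nat :=
  match c with
  | Seq c1 c2 | IfN _ _ c1 c2 | IfX _ _ c1 c2 => limits c1 ++ limits c2
  | For _ b c => b :: limits c
  | _ => [::]
  end.

Fixpoint bound (v : nat -> nat) (c : cmd) : nat :=
  match c with
  | Skip => 0
  | NGet _ _ _ | NSet _ _ _ | XGet _ _ _ | XSet _ _ _ => 7
  | Seq c1 c2 => bound v c1 + bound v c2
  | IfN _ _ c1 c2 | IfX _ _ c1 c2 => 2 + bound v c1 + bound v c2
  | For _ b c => 3 + v b * (4 + bound v c)
  | _ => 1
  end.

Section Frame.
Variable R : realType.
Implicit Types s : hst R.

Lemma xr_heval c s a : a \notin xwrites c -> xr (heval c s) a = xr s a.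
Proof.
elim: c s => //=; try (by move=> *; rewrite /upd; move: H; rewrite inE => /negPf ->).
- by move=> b k s; rewrite inE /upd => /negPf ->.
- by move=> b k l s; rewrite inE /upd => /negPf ->.
- by move=> b k l s; rewrite inE /upd => /negPf ->.
- by move=> b k l s; rewrite inE /upd => /negPf ->.
- by move=> b k l s; rewrite inE /upd => /negPf ->.
- by move=> b k l s; rewrite inE /upd => /negPf ->.
- by move=> c1 IH1 c2 IH2 s; rewrite mem_cat negb_or => /andP[h1 h2]; rewrite IH2 // IH1.
- move=> b d c1 IH1 c2 IH2 s; rewrite mem_cat negb_or => /andP[h1 h2].
  by case: ifP => _ /=; rewrite ?IH1 ?IH2.
- move=> b d c1 IH1 c2 IH2 s; rewrite mem_cat negb_or => /andP[h1 h2].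
  by case: ifP => _ /=; rewrite ?IH1 ?IH2.
- by move=> b d c IH s h; elim: (nr s d) => [|n IHn] //=; rewrite IH.
Qed.

Lemma na_heval c s k i : k \notin nawrites c -> na (heval c s) k i = na s k i.
Proof.
elim: c s => //=.
- by move=> b j l s; rewrite inE /upd2 => /negPf ->.
- by move=> c1 IH1 c2 IH2 s; rewrite mem_cat negb_or => /andP[h1 h2]; rewrite IH2 // IH1.
- move=> b d c1 IH1 c2 IH2 s; rewrite mem_cat negb_or => /andP[h1 h2].
  by case: ifP => _ /=; rewrite ?IH1 ?IH2.
- move=> b d c1 IH1 c2 IH2 s; rewrite mem_cat negb_or => /andP[h1 h2].
  by case: ifP => _ /=; rewrite ?IH1 ?IH2.
- by move=> b d c IH s h; elim: (nr s d) => [|n IHn] //=; rewrite IH.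
Qed.

Lemma xa_heval c s k i : k \notin xawrites c -> xa (heval c s) k i = xa s k i.
Proof.
elim: c s => //=.
- by move=> b j l s; rewrite inE /upd2 => /negPf ->.
- by move=> c1 IH1 c2 IH2 s; rewrite mem_cat negb_or => /andP[h1 h2]; rewrite IH2 // IH1.
- move=> b d c1 IH1 c2 IH2 s; rewrite mem_cat negb_or => /andP[h1 h2].
  by case: ifP => _ /=; rewrite ?IH1 ?IH2.
- move=> b d c1 IH1 c2 IH2 s; rewrite mem_cat negb_or => /andP[h1 h2].
  by case: ifP => _ /=; rewrite ?IH1 ?IH2.
- by move=> b d c IH s h; elim: (nr s d) => [|n IHn] //=; rewrite IH.
Qed.

Lemma clk_heval v c s : {in limits c, forall b, b \notin writes c} ->
  {in limits c, forall b, nr s b = v b} -> (clk (heval c s) <= clk s + bound v c)%N.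
Proof.
elim: c s => //=; try (by move=> *; rewrite ?addn0).
- move=> c1 IH1 c2 IH2 s h1 h2.
  have h11 : {in limits c1, forall b, b \notin writes c1}.
    by move=> b hb; have := h1 b; rewrite !mem_cat hb negb_or => /(_ isT) /andP[].
  have h12 : {in limits c2, forall b, b \notin writes c2}.
    by move=> b hb; have := h1 b; rewrite !mem_cat hb orbT negb_or => /(_ isT) /andP[].
  have H1 : (clk (heval c1 s) <= clk s + bound v c1)%N.
    by apply: IH1 => // b hb; apply: h2; rewrite mem_cat hb.
  have H2 : (clk (heval c2 (heval c1 s)) <= clk (heval c1 s) + bound v c2)%N.
    apply: IH2 => // b hb; rewrite nr_heval; last first.
      by have := h1 b; rewrite !mem_cat hb orbT negb_or => /(_ isT) /andP[].
    by apply: h2; rewrite mem_cat hb orbT.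
  by lia.
- move=> a b c1 IH1 c2 IH2 s h1 h2.
  have h11 : {in limits c1, forall b, b \notin writes c1}.
    by move=> d hd; have := h1 d; rewrite !mem_cat hd negb_or => /(_ isT) /andP[].
  have h12 : {in limits c2, forall b, b \notin writes c2}.
    by move=> d hd; have := h1 d; rewrite !mem_cat hd orbT negb_or => /(_ isT) /andP[].
  have h21 : {in limits c1, forall b, nr (tick 1 s) b = v b} by move=> d hd; apply: h2; rewrite mem_cat hd.
  have h22 : {in limits c2, forall b, nr (tick 1 s) b = v b} by move=> d hd; apply: h2; rewrite mem_cat hd orbT.
  by case: ifP => _ /=; have := IH1 _ h11 h21; have := IH2 _ h12 h22; rewrite /=; lia.
- move=> a b c1 IH1 c2 IH2 s h1 h2.
  have h11 : {in limits c1, forall b, b \notin writes c1}.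
    by move=> d hd; have := h1 d; rewrite !mem_cat hd negb_or => /(_ isT) /andP[].
  have h12 : {in limits c2, forall b, b \notin writes c2}.
    by move=> d hd; have := h1 d; rewrite !mem_cat hd orbT negb_or => /(_ isT) /andP[].
  have h21 : {in limits c1, forall b, nr (tick 1 s) b = v b} by move=> d hd; apply: h2; rewrite mem_cat hd.
  have h22 : {in limits c2, forall b, nr (tick 1 s) b = v b} by move=> d hd; apply: h2; rewrite mem_cat hd orbT.
  by case: ifP => _ /=; have := IH1 _ h11 h21; have := IH2 _ h12 h22; rewrite /=; lia.
- move=> a b c IH s h1 h2.
  have h11 : {in limits c, forall b, b \notin writes c}.
    by move=> d hd; have := h1 d; rewrite !inE hd orbT negb_or => /(_ isT) /andP[].
  have na1 d : d \in limits c -> d != a.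
    by move=> hd; have := h1 d; rewrite !inE hd orbT negb_or => /(_ isT) /andP[].
  rewrite -(h2 b) ?inE ?eqxx //.
  set F := fun s' => incr_nr a _; set s0 := tick 1 _.
  have H n : (clk (iter n F s0) <= clk s + 1 + n * (4 + bound v c))%N /\
      {in limits c, forall d, nr (iter n F s0) d = v d}.
    elim: n => [|n [h4 h5]]; first split=> //=; first by lia.
      by move=> d hd; rewrite /= /upd (negPf (na1 d hd)); apply: h2; rewrite inE hd orbT.
    split=> /=; first by have := IH _ h11 h5; lia.
    by move=> d hd; rewrite /upd (negPf (na1 d hd)) nr_heval ?h5 // h11.
  by have [h4 _] := H (nr s b); lia.
Qed.

Definition frame (c : cmd) s s' : Prop :=
  [/\ forall a, a \notin writes c -> nr s' a = nr s a,
      forall a, a \notin xwrites c -> xr s' a = xr s a,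
      forall k i, k \notin nawrites c -> na s' k i = na s k i
    & forall k i, k \notin xawrites c -> xa s' k i = xa s k i].

Lemma frame_heval c s : frame c s (heval c s).
Proof. split=> *; [exact: nr_heval|exact: xr_heval|exact: na_heval|exact: xa_heval]. Qed.

Lemma frame_trans c s1 s2 s3 : frame c s1 s2 -> frame c s2 s3 -> frame c s1 s3.
Proof.
move=> [h1 h2 h3 h4] [g1 g2 g3 g4]; split=> *; rewrite ?g1 ?h1 ?g2 ?h2 ?g3 ?h3 ?g4 ?h4 //.
Qed.

(** The frame relative to the start of the loop is supplied at every iteration, so invariants
    mention only what the body changes. *)
Lemma for_rule (I : nat -> hst R -> Prop) a b c s :
  wf (For a b c) ->
  I 0%N (tick 1 (set_nr a 0%N s)) ->
  (forall i s', (i < nr s b)%N -> I i s' -> nr s' a = i -> frame (For a b c) s s' ->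
     I i.+1 (incr_nr a (tick 4 (heval c s')))) ->
  exists2 s', heval (For a b c) s = tick 2 s' & I (nr s b) s' .
Proof.
move=> /and5P[_ _ ab ha /andP[hb w]] I0 IS.
have [|i s' hi [h1 h2] h3 h4|s' [h1 [h2 _] _ _]] :=
  @for_inv R (fun i s' => I i s' /\ frame (For a b c) s s') a b c s ha hb ab; last by exists s'.
  split=> //; split=> //= d; rewrite inE negb_or /upd => /andP[/negPf -> _] //.
split; first exact: IS.
apply: frame_trans h2 _; have [g1 g2 g3 g4] := frame_heval c s'; split=> //= d.
  by rewrite inE negb_or /upd => /andP[/negPf -> /g1].
Qed.

End Frame.

(** * The program *)

Declare Scope cmd_scope.
Delimit Scope cmd_scope with cmd.
Notation "c1 ;; c2" := (Seq c1 c2) (at level 60, right associativity) : cmd_scope.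
Local Open Scope cmd_scope.

(* Real arrays: 0 the input, 1 and 2 the below_sum and below_cnt of every pair (i, j) over the
   unconnected clients, 3 the current connection costs, 4 the scaled facility costs, reset to 0 when a
   site opens.  Natural-number arrays: 0 the output, 1 the flags of connected clients.
   Row i of a table over pairs starts at index nF + i * nC, as in the input. *)
Definition init_consts : cmd :=
  NC 7 1;; NC 8 0;; XC 30 1;; XC 31 0;; XC 21 38;; XC 22 25;; XD 20 21 22.
Definition init_fp : cmd := For 3 0 (XGet 0 0 3;; XM 0 0 20;; XSet 4 3 0).
Definition sum_below : cmd :=
  For 13 1 (XGet 3 0 6;; IfX 0 3 Skip (XA 1 1 3;; XA 2 2 30);; NA 6 6 7).
Definition init_below : cmd :=
  NA 5 0 8;;
  For 3 0 (NA 11 5 8;;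
    For 4 1 (NA 6 11 8;; XC 1 0;; XC 2 0;; XGet 0 0 5;; sum_below;;
             XSet 1 5 1;; XSet 2 5 2;; NA 5 5 7)).

Definition sub_savings : cmd :=
  For 4 1 (NGet 16 1 4;;
    IfN 8 16 (XGet 1 0 6;; XGet 2 3 4;; IfX 1 2 (XS 1 2 1;; XS 0 0 1) Skip) Skip;;
    NA 6 6 7).
(** There is no move command; adding register 31 or 8, which hold 0, copies. Register 9 flags that a
    candidate exists, 10 holds its site and 11 the start of its row. *)
Definition keep_candidate : cmd := XA 5 1 31;; NC 9 1;; NA 10 3 8;; NA 11 17 8.
Definition scan_candidates : cmd :=
  For 4 1 (NGet 16 1 4;;
    IfN 8 16 Skip (XGet 1 1 5;; XGet 2 2 5;; XA 1 1 0;; XD 1 1 2;;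
      IfN 8 9 (IfX 1 5 keep_candidate Skip) keep_candidate);;
    NA 5 5 7).
Definition select_star : cmd :=
  NC 9 0;; NA 5 0 8;;
  For 3 0 (NA 6 5 8;; NA 17 5 8;; XGet 0 4 3;; sub_savings;; scan_candidates).

(** Register 15 walks down the column of the client in steps of [nC], while register 6 runs through
    the whole table. *)
Definition remove_client : cmd :=
  NA 6 0 8;; NA 15 0 4;;
  For 14 0 (XGet 3 0 15;;
    For 13 1 (XGet 4 0 6;;
      IfX 4 3 Skip (XGet 6 1 6;; XS 6 6 3;; XSet 1 6 6;; XGet 6 2 6;; XS 6 6 30;; XSet 2 6 6);;
      NA 6 6 7);;
    NA 15 15 1).
Definition connect_clients : cmd :=
  For 4 1 (XGet 1 0 11;; NGet 16 1 4;;
    IfN 8 16 (XGet 2 3 4;; IfX 1 2 (XSet 3 4 1) Skip)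
             (IfX 5 1 Skip (NSet 1 4 7;; XSet 3 4 1;; remove_client));;
    NA 11 11 7).
Definition open_star : cmd := XC 0 0;; XSet 4 10 0;; NSet 0 10 2.
Definition jms_round : cmd :=
  select_star;; IfN 8 9 (open_star;; connect_clients) Skip.
Definition jms : cmd := For 12 1 jms_round.

Definition keep_gain : cmd := XA 5 0 31;; XA 7 2 31;; NC 9 1;; NA 10 3 8;; NA 11 17 8.
Definition sum_gain : cmd :=
  For 4 1 (XGet 1 0 5;; XGet 2 3 4;; IfX 1 2 (XS 1 2 1;; XA 0 0 1) Skip;; NA 5 5 7).
Definition select_gain : cmd :=
  NC 9 0;; NA 5 0 8;;
  For 3 0 (NA 17 5 8;; XC 0 0;; sum_gain;; XGet 2 0 3;;
    IfX 2 0 (IfN 8 9 (XM 3 5 2;; XM 4 0 7;; IfX 3 4 keep_gain Skip) keep_gain) Skip).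
Definition apply_gain : cmd :=
  NSet 0 10 2;; For 4 1 (XGet 1 0 11;; XGet 2 3 4;; IfX 1 2 (XSet 3 4 1) Skip;; NA 11 11 7).
Definition augment_round : cmd := select_gain;; IfN 8 9 apply_gain Skip.
Definition augment : cmd := For 12 0 augment_round.

Definition assign_client : cmd :=
  For 3 0 (NGet 16 0 3;;
    IfN 8 16 (IfN 8 9 Skip (XGet 1 0 5;; IfX 2 1 Skip (NSet 0 5 2;; NC 9 1))) Skip;;
    NA 5 5 1).
Definition assign : cmd := For 4 1 (NC 9 0;; NA 5 0 4;; XGet 2 3 4;; assign_client).

Definition init : cmd := init_consts;; init_fp;; init_below.
Definition main : cmd := init;; jms;; augment;; assign.

Section Rules.
Variable R : realType.
Implicit Types s : hst R.

Lemma heval_Seq c1 c2 s : heval (c1;; c2) s = heval c2 (heval c1 s). Proof. by []. Qed.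
Lemma heval_Skip s : heval Skip s = s. Proof. by []. Qed.
Lemma heval_NC a k s : heval (NC a k) s = tick 1 (set_nr a k s). Proof. by []. Qed.
Lemma heval_NA a b c s : heval (NA a b c) s = tick 1 (set_nr a (nr s b + nr s c)%N s).
Proof. by []. Qed.
Lemma heval_XC a k s : heval (XC a k) s = tick 1 (set_xr a k%:R s). Proof. by []. Qed.
Lemma heval_XA a b c s : heval (XA a b c) s = tick 1 (set_xr a (xr s b + xr s c) s).
Proof. by []. Qed.
Lemma heval_XS a b c s : heval (XS a b c) s = tick 1 (set_xr a (xr s b - xr s c) s).
Proof. by []. Qed.
Lemma heval_XM a b c s : heval (XM a b c) s = tick 1 (set_xr a (xr s b * xr s c) s).
Proof. by []. Qed.
Lemma heval_XD a b c s : heval (XD a b c) s = tick 1 (set_xr a (xr s b / xr s c) s).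
Proof. by []. Qed.
Lemma heval_NGet a k b s : heval (NGet a k b) s = tick 7 (set_nr a (na s k (nr s b)) s).
Proof. by []. Qed.
Lemma heval_NSet k a b s : heval (NSet k a b) s = tick 7 (set_na k (nr s a) (nr s b) s).
Proof. by []. Qed.
Lemma heval_XGet a k b s : heval (XGet a k b) s = tick 7 (set_xr a (xa s k (nr s b)) s).
Proof. by []. Qed.
Lemma heval_XSet k a b s : heval (XSet k a b) s = tick 7 (set_xa k (nr s a) (xr s b) s).
Proof. by []. Qed.
Lemma heval_IfN a b c1 c2 s : heval (IfN a b c1 c2) s =
  if (nr s a < nr s b)%N then heval c1 (tick 1 s) else tick 1 (heval c2 (tick 1 s)).
Proof. by []. Qed.
Lemma heval_IfX a b c1 c2 s : heval (IfX a b c1 c2) s =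
  if xr s a < xr s b then heval c1 (tick 1 s) else tick 1 (heval c2 (tick 1 s)).
Proof. by []. Qed.

Definition hevalE := (heval_Seq, heval_Skip, heval_NC, heval_NA, heval_XC, heval_XA, heval_XS,
  heval_XM, heval_XD, heval_NGet, heval_NSet, heval_XGet, heval_XSet, heval_IfN, heval_IfX).
End Rules.

(** * Program invariants: constants, tables and the greedy state *)

Section Env.
Variables (R : realType) (nF nC r : nat) (f : nat -> R) (c : nat -> nat -> R).
Implicit Types s : hst R.

Definition ix i j := (nF + i * nC + j)%N.

Lemma ixS i : ix i.+1 0 = ix i nC. Proof. by rewrite /ix mulSn; lia. Qed.

Lemma ix_inj i j i' j' : (j < nC)%N -> (j' < nC)%N -> ix i j = ix i' j' -> i = i' /\ j = j'.
Proof.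
rewrite /ix -!addnA => hj hj' /addnI e.
have := congr1 (fun n => n %/ nC)%N e; have := congr1 (fun n => n %% nC)%N e.
have n0 : (0 < nC)%N by lia.
by rewrite !modnMDl !modn_small // !divnMDl // !divn_small // !addn0.
Qed.

Lemma ix_eq i j i' j' : (j < nC)%N -> (j' < nC)%N ->
  (ix i j == ix i' j') = (i == i') && (j == j').
Proof.
move=> hj hj'; apply/eqP/andP => [/ix_inj[] // -> ->|[/eqP -> /eqP ->]//].
by rewrite !eqxx.
Qed.

(** Registers 7 and 8 hold 1 and 0, so that [IfN 8 a] tests whether register [a] is nonzero. *)
Record env s : Prop := Env {
  env_nr : [/\ nr s 0%N = nF, nr s 1%N = nC, nr s 2%N = r, nr s 7%N = 1%N & nr s 8%N = 0%N];
  env_xr : [/\ xr s 20%N = 38%:R / 25%:R, xr s 30%N = 1 & xr s 31%N = 0];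
  env_f : forall i, (i < nF)%N -> xa s 0%N i = f i;
  env_c : forall i j, (i < nF)%N -> (j < nC)%N -> xa s 0%N (ix i j) = c i j }.

Definition safe (c : cmd) : bool :=
  [&& all (fun a => a \notin writes c) [:: 0; 1; 2; 7; 8]%N,
      all (fun a => a \notin xwrites c) [:: 20; 30; 31]%N & 0%N \notin xawrites c].

Lemma env_frame (p : cmd) s s' : safe p -> frame p s s' -> env s -> env s'.
Proof.
case/and3P=> /and5P[w0 w1 w2 w7 /andP[w8 _]] /and4P[x0 x1 x2 _] wa [h1 h2 _ h4] [[e1 e2 e3 e4 e5] [e6 e7 e8] ef ec].
split; first by rewrite !h1.
- by rewrite !h2.
- by move=> i hi; rewrite h4 // ef.
- by move=> i j hi hj; rewrite h4 // ec.
Qed.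

Lemma env_heval (p : cmd) s : safe p -> env s -> env (heval p s).
Proof. by move=> hp; apply: env_frame hp (frame_heval _ _). Qed.

(** Array 0 is built up as the output: an open site already carries [r] facilities and the
    connection part is still 0. *)
Record jrep (st : jstate R) s : Prop := JRep {
  rep_conn : forall j, (j < nC)%N -> na s 1%N j = conn st j;
  rep_rr : forall j, (j < nC)%N -> conn st j -> xa s 3%N j = rr st j;
  rep_fp : forall i, (i < nF)%N -> xa s 4%N i = fp st i;
  rep_opn : forall i, (i < nF)%N -> na s 0%N i = if opn st i then r else 0%N;
  rep_x : forall e, na s 0%N (nF + e)%N = 0%N;
  rep_sum : forall i j, (i < nF)%N -> (j < nC)%N ->
    xa s 1%N (ix i j) = below_sum nC (fun k => ~~ conn st k) (c i) j;
  rep_cnt : forall i j, (i < nF)%N -> (j < nC)%N ->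
    xa s 2%N (ix i j) = below_cnt nC (fun k => ~~ conn st k) (c i) j }.

Definition quiet (c : cmd) : bool := (nawrites c == [::]) && (xawrites c == [::]).

Lemma jrep_frame (p : cmd) st s s' : quiet p -> frame p s s' -> jrep st s -> jrep st s'.
Proof.
move=> /andP[/eqP h1 /eqP h2] [_ _ g1 g2] [e1 e2 e3 e4 e5 e6 e7].
rewrite h1 h2 in g1 g2.
by split=> *; rewrite ?g1 ?g2 // ?e1 ?e2 ?e3 ?e4 ?e5 ?e6 ?e7.
Qed.

Lemma jrep_heval (p : cmd) st s : quiet p -> jrep st s -> jrep st (heval p s).
Proof. by move=> hp; apply: jrep_frame hp (frame_heval _ _). Qed.

Lemma sub_savings_ok st s i : env s -> jrep st s -> (i < nF)%N -> nr s 6%N = ix i 0 ->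
  xr (heval sub_savings s) 0%N =
  xr s 0%N - \sum_(0 <= k < nC) (if conn st k then pospart (rr st k - c i k) else 0).
Proof.
move=> es js hi h6; rewrite /sub_savings; set body := (NGet _ _ _ ;; _).
have [[e0 e1 e2 e7 e8] _ _ _] := es.
have [||j s' hj [x0 n6] n4 fr|s' -> [-> _]] := @for_rule R (fun j s' =>
   xr s' 0%N = xr s 0%N - \sum_(0 <= k < j) (if conn st k then pospart (rr st k - c i k) else 0)
   /\ nr s' 6%N = ix i j) 4%N 1%N body s; last by rewrite e1.
- exact: isT.
- by rewrite /= big_geq // subr0 /upd /= h6.
have [[e0' e1' e2' e7' e8'] _ _ ec'] := env_frame (isT : safe (For 4 1 body)) fr es.
have [cn rr' _ _ _ _ _] := jrep_frame (isT : quiet (For 4 1 body)) fr js.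
rewrite e1 in hj; rewrite /body !hevalE /= /upd /= n4 e8' cn //.
rewrite big_nat_recr //=; case Cj: (conn st j) => /=; last first.
  by rewrite /upd /= x0 n6 e7' addr0; split => //; rewrite /ix; lia.
rewrite n6 ec' // rr' //; case: ltP => hc /=; rewrite /upd /= x0 n6 e7'.
  split; last by rewrite /ix; lia.
  by rewrite /pospart max_l ?subr_ge0 ?ltW //; ring.
split; last by rewrite /ix; lia.
by rewrite /pospart max_r ?subr_le0 // addr0.
Qed.

End Env.

Opaque heval.

(** * Finding the next event of the greedy algorithm *)

Section Select.
Variables (R : realType) (nF nC r : nat) (f : nat -> R) (c : nat -> nat -> R).
Implicit Types s : hst R.
Local Notation env := (env nF nC r f c).
Local Notation jrep := (jrep nF nC r c).
Local Notation ix := (ix nF nC).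
Local Notation candidate := (candidate nC c).

Definition best st (cond : nat -> nat -> Prop) s : Prop :=
  (nr s 9%N = 0%N /\ forall i k, cond i k -> conn st k) \/
  (nr s 9%N = 1%N /\ (exists i0 k0, cond i0 k0 /\
      [/\ ~~ conn st k0, nr s 10%N = i0, nr s 11%N = ix i0 0 & xr s 5%N = candidate st i0 k0])
    /\ forall i k, cond i k -> ~~ conn st k -> xr s 5%N <= candidate st i k).

Lemma best_sub st (cond cond' : nat -> nat -> Prop) s :
  (forall i k, cond i k <-> cond' i k) -> best st cond s -> best st cond' s.
Proof.
move=> h [[h1 h2]|[h1 [[i0 [k0 [h2 h3]]] h4]]]; [left|right]; split=> //.
  by move=> i k /h; exact: h2.
by split=> [|i k /h]; [exists i0, k0; split => //; exact/h|exact: h4].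
Qed.

Lemma best_same st cond s s' : nr s' 9%N = nr s 9%N -> nr s' 10%N = nr s 10%N ->
  nr s' 11%N = nr s 11%N -> xr s' 5%N = xr s 5%N -> best st cond s -> best st cond s'.
Proof. by rewrite /best => -> -> -> ->. Qed.

Lemma scan_candidates_ok st s i : env s -> jrep st s -> (i < nF)%N ->
  nr s 3%N = i -> nr s 5%N = ix i 0 -> nr s 17%N = ix i 0 -> xr s 0%N = residual nC c st i ->
  best st (fun i' k => (i' < i)%N /\ (k < nC)%N) s ->
  best st (fun i' k => (i' < i.+1)%N /\ (k < nC)%N) (heval scan_candidates s) /\
  nr (heval scan_candidates s) 5%N = ix i.+1 0.
Proof.
move=> es js hi h3 h5 h17 x0 bs; rewrite /scan_candidates; set body := (NGet _ _ _ ;; _).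
have [[e0 e1 e2 e7 e8] _ _ _] := es.
have [||j s' hj [b5 n5] n4 fr|s' -> [b5 n5]] := @for_rule R (fun j s' =>
   best st (fun i' k => (i' < i)%N /\ (k < nC)%N \/ i' = i /\ (k < j)%N) s' /\
   nr s' 5%N = ix i j) 4%N 1%N body s; last 1 first.
- rewrite e1 in b5 n5; rewrite ixS; split=> //.
  by apply: best_same (best_sub _ b5) => // i' k; split; lia.
- exact: isT.
- by split=> //; apply: best_same (best_sub _ bs) => // i' k; split; lia.
have [[e0' e1' e2' e7' e8'] [_ _ e31'] _ ec'] := env_frame (isT : safe (For 4 1 body)) fr es.
have [cn _ _ _ _ rs rc] := jrep_frame (isT : quiet (For 4 1 body)) fr js.
have [f1 f2 _ _] := fr.
rewrite e1 in hj.
have e3 : nr s' 3%N = i by rewrite f1 // h3.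
have e17 : nr s' 17%N = ix i 0 by rewrite f1 // h17.
have e0x : xr s' 0%N = residual nC c st i by rewrite f2 // x0.
rewrite /body !heval_Seq heval_NA; set s1 := heval (NGet _ _ _) s'; set inner := IfN _ _ _ _.
have n51 : nr (heval inner s1) 5%N = ix i j by rewrite !nr_heval.
have n71 : nr (heval inner s1) 7%N = 1%N by rewrite !nr_heval.
split; last by rewrite /= /upd /= n51 n71 /ix; lia.
apply: (@best_same _ _ (heval inner s1)) => //.
have b1 : best st (fun i' k => (i' < i)%N /\ (k < nC)%N \/ i' = i /\ (k < j)%N) s1 by [].
have e16 : nr s1 16%N = conn st j by rewrite /s1 heval_NGet /= /upd /= n4 cn.
rewrite /inner heval_IfN e16 [nr s1 8%N]e8'.
case Cj: (conn st j) => /=.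
  apply: (@best_same _ _ s1) => //.
  case: b1 => [[h1 h2]|[h1 [[i0 [k0 [h2 h2']]] h4]]]; [left|right]; split=> //.
    move=> i' k hk; have [->//|nkj] := eqVneq k j.
    by apply: (h2 i'); case: hk => [|[-> hk]]; [left|right; split=> //; lia].
  split; first by exists i0, k0; split=> //; lia.
  move=> i' k hk; have [->|nkj] := eqVneq k j; first by rewrite Cj.
  by apply: h4; case: hk => [|[-> hk]]; [left|right; split=> //; lia].
set s2 := tick 1 s1; set arith := XGet 1 1 5;; XGet 2 2 5;; XA 1 1 0;; XD 1 1 2.
set last := IfN 8 9 _ _.
have -> : heval (XGet 1 1 5;; XGet 2 2 5;; XA 1 1 0;; XD 1 1 2;; last) s2 = heval last (heval arith s2) by [].
set s3 := heval arith s2.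
have ec : xr s3 1%N = candidate st i j.
  rewrite /s3 /arith !hevalE /= /upd /= /s2 /s1 heval_NGet /= /upd /= n5 rs // rc // e0x.
  by rewrite addrC.
have b3 : best st (fun i' k => (i' < i)%N /\ (k < nC)%N \/ i' = i /\ (k < j)%N) s3 by [].
have n33 : nr s3 3%N = i by [].
have n38 : nr s3 8%N = 0%N by [].
have n317 : nr s3 17%N = ix i 0 by [].
have x331 : xr s3 31%N = 0 by [].
clearbody s3; clear s1 b1 e16 inner s2 n51 n71 arith.
have upd_best s4 : nr s4 9%N = 1%N -> nr s4 10%N = i -> nr s4 11%N = ix i 0 ->
    xr s4 5%N = candidate st i j ->
    (forall i' k, (i' < i)%N /\ (k < nC)%N \/ i' = i /\ (k < j)%N -> ~~ conn st k ->
        candidate st i j <= candidate st i' k) ->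
    best st (fun i' k => (i' < i)%N /\ (k < nC)%N \/ i' = i /\ (k < j.+1)%N) s4.
  move=> q9 q10 q11 q5 qb; right; split=> //; split.
    by exists i, j; split; [right|split=> //; rewrite Cj].
  move=> i' k hk Ck; rewrite q5; have [hlt|[-> hkj]] := hk; first by apply: qb => //; left.
  by have [->//|nkj] := eqVneq k j; apply: qb => //; right; split=> //; lia.
rewrite /last heval_IfN heval_IfX n38.
case: b3 => [[h1 h2]|[h1 [[i0 [k0 [h2 [h21 h22 h23 h24]]]] h4]]]; rewrite h1 /=.
  rewrite /keep_candidate !hevalE; apply: upd_best; rewrite /= /upd //= ?n33 ?n38 ?n317 ?x331 ?ec ?addn0 ?addr0 //.
  by move=> i' k /h2 ->.
case: ltP => hc; rewrite ec in hc.
  rewrite /keep_candidate !hevalE; apply: upd_best; rewrite /= /upd //= ?n33 ?n38 ?n317 ?x331 ?ec ?addn0 ?addr0 //.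
  by move=> i' k hk Ck; apply: le_trans (ltW hc) (h4 _ _ hk Ck).
rewrite heval_Skip; right; split=> //; split; first by exists i0, k0; split=> //; lia.
move=> i' k hk Ck /=; have [hlt|[ei hkj]] := hk; first by apply: h4 => //; left.
have [ek|nkj] := eqVneq k j; first by rewrite ei ek.
by apply: h4 => //; right; split=> //; lia.
Qed.

Lemma select_star_ok st s : env s -> jrep st s ->
  best st (fun i k => (i < nF)%N /\ (k < nC)%N) (heval select_star s).
Proof.
move=> es js; rewrite /select_star !heval_Seq; set s1 := heval (NA 5 0 8) _.
have es1 : env s1 := env_heval (isT : safe (NA 5 0 8)) (env_heval (isT : safe (NC 9 0)) es).
have js1 : jrep st s1 := jrep_heval (isT : quiet (NA 5 0 8)) (jrep_heval (isT : quiet (NC 9 0)) js).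
have [[e0 e1 e2 e7 e8] _ _ _] := es.
have n51 : nr s1 5%N = ix 0 0 by rewrite /s1 !hevalE /= /upd /= e0 e8 /ix; lia.
have n91 : nr s1 9%N = 0%N by rewrite /s1 !hevalE.
clearbody s1; set body := (NA 6 5 8;; _).
have [[q0 _ _ _ _] _ _ _] := es1.
have [||i s' hi [b5 n5] n3 fr|s' -> [b5 n5]] := @for_rule R (fun i s' =>
   best st (fun i' k => (i' < i)%N /\ (k < nC)%N) s' /\
   nr s' 5%N = ix i 0) 3%N 0%N body s1; last 1 first.
- by move: b5; rewrite q0; apply: best_same.
- exact: isT.
- by split; [left; split=> // i k [] | ].
have es' := env_frame (isT : safe (For 3 0 body)) fr es1.
have js' := jrep_frame (isT : quiet (For 3 0 body)) fr js1.
rewrite q0 in hi; rewrite /body.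
set pre := NA 6 5 8;; NA 17 5 8;; XGet 0 4 3.
rewrite -[heval _ s']/(heval scan_candidates (heval sub_savings (heval pre s'))).
set s2 := heval pre s'.
have es2 : env s2 by apply: env_heval.
have js2 : jrep st s2 by apply: jrep_heval.
have [[g0 g1 g2 g7 g8] _ _ _] := es'.
have [_ _ fpe _ _ _ _] := js'.
have n62 : nr s2 6%N = ix i 0 by rewrite /s2 /pre !hevalE /= /upd /= n5 g8 addn0.
have n172 : nr s2 17%N = ix i 0 by rewrite /s2 /pre !hevalE /= /upd /= n5 g8 addn0.
have x02 : xr s2 0%N = fp st i by rewrite /s2 /pre !hevalE /= /upd /= n3 fpe.
have x03 := sub_savings_ok es2 js2 hi n62.
rewrite x02 in x03; set s3 := heval sub_savings s2.
have es3 : env s3 by apply: env_heval.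
have js3 : jrep st s3 by apply: jrep_heval.
have [|||//||b6 n6] := scan_candidates_ok es3 js3 hi; last by [].
- by rewrite /s3 nr_heval // /s2 nr_heval.
- by rewrite /s3 nr_heval // /s2 nr_heval.
- by rewrite /s3 nr_heval.
- by apply: best_same b5; rewrite /s3 ?nr_heval ?xr_heval // /s2 ?nr_heval ?xr_heval.
Qed.

(** With at least one site, finding no candidate means that no client is unconnected. *)
Lemma select_star_selected st s : (0 < nF)%N -> env s -> jrep st s ->
  let s' := heval select_star s in
  (nr s' 9%N = 0%N /\ forall k, (k < nC)%N -> conn st k) \/
  (nr s' 9%N = 1%N /\ selected nF nC c st (xr s' 5%N) (nr s' 10%N) /\ nr s' 11%N = ix (nr s' 10%N) 0).
Proof.
move=> nF0 es js s'; have := select_star_ok es js; rewrite -/s'.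
case=> [[h1 h2]|[h1 [[i0 [k0 [[h2 h2'] [h21 h22 h23 h24]]]] h4]]].
  by left; split=> // k hk; apply: (h2 0%N).
right; split=> //; split; last by rewrite h23 h22.
by rewrite h22; split=> // [i k hi hk|]; [exact: h4|exists k0; split].
Qed.
End Select.

(** * Opening the selected site and updating the tables *)

Section Connect.
Variables (R : realType) (nF nC r : nat) (f : nat -> R) (c : nat -> nat -> R).
Implicit Types s : hst R.
Local Notation env := (env nF nC r f c).
Local Notation jrep := (jrep nF nC r c).
Local Notation ix := (ix nF nC).

Definition removed (j : nat) s (cond : nat -> nat -> bool) s' : Prop :=
  forall i k, (i < nF)%N -> (k < nC)%N ->
    xa s' 1%N (ix i k) = xa s 1%N (ix i k) - (if cond i k && (c i j <= c i k) then c i j else 0) /\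
    xa s' 2%N (ix i k) = xa s 2%N (ix i k) - (if cond i k && (c i j <= c i k) then 1 else 0).

Lemma removed_same j s cond cond' s' s'' :
  (forall k i, xa s'' k i = xa s' k i) ->
  (forall i k, (i < nF)%N -> (k < nC)%N -> cond i k = cond' i k) ->
  removed j s cond s' -> removed j s cond' s''.
Proof. by move=> h1 h2 h i k hi hk; rewrite !h1 -h2 //; exact: h. Qed.

Lemma remove_client_ok s j : env s -> (j < nC)%N -> nr s 4%N = j ->
  removed j s (fun _ _ => true) (heval remove_client s).
Proof.
move=> es hj n4; rewrite /remove_client !heval_Seq; set s1 := heval (NA 15 0 4) _.
have es1 : env s1 := env_heval (isT : safe (NA 15 0 4)) (env_heval (isT : safe (NA 6 0 8)) es).
have [[e0 e1 e2 e7 e8] _ _ _] := es.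
have n61 : nr s1 6%N = ix 0 0 by rewrite /s1 !hevalE /= /upd /= e0 e8 /ix; lia.
have n151 : nr s1 15%N = ix 0 j by rewrite /s1 !hevalE /= /upd /= e0 n4 /ix; lia.
have r1 : removed j s (fun _ _ => false) s1 by move=> i k _ _; rewrite /= !subr0.
clearbody s1; set body := (XGet 3 0 15;; _).
have [[q0 q1 _ _ _] _ _ _] := es1.
have [||i s' hi [b n6 n15] n14 fr|s' -> [b _ _]] := @for_rule R (fun i s' =>
   [/\ removed j s (fun i' _ => (i' < i)%N) s', nr s' 6%N = ix i 0 & nr s' 15%N = ix i j])
   14%N 0%N body s1; last 1 first.
- by apply: removed_same b => // i k hi hk; rewrite q0 hi.
- exact: isT.
- by split=> //; apply: removed_same r1.
rewrite q0 in hi.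
have es' := env_frame (isT : safe (For 14 0 body)) fr es1.
have [[g0 g1 g2 g7 g8] _ _ gc] := es'.
rewrite /body !heval_Seq; set s2 := heval (XGet 3 0 15) s'; set ibody := (XGet 4 0 6;; _).
have es2 : env s2 by apply: env_heval.
have x3 : xr s2 3%N = c i j by rewrite /s2 !hevalE /= /upd /= n15 gc.
have n62 : nr s2 6%N = ix i 0 by [].
have n152 : nr s2 15%N = ix i j by [].
have r2 : removed j s (fun i' _ => (i' < i)%N) s2 by [].
clearbody s2.
have [[p0 p1 _ p7 p8] [_ p30 _] _ pc] := es2.
have [||k s3 hk [b3 m6] m13 fr3|s3 E [b3 m6]] := @for_rule R (fun k s3 =>
   removed j s (fun i' k' => (i' < i)%N || (i' == i) && (k' < k)%N) s3 /\ nr s3 6%N = ix i k)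
   13%N 1%N ibody s2; last 1 first.
- have a15 : nr (heval (For 13 1 ibody) s2) 15%N = nr s2 15%N by rewrite nr_heval.
  have a1 : nr (heval (For 13 1 ibody) s2) 1%N = nr s2 1%N by rewrite nr_heval.
  rewrite E /= in a15 a1; rewrite E heval_NA; split.
  + apply: removed_same b3 => // i' k' hi' hk'; rewrite p1 hk' andbT ltnS [(i' <= i)%N]leq_eqVlt.
    by rewrite orbC.
  + by rewrite /= /upd /= m6 p1 ixS.
  + by rewrite /= /upd /= a15 a1 n152 p1 /ix mulSn; lia.
- exact: isT.
- split=> //; apply: removed_same r2 => // i' k' _ _; by rewrite ltn0 andbF orbF.
rewrite p1 in hk.
have es3 := env_frame (isT : safe (For 13 1 ibody)) fr3 es2.
have [[t0 t1 t2 t7 t8] [_ t30 _] _ tc] := es3.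
have y3 : xr s3 3%N = c i j by have [_ f3 _ _] := fr3; rewrite f3.
rewrite /ibody !heval_Seq; set s4 := heval (XGet 4 0 6) s3.
have y4 : xr s4 4%N = c i k by rewrite /s4 !hevalE /= /upd /= m6 tc.
have z3 : xr s4 3%N = c i j by [].
have z30 : xr s4 30%N = 1 by [].
have l6 : nr s4 6%N = ix i k by [].
have l7 : nr s4 7%N = 1%N by [].
have r4 : removed j s (fun i' k' => (i' < i)%N || (i' == i) && (k' < k)%N) s4 by [].
clearbody s4; set upd_cmd := (IfX 4 3 _ _).
have u6 : nr (heval upd_cmd s4) 6%N = ix i k by rewrite nr_heval.
have u7 : nr (heval upd_cmd s4) 7%N = 1%N by rewrite nr_heval.
rewrite heval_NA; split; last by rewrite /= /upd /= u6 u7 /ix; lia.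
apply: (@removed_same _ _ _ _ (heval upd_cmd s4)) => //.
move=> i' k' hi' hk'.
have [q1' q2'] := r4 i' k' hi' hk'.
have -> : (i' < i)%N || (i' == i) && (k' < k.+1)%N =
    ((i' < i)%N || (i' == i) && (k' < k)%N) || ((i' == i) && (k' == k)).
  by rewrite ltnS [(k' <= k)%N]leq_eqVlt; case: (i' < i)%N; case: (i' == i); case: (k' == k); case: (k' < k)%N.
rewrite /upd_cmd heval_IfX y4 z3; case: ltP => hc.
  rewrite heval_Skip /= q1' q2'.
  have [/andP[/eqP -> /eqP ->]|nik] := boolP ((i' == i) && (k' == k)); last by rewrite orbF.
  by rewrite leNgt hc !andbF.
rewrite !hevalE /= /upd2 /upd /= l6 ix_eq // z3 z30.
case: ifP => [/andP[/eqP ei /eqP ek]|_]; last by rewrite orbF q1' q2'.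
have [w1 w2] := r4 i k hi hk; move: w1 w2; rewrite ltnn eqxx ltnn /= !subr0 => -> ->.
by rewrite ei ek orbT /= hc.
Qed.

End Connect.

Section BelowRemove.
Variables (R : realType) (n : nat) (x : nat -> R).

Lemma below_sum_ext (U U' : nat -> bool) j : (forall k, (k < n)%N -> U k = U' k) ->
  below_sum n U x j = below_sum n U' x j.
Proof. by move=> h; apply: eq_big_nat => k hk; rewrite h. Qed.

Lemma below_cnt_ext (U U' : nat -> bool) j : (forall k, (k < n)%N -> U k = U' k) ->
  below_cnt n U x j = below_cnt n U' x j.
Proof. by move=> h; apply: eq_big_nat => k hk; rewrite h. Qed.

Lemma below_sum_remove (U : nat -> bool) m j : (m < n)%N -> U m ->
  below_sum n (fun k => U k && (k != m)) x j =
  below_sum n U x j - (if x m <= x j then x m else 0).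
Proof.
move=> hm Um; rewrite /below_sum !big_mkord [in RHS](bigD1 (Ordinal hm)) //=.
rewrite [LHS](bigD1 (Ordinal hm)) //= eqxx andbF /= add0r Um /=.
rewrite [RHS]addrAC subrr add0r; apply: eq_bigr => i; rewrite -val_eqE /= => ->.
by rewrite andbT.
Qed.

Lemma below_cnt_remove (U : nat -> bool) m j : (m < n)%N -> U m ->
  below_cnt n (fun k => U k && (k != m)) x j =
  below_cnt n U x j - (if x m <= x j then 1 else 0).
Proof.
move=> hm Um; rewrite /below_cnt !big_mkord [in RHS](bigD1 (Ordinal hm)) //=.
rewrite [LHS](bigD1 (Ordinal hm)) //= eqxx andbF /= add0r Um /=.
rewrite [RHS]addrAC subrr add0r; apply: eq_bigr => i; rewrite -val_eqE /= => ->.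
by rewrite andbT.
Qed.
End BelowRemove.

Section Connect.
Variables (R : realType) (nF nC r : nat) (f : nat -> R) (c : nat -> nat -> R).
Implicit Types s : hst R.
Local Notation env := (env nF nC r f c).
Local Notation jrep := (jrep nF nC r c).
Local Notation ix := (ix nF nC).
Variables (st : jstate R) (t : R) (ib : nat).
Hypothesis hib : (ib < nF)%N.
Let st' := jstep c st t ib.

(** The state inside the loop over clients: those before [j] are already updated, and the site is
    already open. *)
Definition mix j : jstate R := JState
  (fun k => if (k < j)%N then conn st' k else conn st k)
  (fun k => if (k < j)%N then rr st' k else rr st k) (fp st') (opn st').

Definition loop_limit (v0 v1 : nat) (a : nat) : nat := if a == 0%N then v0 else v1.
Definition remove_cost : nat := bound (loop_limit nF nC) remove_client.

Lemma remove_client_clk s : env s ->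
  (clk (heval remove_client s) <= clk s + remove_cost)%N.
Proof.
move=> [[e0 e1 _ _ _] _ _ _]; apply: clk_heval.
  by apply/allP.
by move=> b; rewrite !inE => /orP[/eqP ->|/eqP ->].
Qed.

Lemma open_star_ok s : env s -> jrep st s -> nr s 10%N = ib ->
  jrep (mix 0) (heval open_star s).
Proof.
move=> es [j1 j2 j3 j4 j5 j6 j7] n10; have [[e0 e1 e2 e7 e8] _ _ _] := es.
rewrite /open_star !hevalE; split=> /=.
- by move=> j hj; rewrite /upd2 /= j1.
- by move=> j hj Cj; rewrite /upd2 /= j2.
- by move=> i hi; rewrite /upd2 /upd /= n10; case: ifP => // _; exact: j3.
- by move=> i hi; rewrite /upd2 /upd /= n10 e2; case: ifP => // _; exact: j4.
- by move=> e; rewrite /upd2 /upd /= n10 ifF ?j5 //; apply/eqP; lia.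
- by move=> i j hi hj; rewrite /upd2 /= j6.
- by move=> i j hi hj; rewrite /upd2 /= j7.
Qed.

(* remove_client takes time O(nF * nC), but is run only once per client over the whole program. *)
Lemma connect_clients_ok s : env s -> jrep (mix 0) s -> nr s 11%N = ix ib 0 -> xr s 5%N = t ->
  jrep st' (heval connect_clients s) /\
  (clk (heval connect_clients s) <= clk s + 3 + nC * 48 +
     (\sum_(0 <= k < nC) (conn st' k && ~~ conn st k)) * remove_cost)%N.
Proof.
move=> es js n11 x5; rewrite /connect_clients; set body := (XGet 1 0 11;; _).
have [[e0 e1 e2 e7 e8] _ _ _] := es.
have [||j s' hj [js' m11 ck] n4 fr|s' -> [[j1 j2 j3 j4 j5 j6 j7] _ ck]] := @for_rule R (fun j s' =>
   [/\ jrep (mix j) s', nr s' 11%N = ix ib j &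
     (clk s' <= clk s + 1 + j * 48 + (\sum_(0 <= k < j) (conn st' k && ~~ conn st k)) * remove_cost)%N])
   4%N 1%N body s; last 1 first.
- rewrite e1 in j1 j2 j6 j7 ck; split; last first.
    by move: ck; move: (_ * remove_cost)%N => M /= ck; lia.
  split=> //=.
  + by move=> j hj; rewrite j1 //= hj.
  + by move=> j hj Cj; rewrite j2 //= hj.
  + by move=> i j hi hj; rewrite j6 //; apply: below_sum_ext => k hk /=; rewrite hk.
  + by move=> i j hi hj; rewrite j7 //; apply: below_cnt_ext => k hk /=; rewrite hk.
- exact: isT.
- split=> //; first by case: js => *; split.
  by rewrite big_geq //=; lia.
rewrite e1 in hj.
have es' := env_frame (isT : safe (For 4 1 body)) fr es.
have [_ fx _ _] := fr; have y5 : xr s' 5%N = t by rewrite fx.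
have [[q0 q1 q2 q7 q8] _ _ qc] := es'.
have [j1 j2 j3 j4 j5 j6 j7] := js'.
have c16 : na s' 1%N j = conn st j by rewrite j1 //= ltnn.
rewrite big_nat_recr //; set N := \sum_(0 <= k < j) _ in ck *.
rewrite /body !heval_Seq heval_NA; set s1 := heval (NGet _ _ _) _; set inner := IfN _ _ _ _.
have n1 : nr (heval inner s1) 11%N = ix ib j by rewrite nr_heval.
have n7 : nr (heval inner s1) 7%N = 1%N by rewrite nr_heval.
suff [J C] : jrep (mix j.+1) (heval inner s1) /\
   (clk (heval inner s1) <= clk s1 + 24 + (conn st' j && ~~ conn st j) * remove_cost)%N.
  split.
  + by case: J => *; split.
  + by rewrite /= /upd /= n1 n7 /ix; lia.
  + have ck1 : clk s1 = (clk s' + 14)%N by rewrite /s1 !hevalE /=; lia.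
    move: C ck; rewrite mulnDl ck1; move: (N * _)%N (_ * remove_cost)%N => M1 M2 /=; lia.
have k16 : nr s1 16%N = conn st j by rewrite /s1 !hevalE /= /upd /= n4.
have k1 : xr s1 1%N = c ib j by rewrite /s1 !hevalE /= /upd /= m11 qc.
have k5 : xr s1 5%N = t by [].
have k4 : nr s1 4%N = j by [].
have k8 : nr s1 8%N = 0%N by [].
have es1 : env s1 := env_heval (isT : safe (NGet 16 1 4)) (env_heval (isT : safe (XGet 1 0 11)) es').
have js1 : jrep (mix j) s1 by case: js' => *; split.
clearbody s1; clear s' js' m11 ck n4 fr es' fx y5 q0 q1 q2 q7 q8 qc j1 j2 j3 j4 j5 j6 j7 c16 n1 n7.
have [j1 j2 j3 j4 j5 j6 j7] := js1.
have mix_ne k : k != j -> conn (mix j.+1) k = conn (mix j) k /\ rr (mix j.+1) k = rr (mix j) k.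
  by move=> hk; rewrite /= ltnS leq_eqVlt (negPf hk).
rewrite /inner heval_IfN k8 k16; case Cj: (conn st j) => /=.
  have U k : conn (mix j.+1) k = conn (mix j) k.
    by have [->|/mix_ne[]//] := eqVneq k j; rewrite /= ltnSn ltnn Cj.
  rewrite !heval_Seq heval_IfX; set s2 := heval (XGet 2 3 4) _.
  have x2 : xr s2 2%N = rr st j.
    by rewrite /s2 !hevalE /= /upd /= k4; have := j2 j hj; rewrite /= ltnn => ->.
  have x1 : xr s2 1%N = c ib j by rewrite /s2 !hevalE.
  have n4 : nr s2 4%N = j by rewrite /s2 !hevalE.
  have ck2 : clk s2 = (clk s1 + 8)%N by rewrite /s2 !hevalE /=; lia.
  have js2 : jrep (mix j) s2 by rewrite /s2 !hevalE; case: js1 => *; split.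
  clearbody s2; rewrite x1 x2; split; last first.
    by case: ifP => _; rewrite !hevalE /= ck2; lia.
  have [i1 i2 i3 i4 i5 i6 i7] := js2.
  case: ltP => hc; rewrite !hevalE; split=> //.
  all: try by move=> k hk; rewrite U; exact: i1.
  all: try by move=> i k hi hk; transitivity (xa s2 1%N (ix i k)); [rewrite /= /upd2|rewrite i6 //; apply: below_sum_ext => q hq; rewrite U].
  all: try by move=> i k hi hk; transitivity (xa s2 2%N (ix i k)); [rewrite /= /upd2|rewrite i7 //; apply: below_cnt_ext => q hq; rewrite U].
  - move=> k hk; rewrite U => Ck; have [->|/[dup] nk /mix_ne[_ ->]] := eqVneq k j.
      by rewrite /= /upd2 /= n4 x1 eqxx ltnSn Cj hc.
    by rewrite /= /upd2 /= n4 (negPf nk); exact: i2.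
  - move=> k hk; rewrite U => Ck; transitivity (rr (mix j) k); first exact: i2.
    by have [->|/mix_ne[_ ->]] := eqVneq k j; rewrite //= ltnn ltnSn Cj ltNge hc.
rewrite heval_IfX [xr (tick _ _) _]k5 [xr (tick _ _) _]k1; case: ltP => hc /=.
  have U k : conn (mix j.+1) k = conn (mix j) k.
    have [->|/mix_ne[]//] := eqVneq k j.
    by rewrite /= ltnSn ltnn Cj /= leNgt hc.
  rewrite heval_Skip /=; split; last by lia.
  split=> //.
  - by move=> k hk; rewrite U; exact: j1.
  - move=> k hk; rewrite U => Ck; have [ek|/mix_ne[_ ->]] := eqVneq k j; last exact: j2.
    by move: Ck; rewrite ek /= ltnn Cj.
  - by move=> i k hi hk; rewrite (@below_sum_ext _ _ _ _ (fun k => ~~ conn (mix j) k)) ?j6 // => q hq; rewrite U.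
  - by move=> i k hi hk; rewrite (@below_cnt_ext _ _ _ _ (fun k => ~~ conn (mix j) k)) ?j7 // => q hq; rewrite U.
rewrite 2!heval_Seq; set s2 := heval (XSet 3 4 1) _.
have est : env (tick 1 (tick 1 s1)) by case: es1 => *; split.
have es2 : env s2 := env_heval (isT : safe (XSet 3 4 1)) (env_heval (isT : safe (NSet 1 4 7)) est).
have [[p0 p1 p2 p7 p8] _ _ _] := es1.
have n4 : nr s2 4%N = j by rewrite /s2 !hevalE.
have ck2 : clk s2 = (clk s1 + 16)%N by rewrite /s2 !hevalE /=; lia.
have rm := remove_client_ok es2 hj n4; have rc := remove_client_clk es2.
have a1 k : na s2 1%N k = if k == j then 1%N else na s1 1%N k.
  by rewrite /s2 !hevalE /= /upd2 /= k4 p7.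
have a0 k : na s2 0%N k = na s1 0%N k by rewrite /s2 !hevalE.
have b3 k : xa s2 3%N k = if k == j then c ib j else xa s1 3%N k.
  by rewrite /s2 !hevalE /= /upd2 /= k4 k1.
have b4 k : xa s2 4%N k = xa s1 4%N k by rewrite /s2 !hevalE.
have b1 k : xa s2 1%N k = xa s1 1%N k by rewrite /s2 !hevalE.
have b2 k : xa s2 2%N k = xa s1 2%N k by rewrite /s2 !hevalE.
clearbody s2; split; last by rewrite ?Cj ?hc /= mul1n; move: rc; rewrite ck2 /=; lia.
have U k : ~~ conn (mix j.+1) k = (~~ conn (mix j) k) && (k != j).
  have [->|nk] := eqVneq k j; first by rewrite andbF /= ltnSn Cj /= hc.
  by rewrite andbT; have [-> _] := mix_ne k nk.
split.
- move=> k hk; rewrite na_heval // a1; have [->|nk] := eqVneq k j; first by rewrite /= ltnSn Cj hc.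
  by have [-> _] := mix_ne k nk; exact: j1.
- move=> k hk Ck; rewrite xa_heval // b3; have [->|nk] := eqVneq k j; first by rewrite /= ltnSn Cj hc.
  by move: Ck; have [-> ->] := mix_ne k nk; exact: j2.
- by move=> i hi; rewrite xa_heval // b4; exact: j3.
- by move=> i hi; rewrite na_heval // a0; exact: j4.
- by move=> e; rewrite na_heval // a0; exact: j5.
- move=> i k hi hk; have [-> _] := rm i k hi hk; rewrite b1 j6 //=.
  have Uj : ~~ conn (mix j) j by rewrite /= ltnn Cj.
  rewrite -(@below_sum_remove _ nC (c i) (fun k => ~~ conn (mix j) k)) //.
  by apply: below_sum_ext => q hq; rewrite U.
- move=> i k hi hk; have [_ ->] := rm i k hi hk; rewrite b2 j7 //=.
  have Uj : ~~ conn (mix j) j by rewrite /= ltnn Cj.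
  rewrite -(@below_cnt_remove _ nC (c i) (fun k => ~~ conn (mix j) k)) //.
  by apply: below_cnt_ext => q hq; rewrite U.
Qed.
End Connect.

Definition nb_true (n : nat) (P : nat -> bool) : nat := (\sum_(0 <= k < n) P k)%N.

Lemma nb_true_compl n P : (nb_true n P + nb_true n (fun k => ~~ P k))%N = n.
Proof.
rewrite /nb_true -big_split /= (@eq_big_nat _ _ _ _ _ _ (fun=> 1%N)).
  by rewrite sum_nat_const_nat subn0 muln1.
by move=> k _; case: (P k).
Qed.

Lemma nb_true_gt0 n (P : nat -> bool) k : (k < n)%N -> P k -> (0 < nb_true n P)%N.
Proof.
move=> hk Pk; rewrite /nb_true big_mkord (bigD1 (Ordinal hk)) //= Pk.
by rewrite addn_gt0.
Qed.

Lemma nb_true_full n (P : nat -> bool) : (n <= nb_true n P)%N -> forall k, (k < n)%N -> P k.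
Proof.
move=> h k hk; apply/negPn/negP => nP.
have := @nb_true_gt0 n (fun k => ~~ P k) k hk nP; have := nb_true_compl n P; lia.
Qed.

Lemma nb_true_new n (P Q : nat -> bool) : (forall k, P k -> Q k) ->
  nb_true n Q = (nb_true n P + nb_true n (fun k => Q k && ~~ P k))%N.
Proof.
move=> h; rewrite /nb_true -big_split /=; apply: eq_big_nat => k _.
by have := h k; case: (P k); case: (Q k) => // ->.
Qed.

(** * The greedy loop and its running time *)

Section JMSProgram.
Variables (R : realType) (nF nC r : nat) (f : nat -> R) (c : nat -> nat -> R).
Implicit Types s : hst R.
Local Notation env := (env nF nC r f c).
Local Notation jrep := (jrep nF nC r c).
Local Notation ix := (ix nF nC).
Local Notation loop_limit := (loop_limit nF nC).
Local Notation remove_cost := (remove_cost nF nC).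
Let g i : R := 38%:R / 25%:R * f i.
Hypothesis nF_gt0 : (0 < nF)%N.
Hypothesis f_ge0 : forall i, (i < nF)%N -> 0 <= f i.
Hypothesis c_ge0 : forall i j, (i < nF)%N -> (j < nC)%N -> 0 <= c i j.
Hypothesis c_metric : forall i i' j j', (i < nF)%N -> (i' < nF)%N -> (j < nC)%N -> (j' < nC)%N ->
  c i j <= c i j' + c i' j' + c i' j.

Lemma g_ge0 i : (i < nF)%N -> 0 <= g i.
Proof. by move=> hi; rewrite mulr_ge0 ?f_ge0 // divr_ge0. Qed.

Lemma clk_env p s : env s -> all (fun b => (b == 0) || (b == 1))%N (limits p) ->
  all (fun b => b \notin writes p) (limits p) ->
  (clk (heval p s) <= clk s + bound loop_limit p)%N.
Proof.
move=> [[e0 e1 _ _ _] _ _ _] /allP h1 /allP h2; apply: clk_heval => // b hb.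
by have /orP[/eqP ->|/eqP ->] := h1 b hb.
Qed.

(** The dual values and the history exist only in the proof; the program does not store them. *)
Definition reached st : Prop := exists L tl al rk h, jinv nF nC g c L st tl al rk h.

Definition select_cost := bound loop_limit select_star.

Lemma jms_round_ok st s : env s -> jrep st s -> reached st ->
  exists st', [/\ jrep st' (heval jms_round s), reached st',
     (forall k, conn st k -> conn st' k),
     (forall k, (k < nC)%N -> conn st k) \/ (0 < nb_true nC (fun k => conn st' k && ~~ conn st k))%N
   & (clk (heval jms_round s) <= clk s + select_cost + nC * 48 + 25 +
        nb_true nC (fun k => conn st' k && ~~ conn st k) * remove_cost)%N].
Proof.
move=> es js rs; rewrite /jms_round heval_Seq; set s1 := heval select_star s.
have es1 : env s1 by apply: env_heval.
have js1 : jrep st s1 by apply: jrep_heval.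
have ck : (clk s1 <= clk s + select_cost)%N by apply: clk_env.
have [[e0 e1 e2 e7 e8] _ _ _] := es1.
rewrite heval_IfN e8.
have [[h9 hall]|[h9 [sel h11]]] := select_star_selected nF_gt0 es js; rewrite -/s1 in h9.
  exists st; rewrite h9 /= heval_Skip; split=> //; first by case: js1 => *; split.
    by left.
  by rewrite /=; move: ck; clear; lia.
rewrite -/s1 in sel h11; rewrite h9 /= heval_Seq.
have hib : (nr s1 10%N < nF)%N by case: sel.
have est : env (tick 1 s1) by case: es1 => *; split.
have jst : jrep st (tick 1 s1) by case: js1 => *; split.
have js2 := open_star_ok (xr s1 5%N) hib est jst erefl.
set s2 := heval open_star (tick 1 s1).
have es2 : env s2 by apply: env_heval.
have n11 : nr s2 11%N = ix (nr s1 10%N) 0 by rewrite /s2 nr_heval.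
have x5 : xr s2 5%N = xr s1 5%N by rewrite /s2 xr_heval.
have ck2 : (clk s2 <= clk s1 + 16)%N.
  by rewrite /s2 /open_star !hevalE /=; lia.
have [js3 ck3] := connect_clients_ok hib es2 js2 n11 x5.
exists (jstep c st (xr s1 5%N) (nr s1 10%N)); split=> //.
- have [L [tl [al [rk [h inv]]]]] := rs.
  by do 5!eexists; apply: (jinv_step g_ge0 c_metric inv sel).
- by move=> k /= ->.
- right; have [L [tl [al [rk [h inv]]]]] := rs.
  have [k [hk nk ck']] := jstep_progress inv sel.
  by apply: (nb_true_gt0 hk); rewrite /= ck' orbT nk.
- move: ck3; rewrite -/(nb_true _ _); set M := (nb_true _ _ * _)%N; move: ck ck2; clear; lia.
Qed.

(** [jms] nests four loops, so a bound by depth would be quartic. Table removals are therefore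
    charged to the clients that become connected, at most [nC] in total. *)
Definition jms_cost := (nC * (select_cost + nC * 48 + 29) + nC * remove_cost + 3)%N.

Lemma jms_ok s : env s -> jrep (jinit g) s ->
  exists st, [/\ jrep st (heval jms s), reached st, (forall k, (k < nC)%N -> conn st k)
    & (clk (heval jms s) <= clk s + jms_cost)%N].
Proof.
move=> es js; have [[e0 e1 e2 e7 e8] _ _ _] := es.
have [||it s' hit [st [js' rs lo ck]] n12 fr|s' -> [st [js' rs lo ck]]] := @for_rule R (fun it s' =>
   exists st, [/\ jrep st s', reached st, (it <= nb_true nC (conn st))%N &
    (clk s' <= clk s + 1 + it * (select_cost + nC * 48 + 29) + nb_true nC (conn st) * remove_cost)%N])
   12%N 1%N jms_round s; last 1 first.
- rewrite e1 in lo ck; exists st; split=> //.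
  + by case: js' => *; split.
  + exact: nb_true_full.
  + have cle : (nb_true nC (conn st) <= nC)%N by have := nb_true_compl nC (conn st); lia.
    have : (nb_true nC (conn st) * remove_cost <= nC * remove_cost)%N by rewrite leq_mul2r cle orbT.
    rewrite /jms_cost /=; move: ck; clear; lia.
- exact: isT.
- exists (jinit g); split=> //; first by case: js => *; split.
    by exists 0%N, 0, (fun=> 0), (fun=> 0%N), (fun _ _ => 0); apply: jinv_init => //; exact: g_ge0.
  by rewrite /= -addnA leq_addr.
rewrite e1 in hit.
have es' := env_frame (isT : safe (For 12 1 jms_round)) fr es.
have [st' [js2 rs' mono prog ck2]] := jms_round_ok es' js' rs.
have cn := nb_true_new nC mono.
exists st'; split=> //.
- by case: js2 => *; split.
- rewrite cn; case: prog => [hall|]; last by lia.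
  suff : nb_true nC (conn st) = nC by lia.
  have : nb_true nC (fun k => ~~ conn st k) = 0%N.
    by rewrite /nb_true big_nat_cond big1 // => k /andP[/andP[_ hk] _]; rewrite hall.
  by have := nb_true_compl nC (conn st); lia.
- rewrite cn mulnDl /=; move: ck ck2; move: (_ * remove_cost)%N (_ * remove_cost)%N => M1 M2; clear; lia.
Qed.

End JMSProgram.

(** * Filling the tables at the start *)

Section Init.
Variables (R : realType) (nF nC r : nat) (f : nat -> R) (c : nat -> nat -> R).
Implicit Types s : hst R.
Local Notation env := (env nF nC r f c).
Local Notation jrep := (jrep nF nC r c).
Local Notation ix := (ix nF nC).
Let g i : R := 38%:R / 25%:R * f i.

Record loaded s : Prop := Loaded {
  ld_nr : [/\ nr s 0%N = nF, nr s 1%N = nC & nr s 2%N = r];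
  ld_f : forall i, (i < nF)%N -> xa s 0%N i = f i;
  ld_c : forall i j, (i < nF)%N -> (j < nC)%N -> xa s 0%N (ix i j) = c i j;
  ld_na : forall k i, (k < 2)%N -> na s k i = 0%N }.

Lemma init_consts_ok s : loaded s -> env (heval init_consts s).
Proof.
move=> [[h0 h1 h2] hf hc _]; rewrite /init_consts !hevalE; split=> //=.
Qed.

Lemma init_fp_ok s : env s -> forall i, (i < nF)%N -> xa (heval init_fp s) 4%N i = g i.
Proof.
move=> es; have [[e0 e1 e2 e7 e8] _ _ _] := es.
rewrite /init_fp; set body := (XGet 0 0 3;; _).
have [||i s' hi b n3 fr|s' -> b] := @for_rule R (fun i s' =>
   forall k, (k < i)%N -> xa s' 4%N k = g k) 3%N 0%N body s; last 1 first.
- by move=> i hi; rewrite /= b ?e0.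
- exact: isT.
- by [].
have [_ [x20 _ _] ef _] := env_frame (isT : safe (For 3 0 body)) fr es.
rewrite e0 in hi; move=> k hk; rewrite /body !hevalE /= /upd2 /upd /= n3.
have [->|nk] := eqVneq k i; first by rewrite ef // x20 mulrC.
by apply: b; lia.
Qed.

Lemma sum_below_ok s i j : env s -> (i < nF)%N -> (j < nC)%N ->
  nr s 6%N = ix i 0 -> xr s 0%N = c i j -> xr s 1%N = 0 -> xr s 2%N = 0 ->
  xr (heval sum_below s) 1%N = below_sum nC (fun=> true) (c i) j /\
  xr (heval sum_below s) 2%N = below_cnt nC (fun=> true) (c i) j.
Proof.
move=> es hi hj n6 x0 x1 x2; rewrite /sum_below; set body := (XGet 3 0 6;; _).
have [[e0 e1 e2 e7 e8] _ _ _] := es.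
have [||k s' hk [b1 b2 m6] n13 fr|s' -> [b1 b2 _]] := @for_rule R (fun k s' =>
   [/\ xr s' 1%N = below_sum k (fun=> true) (c i) j,
       xr s' 2%N = \sum_(0 <= k' < k) (if c i k' <= c i j then 1 else 0) &
       nr s' 6%N = ix i k]) 13%N 1%N body s; last 1 first.
- by rewrite e1 in b1 b2; split.
- exact: isT.
- by rewrite /= /below_sum !big_geq // /upd /= n6 x1 x2; split.
have [[q0 q1 q2 q7 q8] [q20 q30 q31] _ qc] := env_frame (isT : safe (For 13 1 body)) fr es.
have [_ f2 _ _] := fr; have y0 : xr s' 0%N = c i j by rewrite f2.
rewrite e1 in hk; rewrite /body !heval_Seq heval_NA; set s1 := heval (XGet _ _ _) _.
have z3 : xr s1 3%N = c i k by rewrite /s1 !hevalE /= /upd /= m6 qc.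
have z0 : xr s1 0%N = c i j by rewrite /s1 !hevalE.
have z1 : xr s1 1%N = below_sum k (fun=> true) (c i) j by rewrite /s1 !hevalE.
have z2 : xr s1 2%N = \sum_(0 <= k' < k) (if c i k' <= c i j then 1 else 0) by rewrite /s1 !hevalE.
have z30 : xr s1 30%N = 1 by rewrite /s1 !hevalE.
have m1 : nr s1 6%N = ix i k by rewrite /s1 !hevalE.
have m7 : nr s1 7%N = 1%N by rewrite /s1 !hevalE.
clearbody s1; rewrite heval_IfX z0 z3 /below_sum !big_nat_recr //=.
by case: ltP => hc; rewrite !hevalE /= /upd /= ?z1 ?z2 ?z3 ?z30 ?m1 ?m7 ?addr0;
  split=> //; rewrite /ix; lia.
Qed.

Definition filled s (cond : nat -> nat -> bool) : Prop :=
  forall i j, (i < nF)%N -> (j < nC)%N -> cond i j ->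
    xa s 1%N (ix i j) = below_sum nC (fun=> true) (c i) j /\
    xa s 2%N (ix i j) = below_cnt nC (fun=> true) (c i) j.

Lemma filled_same s s' (cond cond' : nat -> nat -> bool) : (forall k i, xa s' k i = xa s k i) ->
  (forall i j, (i < nF)%N -> (j < nC)%N -> cond' i j -> cond i j) ->
  filled s cond -> filled s' cond'.
Proof. by move=> h1 h2 h i j hi hj hc; rewrite !h1; apply: h => //; exact: h2. Qed.

Lemma init_below_ok s : env s -> filled (heval init_below s) (fun _ _ => true).
Proof.
move=> es; rewrite /init_below heval_Seq; set s1 := heval (NA 5 0 8) s.
have es1 : env s1 by apply: env_heval.
have [[e0 e1 e2 e7 e8] _ _ _] := es.
have n51 : nr s1 5%N = ix 0 0 by rewrite /s1 !hevalE /= /upd /= e0 e8 /ix; lia.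
clearbody s1; set body := (NA 11 5 8;; _).
have [[q0 q1 _ _ _] _ _ _] := es1.
have [||i s' hi [b n5] n3 fr|s' -> [b _]] := @for_rule R (fun i s' =>
   filled s' (fun i' _ => (i' < i)%N) /\ nr s' 5%N = ix i 0) 3%N 0%N body s1; last 1 first.
- by rewrite q0 in b; apply: filled_same b.
- exact: isT.
- by split.
rewrite q0 in hi.
have es' := env_frame (isT : safe (For 3 0 body)) fr es1.
have [[g0 g1 g2 g7 g8] _ _ gc] := es'.
rewrite /body heval_Seq; set s2 := heval (NA 11 5 8) s'.
have es2 : env s2 by apply: env_heval.
have n52 : nr s2 5%N = ix i 0 by rewrite /s2 !hevalE.
have n112 : nr s2 11%N = ix i 0 by rewrite /s2 !hevalE /= /upd /= n5 g8 addn0.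
have b2 : filled s2 (fun i' _ => (i' < i)%N).
  by apply: filled_same b => // k m; rewrite /s2 !hevalE.
clearbody s2; set ibody := (NA 6 11 8;; _).
have [[p0 p1 p2 p7 p8] _ _ pc] := es2.
have [||j s3 hj [b3 m5] n4 fr3|s3 -> [b3 m5]] := @for_rule R (fun j s3 =>
   filled s3 (fun i' j' => (i' < i)%N || (i' == i) && (j' < j)%N) /\ nr s3 5%N = ix i j)
   4%N 1%N ibody s2; last 1 first.
- rewrite p1 in b3 m5; split; last by rewrite /= /upd /= m5 ixS.
  by apply: filled_same b3 => // i' j' _ hj' h; rewrite hj' andbT; lia.
- exact: isT.
- split=> //; apply: filled_same b2 => // i' j' _ _; by rewrite ltn0 andbF orbF.
rewrite p1 in hj.
have es3 := env_frame (isT : safe (For 4 1 ibody)) fr3 es2.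
have [[t0 t1 t2 t7 t8] _ _ tc] := es3.
have [f1 _ _ _] := fr3; have m11 : nr s3 11%N = ix i 0 by rewrite f1.
rewrite /ibody.
set pre := NA 6 11 8;; XC 1 0;; XC 2 0;; XGet 0 0 5.
set post := XSet 1 5 1;; XSet 2 5 2;; NA 5 5 7.
rewrite -[heval _ s3]/(heval post (heval sum_below (heval pre s3))).
set s4 := heval pre s3.
have es4 : env s4 by apply: env_heval.
have k6 : nr s4 6%N = ix i 0 by rewrite /s4 /pre !hevalE /= /upd /= m11 t8 addn0.
have k0 : xr s4 0%N = c i j by rewrite /s4 /pre !hevalE /= /upd /= m5 tc.
have k1 : xr s4 1%N = 0 by rewrite /s4 /pre !hevalE.
have k2 : xr s4 2%N = 0 by rewrite /s4 /pre !hevalE.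
have [v1 v2] := sum_below_ok es4 hi hj k6 k0 k1 k2.
set s5 := heval sum_below s4 in v1 v2 *.
have w5 : nr s5 5%N = ix i j by rewrite /s5 nr_heval // /s4 nr_heval.
have w7 : nr s5 7%N = 1%N by rewrite /s5 nr_heval // /s4 nr_heval.
have wa k m : xa s5 k m = xa s3 k m by rewrite /s5 xa_heval // /s4 xa_heval.
clearbody s5; rewrite /post !hevalE; split; last by rewrite /= /upd /= w5 w7 /ix; lia.
move=> i' j' hi' hj' hc /=; rewrite /upd2 /upd /= w5 ix_eq // v1 v2 !wa.
case: ifP => [/andP[/eqP -> /eqP ->]//|nij]; apply: b3 => //.
move: hc; rewrite ltnS [(j' <= j)%N]leq_eqVlt => /orP[->//|/andP[h1 /orP[h2|h2]]].
  by rewrite h1 h2 in nij.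
by rewrite h1 h2 orbT.
Qed.

Lemma init_ok s : loaded s -> env (heval init s) /\ jrep (jinit g) (heval init s).
Proof.
move=> ls; have [_ _ _ z] := ls.
rewrite /init 2!heval_Seq; set s1 := heval init_consts s.
have es1 : env s1 by apply: init_consts_ok.
have es2 : env (heval init_fp s1) by apply: env_heval.
have es3 : env (heval init_below (heval init_fp s1)) by apply: env_heval.
have fl := init_below_ok es2.
split=> //; split.
- by move=> j hj; rewrite na_heval // na_heval // na_heval // z.
- by [].
- by move=> i hi; rewrite xa_heval // init_fp_ok.
- by move=> i hi; rewrite na_heval // na_heval // na_heval // z.
- by move=> e; rewrite na_heval // na_heval // na_heval // z.
- by move=> i j hi hj; have [] := fl i j hi hj isT.
- by move=> i j hi hj; have [] := fl i j hi hj isT.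
Qed.

End Init.

(** * Running greedy augmentation *)

Section AugmentProgram.
Variables (R : realType) (nF nC r : nat) (f : nat -> R) (c : nat -> nat -> R).
Implicit Types s : hst R.
Local Notation env := (env nF nC r f c).
Local Notation ix := (ix nF nC).
Local Notation saving := (saving nC c).
Local Notation on_track := (on_track nF nC r f c).
Hypothesis r_gt0 : (0 < r)%N.
Hypothesis f_ge0 : forall i, (i < nF)%N -> 0 <= f i.
Hypothesis c_ge0 : forall i j, (i < nF)%N -> (j < nC)%N -> 0 <= c i j.

Record arep (opn : nat -> bool) (rr : nat -> R) s : Prop := ARep {
  arep_opn : forall i, (i < nF)%N -> na s 0%N i = if opn i then r else 0%N;
  arep_x : forall e, na s 0%N (nF + e)%N = 0%N;
  arep_rr : forall j, (j < nC)%N -> xa s 3%N j = rr j }.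

Lemma arep_same opn rr s s' : (forall k i, na s' k i = na s k i) ->
  (forall k i, xa s' k i = xa s k i) -> arep opn rr s -> arep opn rr s'.
Proof. by move=> h1 h2 [a1 a2 a3]; split=> [i hi|e|j hj]; rewrite ?h1 ?h2; [exact: a1|exact: a2|exact: a3]. Qed.

Lemma arep_frame p opn rr s s' : quiet p -> frame p s s' -> arep opn rr s -> arep opn rr s'.
Proof.
move=> /andP[/eqP h1 /eqP h2] [_ _ g1 g2]; rewrite h1 h2 in g1 g2.
by apply: arep_same => k i; [exact: g1|exact: g2].
Qed.

Lemma sum_gain_ok opn rr s i : env s -> arep opn rr s -> (i < nF)%N ->
  nr s 5%N = ix i 0 -> xr s 0%N = 0 ->
  xr (heval sum_gain s) 0%N = saving rr i /\ nr (heval sum_gain s) 5%N = ix i.+1 0.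
Proof.
move=> es js hi h5 x0; rewrite /sum_gain; set body := (XGet 1 0 5 ;; _).
have [[e0 e1 e2 e7 e8] _ _ _] := es.
have [||j s' hj [b n5] n4 fr|s' -> [b n5]] := @for_rule R (fun j s' =>
   xr s' 0%N = \sum_(0 <= k < j) pospart (rr k - c i k) /\ nr s' 5%N = ix i j)
   4%N 1%N body s; last 1 first.
- by rewrite e1 in b n5; rewrite ixS; split.
- exact: isT.
- by rewrite big_geq.
have [[q0 q1 q2 q7 q8] _ _ qc] := env_frame (isT : safe (For 4 1 body)) fr es.
have [_ _ a3] := arep_frame (isT : quiet (For 4 1 body)) fr js.
rewrite e1 in hj; rewrite /body !heval_Seq heval_NA; set s1 := heval (XGet 2 3 4) _.
have z1 : xr s1 1%N = c i j by rewrite /s1 !hevalE /= /upd /= n5 qc.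
have z2 : xr s1 2%N = rr j by rewrite /s1 !hevalE /= /upd /= n4 a3.
have z0 : xr s1 0%N = \sum_(0 <= k < j) pospart (rr k - c i k) by rewrite /s1 !hevalE.
have z5 : nr s1 5%N = ix i j by rewrite /s1 !hevalE.
have z7 : nr s1 7%N = 1%N by rewrite /s1 !hevalE.
clearbody s1; rewrite heval_IfX z1 z2 big_nat_recr //=.
case: ltP => hc; rewrite !hevalE /= /upd /= ?z0 ?z1 ?z2 ?z5 ?z7; split; try by rewrite /ix; lia.
  by rewrite /pospart max_l // subr_ge0 ltW.
by rewrite /pospart max_r ?addr0 // subr_le0.
Qed.

(** Ratios of saving to price are compared by cross multiplication, because prices may be 0. Only
    sites whose saving exceeds their price compete. *)
Definition gain_best rr n s : Prop :=
  (nr s 9%N = 0%N /\ forall i, (i < n)%N -> saving rr i <= f i) \/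
  (nr s 9%N = 1%N /\ [/\ (nr s 10%N < n)%N, nr s 11%N = ix (nr s 10%N) 0,
      xr s 5%N = saving rr (nr s 10%N), xr s 7%N = f (nr s 10%N)
    & f (nr s 10%N) < saving rr (nr s 10%N)] /\
   forall i, (i < n)%N -> saving rr i * f (nr s 10%N) <= saving rr (nr s 10%N) * f i).

Lemma gain_best_same rr n s s' : nr s' 9%N = nr s 9%N -> nr s' 10%N = nr s 10%N ->
  nr s' 11%N = nr s 11%N -> xr s' 5%N = xr s 5%N -> xr s' 7%N = xr s 7%N ->
  gain_best rr n s -> gain_best rr n s'.
Proof. by rewrite /gain_best => -> -> -> -> ->. Qed.

Lemma gain_compare rr n s i : (i < nF)%N -> n = i -> gain_best rr n s ->
  nr s 8%N = 0%N -> nr s 3%N = i -> nr s 17%N = ix i 0 -> xr s 31%N = 0 ->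
  xr s 0%N = saving rr i -> xr s 2%N = f i ->
  gain_best rr i.+1 (heval (IfX 2 0 (IfN 8 9 (XM 3 5 2;; XM 4 0 7;; IfX 3 4 keep_gain Skip) keep_gain) Skip) s).
Proof.
move=> hi -> b n8 n3 n17 x31 x0 x2.
have fi0 := f_ge0 hi.
have fk0 k : (k < i)%N -> 0 <= f k by move=> hk; apply: f_ge0; lia.
have keep s' : nr s' 9%N = 1%N -> nr s' 10%N = i -> nr s' 11%N = ix i 0 ->
    xr s' 5%N = saving rr i -> xr s' 7%N = f i -> f i < saving rr i ->
    (forall k, (k < i)%N -> saving rr k * f i <= saving rr i * f k) -> gain_best rr i.+1 s'.
  move=> q9 q10 q11 q5 q7 lt h; right; rewrite q10; split=> //; split=> // k.
  by rewrite ltnS leq_eqVlt => /orP[/eqP ->|/h].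
rewrite heval_IfX x2 x0; case: ltP => hf.
  rewrite heval_IfN [nr (tick _ _) 8%N]n8 [nr (tick _ _) 9%N]/=.
  case: b => [[h9 hall]|[h9 [[h1 h2 h3 h4 h5] hall]]]; rewrite h9 /=.
    rewrite /keep_gain !hevalE; apply: keep; rewrite /= /upd //= ?n3 ?n8 ?n17 ?x31 ?x0 ?x2 ?addn0 ?addr0 //.
    move=> k hk; apply: (@le_trans _ _ (f k * f i)); first by rewrite ler_wpM2r // hall.
    by rewrite mulrC ler_wpM2r ?fk0 // ltW.
  rewrite 2!heval_Seq heval_IfX !heval_XM /= /upd /= h3 x2 x0 h4.
  case: ltP => hlt.
    rewrite /keep_gain !hevalE; apply: keep; rewrite /= /upd //= ?n3 ?n8 ?n17 ?x31 ?x0 ?x2 ?addn0 ?addr0 //.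
    move=> k hk; have := hall k hk; have := fk0 k hk; have := fk0 _ h1; move: h5 hlt hf fi0.
    move: (saving rr (nr s 10%N)) (saving rr i) (saving rr k) (f (nr s 10%N)) (f i) (f k) => sb si sk fb fi fk h5 hlt hf fi0 fb0 fk0' hk'.
    (* The new site beats the old one strictly, which is impossible for an old price 0; a positive
       [fb] can be cancelled in the transitivity argument. *)
    have fbp : 0 < fb by nra.
    rewrite -(ler_pM2r fbp); apply: (@le_trans _ _ (sb * fk * fi)); first by rewrite mulrAC ler_wpM2r.
    have : sb * fi * fk <= si * fb * fk by rewrite ler_wpM2r // ltW.
    by rewrite mulrAC [X in _ <= X -> _]mulrAC.
  rewrite heval_Skip; right; rewrite /= /upd /=; split=> //; split; first by split=> //; lia.
  move=> k; rewrite ltnS leq_eqVlt => /orP[/eqP ->|]; last exact: hall.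
  by rewrite mulrC in hlt; rewrite mulrC; move: hlt; rewrite mulrC [X in _ <= X]mulrC.
rewrite heval_Skip; case: b => [[h9 hall]|[h9 [[h1 h2 h3 h4 h5] hall]]]; [left|right]; split=> //.
  by move=> k; rewrite ltnS leq_eqVlt => /orP[/eqP ->|]; last exact: hall.
split=> /=; first by split=> //; lia.
move=> k; rewrite ltnS leq_eqVlt => /orP[/eqP ->|]; last exact: hall.
by have := fk0 _ h1; nra.
Qed.

Lemma select_gain_ok opn rr s : env s -> arep opn rr s ->
  gain_best rr nF (heval select_gain s).
Proof.
move=> es js; rewrite /select_gain 2!heval_Seq; set s1 := heval (NA 5 0 8) _.
have es1 : env s1 := env_heval (isT : safe (NA 5 0 8)) (env_heval (isT : safe (NC 9 0)) es).
have js1 : arep opn rr s1 by apply: arep_same js => k i; rewrite /s1 !hevalE.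
have [[e0 e1 e2 e7 e8] _ _ _] := es.
have n51 : nr s1 5%N = ix 0 0 by rewrite /s1 !hevalE /= /upd /= e0 e8 /ix; lia.
have n91 : nr s1 9%N = 0%N by rewrite /s1 !hevalE.
clearbody s1; set body := (NA 17 5 8;; _).
have [[q0 _ _ _ _] _ _ _] := es1.
have [||i s' hi [b5 n5] n3 fr|s' -> [b5 n5]] := @for_rule R (fun i s' =>
   gain_best rr i s' /\ nr s' 5%N = ix i 0) 3%N 0%N body s1; last 1 first.
- by rewrite q0 in b5; apply: gain_best_same b5.
- exact: isT.
- by split; [left; split|].
have es' := env_frame (isT : safe (For 3 0 body)) fr es1.
have js' := arep_frame (isT : quiet (For 3 0 body)) fr js1.
rewrite q0 in hi; rewrite /body.
set pre := NA 17 5 8;; XC 0 0.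
set cmp := IfX 2 0 _ _.
rewrite -[heval _ s']/(heval cmp (heval (XGet 2 0 3) (heval sum_gain (heval pre s')))).
set s2 := heval pre s'.
have es2 : env s2 by apply: env_heval.
have js2 : arep opn rr s2 := arep_frame (isT : quiet pre) (frame_heval _ _) js'.
have [[g0 g1 g2 g7 g8] _ _ _] := es'.
have n52 : nr s2 5%N = ix i 0 by rewrite /s2 /pre !hevalE.
have x02 : xr s2 0%N = 0 by rewrite /s2 /pre !hevalE.
have [x03 n53] := sum_gain_ok es2 js2 hi n52 x02.
set s3 := heval sum_gain s2 in x03 n53 *.
have es3 : env s3 by apply: env_heval.
have n172 : nr s3 17%N = ix i 0 by rewrite /s3 nr_heval // /s2 /pre !hevalE /= /upd /= n5 g8 addn0.
have n33 : nr s3 3%N = i by rewrite /s3 nr_heval // /s2 nr_heval.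
have b3 : gain_best rr i s3.
  by apply: gain_best_same b5; rewrite /s3 ?nr_heval ?xr_heval // /s2 ?nr_heval ?xr_heval.
have [[t0 t1 t2 t7 t8] [_ _ t31] tf _] := es3.
clearbody s3; set s4 := heval (XGet 2 0 3) s3.
have x24 : xr s4 2%N = f i by rewrite /s4 !hevalE /= /upd /= n33 tf.
split; last first.
  by rewrite /= /upd /= nr_heval // /s4 nr_heval.
have H : gain_best rr i.+1 (heval cmp s4).
  by apply: (@gain_compare rr i).
by apply: gain_best_same H.
Qed.

Lemma apply_gain_ok opn rr s b : env s -> arep opn rr s -> (b < nF)%N ->
  nr s 10%N = b -> nr s 11%N = ix b 0 ->
  arep (fun i => (i == b) || opn i) (fun j => if c b j < rr j then c b j else rr j)
    (heval apply_gain s).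
Proof.
move=> es js hb n10 n11; rewrite /apply_gain heval_Seq; set s1 := heval (NSet 0 10 2) s.
have es1 : env s1 by apply: env_heval.
have [[e0 e1 e2 e7 e8] _ _ _] := es.
have [a1 a2 a3] := js.
have b1 i : (i < nF)%N -> na s1 0%N i = if (i == b) || opn i then r else 0%N.
  by move=> hi; rewrite /s1 !hevalE /= /upd2 /= n10 e2; case: eqP => //= _; exact: a1.
have b2 e : na s1 0%N (nF + e)%N = 0%N.
  by rewrite /s1 !hevalE /= /upd2 /= n10 ifF ?a2 //; apply/eqP; lia.
have b3 j : (j < nC)%N -> xa s1 3%N j = rr j by move=> hj; rewrite /s1 !hevalE /= a3.
have m11 : nr s1 11%N = ix b 0 by rewrite /s1 !hevalE.
clearbody s1; set body := (XGet 1 0 11;; _).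
have [[q0 q1 _ _ _] _ _ _] := es1.
have [||j s' hj [d n5] n4 fr|s' E [d n5]] := @for_rule R (fun j s' =>
   (forall k, (k < nC)%N -> xa s' 3%N k =
      if (k < j)%N then (if c b k < rr k then c b k else rr k) else rr k) /\
   nr s' 11%N = ix b j) 4%N 1%N body s1; last 1 first.
- split.
  + by move=> i hi; rewrite na_heval // b1.
  + by move=> e; rewrite na_heval // b2.
  + by move=> j hj; rewrite E /= d // q1 hj.
- exact: isT.
- by split.
have [[g0 g1 g2 g7 g8] _ _ gc] := env_frame (isT : safe (For 4 1 body)) fr es1.
rewrite q1 in hj; rewrite /body !heval_Seq heval_NA; set s2 := heval (XGet 2 3 4) _.
have z1 : xr s2 1%N = c b j by rewrite /s2 !hevalE /= /upd /= n5 gc.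
have z2 : xr s2 2%N = rr j by rewrite /s2 !hevalE /= /upd /= n4 d // ltnn.
have z4 : nr s2 4%N = j by rewrite /s2 !hevalE.
have z11 : nr s2 11%N = ix b j by rewrite /s2 !hevalE.
have z7 : nr s2 7%N = 1%N by rewrite /s2 !hevalE.
have zd k : (k < nC)%N -> xa s2 3%N k =
      if (k < j)%N then (if c b k < rr k then c b k else rr k) else rr k.
  by move=> hk; rewrite /s2 !hevalE /= d.
clearbody s2; rewrite heval_IfX z1 z2; split.
  move=> k hk; rewrite ltnS leq_eqVlt.
  case: ltP => hc; rewrite !hevalE /= /upd2 /= ?z4 ?z1.
    by have [->|nk] := eqVneq k j; [rewrite hc|rewrite zd].
  by rewrite zd //; have [->|nk] := eqVneq k j; [rewrite ltnn ltNge hc|].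
by case: ltP => hc; rewrite !hevalE /= /upd /= z11 z7 /ix; lia.
Qed.

(** [rr j] is the distance from [j] to its nearest open site, so open sites offer no saving. *)
Definition covered (opn : nat -> bool) (rr : nat -> R) : Prop :=
  (forall i j, (i < nF)%N -> (j < nC)%N -> opn i -> rr j <= c i j) /\
  (forall j, (j < nC)%N -> exists i, [/\ (i < nF)%N, opn i & rr j = c i j]).

Lemma covered_ge0 opn rr j : covered opn rr -> (j < nC)%N -> 0 <= rr j.
Proof. by move=> [_ h] hj; have [i [hi _ ->]] := h j hj; exact: c_ge0. Qed.

(** Every effective round opens a new site, since open sites save nothing. After [nF] rounds either
    no site was worth opening or all are open, and in both cases no saving exceeds its price. *)
Lemma augment_ok opn rr s : env s -> arep opn rr s -> covered opn rr -> on_track opn rr ->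
  exists opn' rr', [/\ arep opn' rr' (heval augment s), covered opn' rr',
    on_track opn' rr' & forall i, (i < nF)%N -> saving rr' i <= f i].
Proof.
move=> es js cv ot; have [[e0 e1 e2 e7 e8] _ _ _] := es.
have [||it s' hit [o1 [q1 [js' cv' ot' prog]]] n12 fr|s' -> [o1 [q1 [js' cv' ot' prog]]]] :=
  @for_rule R (fun it s' => exists opn' rr', [/\ arep opn' rr' s', covered opn' rr',
    on_track opn' rr' & (forall i, (i < nF)%N -> saving rr' i <= f i) \/ (it <= nb_true nF opn')%N])
  12%N 0%N augment_round s; last 1 first.
- exists o1, q1; split=> //; first by apply: arep_same js'.
  case: prog => // ; rewrite e0 => /nb_true_full all i hi.
  rewrite /saving big_mkord; apply: le_trans (f_ge0 hi); apply: sumr_le0 => j _.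
  rewrite /pospart ge_max lexx andbT subr_le0.
  by case: cv' => h _; apply: h => //; exact: all.
- exact: isT.
- by exists opn, rr; split=> //; [exact: arep_same js|right].
rewrite e0 in hit.
have es' := env_frame (isT : safe (For 12 0 augment_round)) fr es.
rewrite /augment_round heval_Seq; set s1 := heval select_gain s'.
have es1 : env s1 by apply: env_heval.
have js1 : arep o1 q1 s1 := arep_frame (isT : quiet select_gain) (frame_heval _ _) js'.
have [[t0 t1 t2 t7 t8] _ _ _] := es1.
have := select_gain_ok es' js'; rewrite -/s1 heval_IfN t8.
case=> [[h9 hall]|[h9 [[h1 h2 h3 h4 h5] hall]]]; rewrite h9 /=.
  exists o1, q1; split=> //; last by left.
  by apply: arep_same js1 => k i; rewrite heval_Skip.
have est : env (tick 1 s1) by case: es1 => *; split.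
have jst : arep o1 q1 (tick 1 s1) by apply: arep_same js1.
set b := nr s1 10%N in h1 h2 h3 h4 h5 hall.
exists (fun i => (i == b) || o1 i), (fun j => if c b j < q1 j then c b j else q1 j); split.
- by apply: arep_same (apply_gain_ok est jst h1 erefl h2).
- case: cv' => cv1 cv2; split.
    move=> i j hi hj /orP[/eqP ->|oi]; first by case: ltP => // /ltW.
    by have := cv1 i j hi hj oi; case: ltP => // h h'; apply: le_trans (ltW h) h'.
  move=> j hj; case: ltP => _; first by exists b; rewrite eqxx.
  by have [i [hi oi ->]] := cv2 j hj; exists i; rewrite oi orbT.
- apply: on_track_step => //; last exact: ltW.
  by move=> j hj; exact: covered_ge0 cv' hj.
- case: prog => [h|h]; first by have := h _ h1; rewrite leNgt h5.
  right; have nb : ~~ o1 b.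
    apply/negP => ob; have : saving q1 b <= 0.
      rewrite /saving big_mkord; apply: sumr_le0 => j _.
      rewrite /pospart ge_max lexx andbT subr_le0.
      by case: cv' => h' _; apply: h'.
    by have := f_ge0 h1; move: h5; lra.
  rewrite (@nb_true_new _ o1); last by move=> k ->; rewrite orbT.
  have := @nb_true_gt0 nF (fun k => ((k == b) || o1 k) && ~~ o1 k) b h1.
  by rewrite eqxx nb => /(_ isT); lia.
Qed.

End AugmentProgram.

(** * Writing the connections *)

Section Assign.
Variables (R : realType) (nF nC r : nat) (f : nat -> R) (c : nat -> nat -> R).
Implicit Types s : hst R.
Local Notation env := (env nF nC r f c).
Local Notation ix := (ix nF nC).
Hypothesis r_gt0 : (0 < r)%N.
Variables (opn : nat -> bool) (rr : nat -> R).

(** All [r] connections of [j] go to one site, which is possible because that site has [r]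
    facilities. The program takes the first open site that passes the comparison, hence the
    inequality. *)
Definition assigned s j : Prop := exists i0, [/\ (i0 < nF)%N, opn i0, c i0 j <= rr j
  & forall i, (i < nF)%N -> na s 0%N (ix i j) = if i == i0 then r else 0%N].

Lemma assign_client_ok s j : env s -> (j < nC)%N ->
  (forall i, (i < nF)%N -> na s 0%N i = if opn i then r else 0%N) ->
  (forall i, (i < nF)%N -> na s 0%N (ix i j) = 0%N) ->
  (exists i, [/\ (i < nF)%N, opn i & c i j <= rr j]) ->
  nr s 9%N = 0%N -> nr s 5%N = ix 0 j -> xr s 2%N = rr j ->
  let s' := heval assign_client s in
  assigned s' j /\ (forall k, (forall i, (i < nF)%N -> k != ix i j) -> na s' 0%N k = na s 0%N k).
Proof.
move=> es hj ho hz [w [hw ow cw]] n9 n5 x2; rewrite /assign_client; set body := (NGet 16 0 3;; _).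
have [[e0 e1 e2 e7 e8] _ _ _] := es.
have [||i s' hi [p1 p2 m5] n3 fr|s' -> [p1 p2 _]] := @for_rule R (fun i s' =>
  [/\ forall k, (forall i', (i' < i)%N -> k != ix i' j) -> na s' 0%N k = na s 0%N k,
    (nr s' 9%N = 0%N /\ forall i', (i' < i)%N -> na s' 0%N (ix i' j) = 0%N /\ (opn i' -> rr j < c i' j)) \/
    (nr s' 9%N = 1%N /\ exists i0, [/\ (i0 < i)%N, opn i0, c i0 j <= rr j &
       forall i', (i' < i)%N -> na s' 0%N (ix i' j) = if i' == i0 then r else 0%N])
    & nr s' 5%N = ix i j]) 3%N 0%N body s; last 1 first.
- rewrite e0 in p1 p2; split=> //.
  case: p2 => [[_ h]|[_ [i0 [h1 h2 h3 h4]]]]; last by exists i0.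
  by have [_ /(_ ow)] := h w hw; rewrite ltNge cw.
- exact: isT.
- by split=> //; left.
rewrite e0 in hi.
have [[q0 q1 q2 q7 q8] _ _ qc] := env_frame (isT : safe (For 3 0 body)) fr es.
have [_ f2 _ _] := fr; have y2 : xr s' 2%N = rr j by rewrite f2.
have oi : na s' 0%N i = if opn i then r else 0%N.
  by rewrite p1 ?ho // => i' hi'; rewrite /ix; apply/eqP; lia.
have zi : na s' 0%N (ix i j) = 0%N.
  by rewrite p1 ?hz // => i' hi'; rewrite ix_eq // eqxx andbT; apply/eqP; lia.
rewrite /body 2!heval_Seq heval_NA; set s1 := heval (NGet 16 0 3) s'.
have k16 : nr s1 16%N = if opn i then r else 0%N by rewrite /s1 !hevalE /= /upd /= n3 oi.
have k8 : nr s1 8%N = 0%N by rewrite /s1 !hevalE.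
have k9 : nr s1 9%N = nr s' 9%N by rewrite /s1 !hevalE.
have k5 : nr s1 5%N = ix i j by rewrite /s1 !hevalE.
have k2 : nr s1 2%N = r by rewrite /s1 !hevalE.
have k1 : nr s1 1%N = nC by rewrite /s1 !hevalE.
have x1 : xr s1 2%N = rr j by rewrite /s1 !hevalE.
have xc : xa s1 0%N (ix i j) = c i j by rewrite /s1 !hevalE /= qc.
have na1 k m : na s1 k m = na s' k m by rewrite /s1 !hevalE.
clearbody s1.
set inner := IfN 8 16 _ _.
have l5 : nr (heval inner s1) 5%N = ix i j by rewrite nr_heval.
have l1 : nr (heval inner s1) 1%N = nC by rewrite nr_heval.
suff [P1 P2] :
  (forall k, (forall i', (i' < i.+1)%N -> k != ix i' j) -> na (heval inner s1) 0%N k = na s 0%N k) /\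
  ((nr (heval inner s1) 9%N = 0%N /\ forall i', (i' < i.+1)%N ->
      na (heval inner s1) 0%N (ix i' j) = 0%N /\ (opn i' -> rr j < c i' j)) \/
    (nr (heval inner s1) 9%N = 1%N /\ exists i0, [/\ (i0 < i.+1)%N, opn i0, c i0 j <= rr j &
       forall i', (i' < i.+1)%N -> na (heval inner s1) 0%N (ix i' j) = if i' == i0 then r else 0%N])).
  split; [exact: P1|exact: P2|].
  by rewrite /= /upd /= l5 l1 /ix mulSn; lia.
have same s2 : (forall m, na s2 0%N m = na s' 0%N m) ->
    (forall k, (forall i', (i' < i.+1)%N -> k != ix i' j) -> na s2 0%N k = na s 0%N k).
  by move=> h k hk; rewrite h p1 // => i' hi'; apply: hk; lia.
have skip s2 : (forall m, na s2 0%N m = na s' 0%N m) -> nr s2 9%N = nr s' 9%N ->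
   (opn i -> (0 < nr s' 9%N)%N \/ rr j < c i j) ->
   (nr s2 9%N = 0%N /\ forall i', (i' < i.+1)%N ->
      na s2 0%N (ix i' j) = 0%N /\ (opn i' -> rr j < c i' j)) \/
    (nr s2 9%N = 1%N /\ exists i0, [/\ (i0 < i.+1)%N, opn i0, c i0 j <= rr j &
       forall i', (i' < i.+1)%N -> na s2 0%N (ix i' j) = if i' == i0 then r else 0%N]).
  move=> h h9 hs; rewrite h9; case: p2 => [[g9 g]|[g9 [i0 [g1 g2 g3 g4]]]]; [left|right]; split=> //.
    move=> i'; rewrite ltnS leq_eqVlt h => /orP[/eqP ->|/g//]; split=> // /hs.
    by rewrite g9 => -[].
  exists i0; split=> //; first by lia.
  move=> i'; rewrite ltnS leq_eqVlt h => /orP[/eqP ->|/g4//].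
  by rewrite zi ifF //; apply/eqP; lia.
rewrite /inner heval_IfN k8 k16; case Oi: (opn i); rewrite /= ?r_gt0; last first.
  rewrite heval_Skip; split; first by apply: same => m /=; rewrite na1.
  by apply: skip; rewrite ?Oi //= => m; rewrite na1.
rewrite heval_IfN [nr (tick _ _) 8%N]k8 [nr (tick _ _) 9%N]k9.
case: (posnP (nr s' 9%N)) => h9 /=; last first.
  rewrite heval_Skip; split; first by apply: same => m /=; rewrite na1.
  by apply: skip => [m|//|_]; [rewrite /= na1|left].
rewrite heval_Seq heval_IfX; set s2 := heval (XGet 1 0 5) _.
have z1 : xr s2 1%N = c i j by rewrite /s2 !hevalE /= /upd /= k5 xc.
have z2 : xr s2 2%N = rr j by rewrite /s2 !hevalE.
have z9 : nr s2 9%N = nr s' 9%N by rewrite /s2 !hevalE.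
have z5 : nr s2 5%N = ix i j by rewrite /s2 !hevalE.
have zz2 : nr s2 2%N = r by rewrite /s2 !hevalE.
have na2 m : na s2 0%N m = na s' 0%N m by rewrite /s2 !hevalE /= na1.
clearbody s2; rewrite z1 z2; case: ltP => hc.
  rewrite heval_Skip; split; first by apply: same => m /=; rewrite na2.
  by apply: skip => [m|//|_]; [rewrite /= na2|right].
rewrite !hevalE; split.
  move=> k hk; rewrite /= /upd2 /= z5 (negPf (hk i (ltnSn _))) na2 p1 // => i' hi'.
  by apply: hk; lia.
right; split=> //; exists i; split=> //.
move=> i' hi'; rewrite /= /upd2 /= z5 ix_eq // eqxx andbT zz2; case: eqP => // ni.
have {}hi' : (i' < i)%N by lia.
rewrite na2; case: p2 => [[_ g]|[g9]]; last by rewrite h9 in g9.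
by have [] := g i' hi'.
Qed.

Lemma assign_ok s : env s -> arep nF nC r opn rr s ->
  (forall j, (j < nC)%N -> exists i, [/\ (i < nF)%N, opn i & c i j <= rr j]) ->
  let s' := heval assign s in
  (forall i, (i < nF)%N -> na s' 0%N i = if opn i then r else 0%N) /\
  (forall j, (j < nC)%N -> assigned s' j).
Proof.
move=> es [a1 a2 a3] ex; rewrite /assign; set body := (NC 9 0;; _).
have [[e0 e1 e2 e7 e8] _ _ _] := es.
have [||j s' hj [p1 p2 p3] n4 fr|s' -> [p1 p2 _]] := @for_rule R (fun j s' =>
  [/\ forall i, (i < nF)%N -> na s' 0%N i = if opn i then r else 0%N,
      forall j', (j' < j)%N -> assigned s' j' &
      forall i j', (i < nF)%N -> (j <= j')%N -> (j' < nC)%N -> na s' 0%N (ix i j') = 0%N])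
  4%N 1%N body s; last 1 first.
- by rewrite e1 in p2; split.
- exact: isT.
- by split=> // i j' _ _ _; rewrite /= /ix -addnA a2.
rewrite e1 in hj.
have es' := env_frame (isT : safe (For 4 1 body)) fr es.
have [_ _ _ f4] := fr.
rewrite /body.
set pre := NC 9 0;; NA 5 0 4;; XGet 2 3 4.
rewrite -[heval _ s']/(heval assign_client (heval pre s')).
set s2 := heval pre s'.
have es2 : env s2 by apply: env_heval.
have [[q0 q1 q2 q7 q8] _ _ _] := es'.
have na2 m : na s2 0%N m = na s' 0%N m by rewrite /s2 /pre !hevalE.
have k9 : nr s2 9%N = 0%N by rewrite /s2 /pre !hevalE.
have k5 : nr s2 5%N = ix 0 j by rewrite /s2 /pre !hevalE /= /upd /= q0 n4 /ix; lia.
have x2 : xr s2 2%N = rr j by rewrite /s2 /pre !hevalE /= /upd /= n4 f4 // a3.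
have [||A B] := assign_client_ok es2 hj _ _ (ex j hj) k9 k5 x2.
- by move=> i hi; rewrite na2 p1.
- by move=> i hi; rewrite na2 p3.
split.
- move=> i hi; rewrite /= B ?na2 ?p1 // => i' hi'.
  by rewrite /ix; apply/eqP; lia.
- move=> j'; rewrite ltnS leq_eqVlt => /orP[/eqP ->|hj'].
    by have [i0 [? ? ? ?]] := A; exists i0.
  have [i0 [g1 g2 g3 g4]] := p2 j' hj'; exists i0; split=> // i hi.
  rewrite /= B ?na2 ?g4 // => i' hi'; rewrite ix_eq //; last by lia.
  by rewrite negb_and; apply/orP; right; apply/eqP; lia.
- move=> i j' hi h1 h2; rewrite /= B ?na2 ?p3 //; first by lia.
  move=> i' hi'; rewrite ix_eq //.
  by rewrite negb_and; apply/orP; right; apply/eqP; lia.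
Qed.

End Assign.

(** * Cubic time and the correctness of the whole program *)

Fixpoint depth (p : cmd) : nat :=
  match p with
  | Seq p1 p2 | IfN _ _ p1 p2 | IfX _ _ p1 p2 => maxn (depth p1) (depth p2)
  | For _ _ p => (depth p).+1
  | _ => 0
  end.

Definition weight (p : cmd) : nat := bound (fun=> 1%N) p.

(** Each level of nesting contributes one factor [n], and [weight] is the time when every loop runs
    once. *)
Lemma bound_le v n p : (0 < n)%N -> (forall a, v a <= n)%N ->
  (bound v p <= weight p * n ^ depth p)%N.
Proof.
rewrite /weight => n0 hv.
have mono a b d e : (a <= b * n ^ d)%N -> (d <= e)%N -> (a <= b * n ^ e)%N.
  by move=> h1 h2; apply: leq_trans h1 _; rewrite leq_mul2l leq_pexp2l ?orbT.
elim: p => //=.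
- move=> p1 h1 p2 h2; rewrite mulnDl; apply: leq_add.
    by apply: mono h1 _; rewrite leq_maxl.
  by apply: mono h2 _; rewrite leq_maxr.
- move=> a b p1 h1 p2 h2; rewrite !mulnDl.
  by rewrite !leq_add ?leq_pmulr ?expn_gt0 ?n0 //; [apply: mono h1 _; rewrite leq_maxl|apply: mono h2 _; rewrite leq_maxr].
- move=> a b p1 h1 p2 h2; rewrite !mulnDl.
  by rewrite !leq_add ?leq_pmulr ?expn_gt0 ?n0 //; [apply: mono h1 _; rewrite leq_maxl|apply: mono h2 _; rewrite leq_maxr].
- move=> a b p h; rewrite mulnDl mul1n; apply: leq_add.
    by rewrite leq_pmulr // expn_gt0 n0.
  rewrite expnS mulnCA; apply: leq_mul => //.
  by rewrite mulnDl; apply: leq_add => //; rewrite leq_pmulr // expn_gt0 n0.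
Qed.

Lemma bound_le3 v n p : (0 < n)%N -> (forall a, v a <= n)%N -> (depth p <= 3)%N ->
  (bound v p <= weight p * n ^ 3)%N.
Proof.
move=> n0 hv hd; apply: leq_trans (bound_le p n0 hv) _.
by rewrite leq_mul2l leq_pexp2l ?orbT.
Qed.

Definition main_factor : nat :=
  (weight init + (weight select_star + 48 + 29 + weight remove_client + 3) + weight augment + weight assign)%N.

Section Main.
Variables (R : realType) (nF nC r : nat) (f : nat -> R) (c : nat -> nat -> R).
Implicit Types s : hst R.
Hypothesis nF_gt0 : (0 < nF)%N.
Hypothesis r_gt0 : (0 < r)%N.
Hypothesis f_ge0 : forall i, (i < nF)%N -> 0 <= f i.
Hypothesis c_ge0 : forall i j, (i < nF)%N -> (j < nC)%N -> 0 <= c i j.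
Hypothesis c_metric : forall i i' j j', (i < nF)%N -> (i' < nF)%N -> (j < nC)%N -> (j' < nC)%N ->
  c i j <= c i j' + c i' j' + c i' j.

Lemma jms_cost_le : (jms_cost nF nC <=
  (weight select_star + 48 + 29 + weight remove_client + 3) * (nF + nC) ^ 3)%N.
Proof.
set n := (nF + nC)%N; have n0 : (0 < n)%N by rewrite /n; lia.
have hv a : (loop_limit nF nC a <= n)%N by rewrite /loop_limit /n; case: ifP; lia.
have h1 : (bound (loop_limit nF nC) select_star <= weight select_star * n ^ 2)%N by exact: bound_le.
have h2 : (bound (loop_limit nF nC) remove_client <= weight remove_client * n ^ 2)%N by exact: bound_le.
have hC : (nC <= n)%N by rewrite /n; lia.
have n2 : (n <= n ^ 2)%N by rewrite -{1}[n]expn1 leq_pexp2l.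
have n02 : (1 <= n ^ 2)%N by rewrite expn_gt0 n0.
rewrite /jms_cost /select_cost /remove_cost; clearbody n.
move: h1 h2; move: (weight select_star) (weight remove_client) (bound _ select_star) (bound _ remove_client) => w1 w2 b1 b2 h1 h2; rewrite !mulnDl.
have e (x : nat) : (x * n ^ 3 = n * (x * n ^ 2))%N by rewrite expnS mulnCA.
apply: leq_add; last by rewrite leq_pmulr // expn_gt0 n0.
apply: leq_add; last by rewrite e; apply: leq_mul.
rewrite -!mulnDl e !mulnDl; apply: leq_mul => //; apply: leq_add; last by rewrite leq_pmulr.
apply: leq_add => //.
by rewrite mulnC leq_mul2l /=; apply: leq_trans n2.
Qed.

(** Coverage holds because an open site has price 0, so no client can still gain by switching to it.
    The potential starts from [star_dual_bound] and the [payment] equation of the invariant. *)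
Lemma reached_on_track st : reached nF nC f c st -> (forall k, (k < nC)%N -> conn st k) ->
  covered nF nC c (opn st) (rr st) /\ on_track nF nC r f c (opn st) (rr st).
Proof.
move=> [L [tl [al [rk [h inv]]]]] all.
split.
  split; last by move=> j hj; exact: (nearest inv hj (all j hj)).
  move=> i j hi hj oi; have := offers inv hi; rewrite (fpE inv) oi => /(sum_le0_term hj).
  rewrite all // => hh; rewrite -subr_le0; apply: le_trans (le_pospart _) (hh _) => k _.
  by case: ifP => _; exact: pospart_ge0.
apply: (@on_track_init _ _ _ _ _ _ f_ge0 c_ge0 _ _ al).
- by move=> j hj; have [] := conn_le inv hj (all j hj).
- move=> i S hi; apply: (star_dual_bound _ c_ge0 inv all) => // k hk.
  by rewrite mulr_ge0 ?f_ge0 // divr_ge0.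
- have := payment inv.
  have -> : \sum_(0 <= j < nC) (if conn st j then al j else 0) = \sum_(0 <= j < nC) al j.
    by apply: eq_big_nat => j hj; rewrite all.
  have -> : \sum_(0 <= j < nC) (if conn st j then rr st j else 0) = rr_cost nC (rr st).
    by apply: eq_big_nat => j hj; rewrite all.
  move=> ->; congr (_ + _); rewrite /open_cost mulr_sumr; apply: eq_bigr => i _.
  by case: ifP; rewrite ?mulr0.
Qed.

Theorem main_correct s : loaded nF nC r f c s -> exists opn rr,
  [/\ forall i, (i < nF)%N -> na (heval main s) 0%N i = if opn i then r else 0%N,
      forall j, (j < nC)%N -> assigned nF nC r c opn rr (heval main s) j,
      forall y x, nat_feasible nF nC r y x ->
        r%:R * (open_cost nF f opn + rr_cost nC rr) <= approx R * (fac_cost nF f y + con_cost nF nC c x)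
    & (clk (heval main s) <= clk s + main_factor * (nF + nC) ^ 3)%N].
Proof.
move=> ld; have [es1 js1] := init_ok ld.
rewrite /main 3!heval_Seq.
set s1 := heval init s in es1 js1 *.
have [st [js2 rs all ck2]] := jms_ok nF_gt0 f_ge0 c_ge0 c_metric es1 js1.
set s2 := heval jms s1 in js2 ck2 *.
have es2 : env nF nC r f c s2 by apply: env_heval.
have [cv ot] := reached_on_track rs all.
have ar : arep nF nC r (opn st) (rr st) s2.
  by case: js2 => _ q2 _ q4 q5 _ _; split=> // j hj; apply: q2 => //; exact: all.
have [o' [q' [ar' cv' ot' term]]] := augment_ok r_gt0 f_ge0 c_ge0 es2 ar cv ot.
set s3 := heval augment s2 in ar' *.
have es3 : env nF nC r f c s3 by apply: env_heval.
have [|h1 h2] := assign_ok r_gt0 es3 ar'.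
  by case: cv' => _ h j hj; have [i [hi oi ->]] := h j hj; exists i.
exists o', q'; split=> //.
  apply: (on_track_end f_ge0 ot') => // j hj; exact: (covered_ge0 c_ge0 cv' hj).
set n := (nF + nC)%N; have n0 : (0 < n)%N by rewrite /n; lia.
have hv a : (loop_limit nF nC a <= n)%N by rewrite /loop_limit /n; case: ifP; lia.
have [n00 n01 _] := ld_nr ld.
have c1 : (clk s1 <= clk s + bound (loop_limit nF nC) init)%N.
  apply: clk_heval; first by apply/allP.
  have hl : seq.all (fun b => (b == 0) || (b == 1))%N (limits init) by [].
  by move=> b /(allP hl) /orP[/eqP ->|/eqP ->].
have c3 : (clk s3 <= clk s2 + bound (loop_limit nF nC) augment)%N by apply: clk_env es2 _ _.
have c4 : (clk (heval assign s3) <= clk s3 + bound (loop_limit nF nC) assign)%N by apply: clk_env es3 _ _.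
have b1 : (bound (loop_limit nF nC) init <= weight init * n ^ 3)%N by apply: bound_le3.
have b3 : (bound (loop_limit nF nC) augment <= weight augment * n ^ 3)%N by apply: bound_le3.
have b4 : (bound (loop_limit nF nC) assign <= weight assign * n ^ 3)%N by apply: bound_le3.
have b2 := jms_cost_le; rewrite -/n in b2.
rewrite /main_factor 3!mulnDl.
move: (leq_add (leq_add (leq_add b1 b2) b3) b4).
move: c1 ck2 c3 c4; clear; lia.
Qed.

End Main.

(** * Loading the input and storing the output *)

Section Loader.
Variable R : realType.
Implicit Types (N : nat -> nat) (X : nat -> R).

Lemma runs_loop P (I : nat -> mstate R -> Prop) t n :
  (forall i s, (i < n)%N -> I i s -> exists2 s', I i.+1 s' & runs P t s s') ->
  forall s, I 0%N s -> exists2 s', I n s' & runs P (n * t) s s'.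
Proof.
elim: n => [|n IH] h s I0; first by exists s.
have [|s1 I1 r1] := IH _ s I0; first by move=> i s' hi; apply: h; exact: ltnW.
have [s2 I2 r2] := h n s1 (ltnSn n) I1.
by exists s2 => //; rewrite mulSnr; exact: runs_trans r2.
Qed.

(** The number [m = nF + nF * nC] comes from repeated addition. The base [m + 70] lies above the
    input, the registers and the output region. Cells 5, 6 and 8 are used as zeros, their initial
    value. *)
Definition prologue : seq instr :=
  [:: NConst 4 1; NAdd 3 0 5;
      JmpNLt 6 0 4; Jmp 7; NAdd 3 3 1; NAdd 6 6 4; Jmp 2;
      NConst 7 70; NAdd 60 3 7; NAdd 9 60 5; NConst 10 8;
      JmpNLt 8 3 13; Jmp 18; XLoad 0 8; XStore 9 0; NAdd 8 8 4; NAdd 9 9 10; Jmp 11].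

(* The output region starts at address 3 and may overwrite every register but 0, 1 and 2, so the
   copying loop lives in these three. *)
Definition epilogue (p : nat) : seq instr :=
  [:: NConst 3 70; NSub 3 60 3; NConst 4 3; NAdd 0 3 4; NAdd 1 3 3; NAdd 1 1 1; NAdd 1 1 1;
      NAdd 1 1 60;
      NConst 2 3; JmpNLt 2 0 (p + 11); Halt; NConst 2 1; NSub 0 0 2; NConst 2 8; NSub 1 1 2;
      NLoad 2 1; NStore 0 2; Jmp (p + 8)].

Lemma code_nth P p code i : code_at P p code -> (i < size code)%N -> nth Halt P (p + i) = nth Halt code i.
Proof. by move=> h; exact: h. Qed.

Lemma prologue_ok P nF nC r N X : code_at P 0 prologue ->
  N 0%N = nF -> N 1%N = nC -> N 2%N = r -> (forall a, (3 <= a)%N -> N a = 0%N) ->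
  let m := (nF + nF * nC)%N in
  exists N' X', [/\ runs P (nF * 4 + m * 6 + 10) (MState 0 N X) (MState 18 N' X'),
    [/\ N' 0%N = nF, N' 1%N = nC, N' 2%N = r & N' 60%N = (m + 70)%N],
    (forall a, (61 <= a)%N -> N' a = 0%N) &
    forall k, (k < m)%N -> X' (m + 70 + 8 * k)%N = X k].
Proof.
move=> hc h0 h1 h2 hz m.
have at_ k : (k < 18)%N -> nth Halt P k = nth Halt prologue k.
  by move=> hk; rewrite -(code_nth hc hk).
pose I1 i s := exists N1, [/\ s = MState 2 N1 X, [/\ N1 0%N = nF, N1 1%N = nC & N1 2%N = r],
  [/\ N1 3%N = (nF + i * nC)%N, N1 4%N = 1%N, N1 5%N = 0%N & N1 6%N = i]
  & forall a, (7 <= a)%N -> N1 a = 0%N].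
pose N0 := upd (upd N 4 1%N) 3 (N 0 + N 5)%N.
have start : runs P 2 (MState 0 N X) (MState 2 N0 X).
  apply: (@runsS _ _ _ _ (MState 1 (upd N 4 1%N) X)); first by rewrite /step /= at_.
  by apply: runs1; rewrite /step /= at_.
have init1 : I1 0%N (MState 2 N0 X).
  exists N0; split=> //; rewrite /N0 /upd /=.
  - by rewrite h0 (hz 5%N) // (hz 6%N) //; split=> //; lia.
  - by move=> a ha; rewrite !ifF ?hz //; first [lia | apply/eqP; lia].
have step1 i s : (i < nF)%N -> I1 i s -> exists2 s', I1 i.+1 s' & runs P 4 s s'.
  move=> hi [N1 [-> [a0 a1 a2] [a3 a4 a5 a6] az]].
  pose N2 := upd (upd N1 3 (N1 3 + N1 1)%N) 6 (N1 6 + N1 4)%N.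
  exists (MState 2 N2 X).
    exists N2; split=> //; rewrite /N2 /upd /=.
    - by rewrite a1 a3 a4 a5 a6; split=> //; rewrite ?mulSn; lia.
    - by move=> a ha; rewrite !ifF ?az //; apply/eqP; lia.
  apply: (@runsS _ _ _ _ (MState 4 N1 X)); first by rewrite /step /= at_ //= a6 a0 hi.
  apply: (@runsS _ _ _ _ (MState 5 (upd N1 3 (N1 3 + N1 1)%N) X)); first by rewrite /step /= at_.
  apply: (@runsS _ _ _ _ (MState 6 N2 X)); first by rewrite /step /= at_.
  by apply: runs1; rewrite /step /= at_.
have [s1 [N1 [-> [a0 a1 a2] [a3 a4 a5 a6] az]] r1] := runs_loop step1 init1.
pose off := (m + 70)%N.
pose N2 := upd (upd (upd (upd N1 7 70%N) 60 off) 9 off) 10 8%N.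
have mid : runs P 6 (MState 2 N1 X) (MState 11 N2 X).
  apply: (@runsS _ _ _ _ (MState 3 N1 X)); first by rewrite /step /= at_ //= a6 a0 ltnn.
  apply: (@runsS _ _ _ _ (MState 7 N1 X)); first by rewrite /step /= at_.
  apply: (@runsS _ _ _ _ (MState 8 (upd N1 7 70%N) X)); first by rewrite /step /= at_.
  apply: (@runsS _ _ _ _ (MState 9 (upd (upd N1 7 70%N) 60 off) X)).
    by rewrite /step /= at_ //= /upd /= a3 -/m.
  apply: (@runsS _ _ _ _ (MState 10 (upd (upd (upd N1 7 70%N) 60 off) 9 off) X)).
    by rewrite /step /= at_ //= /upd /= a5 addn0.
  by apply: runs1; rewrite /step /= at_.
(* Real cell 0 is the scratch cell of the copying loop; its input value is lost in the first
   iteration, but that iteration copies it. *)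
pose I2 k s := exists N3 X3, [/\ s = MState 11 N3 X3,
  [/\ N3 0%N = nF, N3 1%N = nC & N3 2%N = r],
  [/\ N3 3%N = m, N3 4%N = 1%N, N3 8%N = k, N3 9%N = (off + 8 * k)%N & N3 10%N = 8%N] /\ N3 60%N = off,
  (forall a, (61 <= a)%N -> N3 a = 0%N) &
  (forall l, (l < k)%N -> X3 (off + 8 * l)%N = X l) /\ (forall l, (k <= l)%N -> (0 < l)%N -> (l < off)%N -> X3 l = X l)
  /\ (k = 0%N -> X3 0%N = X 0%N)].
have init2 : I2 0%N (MState 11 N2 X).
  exists N2, X; split=> //; rewrite /N2 /upd /=.
  - by rewrite a4 (az 8%N) // a3; split=> //; split=> //; lia.
  - by move=> a ha; rewrite !ifF ?az //; first [lia | apply/eqP; lia].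
have step2 k s : (k < m)%N -> I2 k s -> exists2 s', I2 k.+1 s' & runs P 6 s s'.
  move=> hk [N3 [X3 [-> [b0 b1 b2] [[b3 b4 b8 b9 b10] b60] bz [x1 [x2 x3]]]]].
  pose X4 := upd X3 0 (X3 k); pose X5 := upd X4 (off + 8 * k)%N (X4 0%N).
  pose N4 := upd N3 8 (N3 8 + N3 4)%N; pose N5 := upd N4 9 (N4 9 + N4 10)%N.
  have xk : X3 k = X k.
    by have [k0|k0] := posnP k; [rewrite k0 x3|apply: x2 => //; rewrite /off; lia].
  exists (MState 11 N5 X5).
    exists N5, X5; split=> //; rewrite /N5 /N4 /upd /=.
    - by rewrite b3 b4 b8 b9 b10 b60; split=> //; split=> //; lia.
    - by move=> a ha; rewrite !ifF ?bz //; apply/eqP; lia.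
    - split; first move=> l; last split=> //.
        rewrite ltnS leq_eqVlt /X5 /X4 /upd => /orP[/eqP ->|hl]; first by rewrite eqxx /= xk.
        by rewrite !ifF ?x1 //; apply/eqP; rewrite /off; lia.
      move=> l h1' h2' h3'; rewrite /X5 /X4 /upd !ifF ?x2 //; first [lia | apply/eqP; lia].
  apply: (@runsS _ _ _ _ (MState 13 N3 X3)); first by rewrite /step /= at_ //= b8 b3 hk.
  apply: (@runsS _ _ _ _ (MState 14 N3 X4)); first by rewrite /step /= at_ //= b8.
  apply: (@runsS _ _ _ _ (MState 15 N3 X5)); first by rewrite /step /= at_ //= b9.
  apply: (@runsS _ _ _ _ (MState 16 N4 X5)); first by rewrite /step /= at_.
  apply: (@runsS _ _ _ _ (MState 17 N5 X5)); first by rewrite /step /= at_.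
  by apply: runs1; rewrite /step /= at_.
have [s2 [N3 [X3 [-> [b0 b1 b2] [[b3 b4 b8 b9 b10] b60] bz [x1 _]]]] r2] := runs_loop step2 init2.
exists N3, X3; split=> //.
have fin : runs P 2 (MState 11 N3 X3) (MState 18 N3 X3).
  apply: (@runsS _ _ _ _ (MState 12 N3 X3)); first by rewrite /step /= at_ //= b8 b3 ltnn.
  by apply: runs1; rewrite /step /= at_.
have -> : (nF * 4 + m * 6 + 10 = 2 + (nF * 4 + (6 + (m * 6 + 2))))%N by lia.
by apply: runs_trans start _; apply: runs_trans r1 _; apply: runs_trans mid _; apply: runs_trans r2 _.
Qed.

Lemma epilogue_ok P p m N X : code_at P p (epilogue p) -> N 60%N = (m + 70)%N ->
  exists N', [/\ runs P (m * 9 + 10) (MState p N X) (MState (p + 10) N' X),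
    nth Halt P (p + 10) = Halt &
    forall k, (k < m)%N -> N' (3 + k)%N = N (m + 70 + 8 * k)%N].
Proof.
move=> hc h60.
have at_ k : (k < 18)%N -> nth Halt P (p + k) = nth Halt (epilogue p) k by move=> hk; exact: hc.
pose off := (m + 70)%N.
pose N1 := upd (upd (upd (upd N 3 70%N) 3 m) 4 3%N) 0 (m + 3)%N.
pose N2 := upd (upd (upd (upd N1 1 (m + m)%N) 1 (m + m + (m + m))%N) 1 (8 * m)%N) 1 (8 * m + off)%N.
have start : runs P 8 (MState p N X) (MState (p + 8) N2 X).
  apply: (@runsS _ _ _ _ (MState (p + 1) (upd N 3 70%N) X)); first by rewrite /step /= -{1}[p]addn0 at_ //= addn1.
  apply: (@runsS _ _ _ _ (MState (p + 2) (upd (upd N 3 70%N) 3 m) X)).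
    rewrite /step /= at_ //= -addnS; congr (Some (MState _ (upd _ _ _) _)).
    by rewrite /upd /= h60 addnK.
  apply: (@runsS _ _ _ _ (MState (p + 3) (upd (upd (upd N 3 70%N) 3 m) 4 3%N) X)); first by rewrite /step /= at_ //= -addnS.
  apply: (@runsS _ _ _ _ (MState (p + 4) N1 X)); first by rewrite /step /= at_ //= -addnS.
  apply: (@runsS _ _ _ _ (MState (p + 5) (upd N1 1 (m + m)%N) X)); first by rewrite /step /= at_ //= -addnS.
  apply: (@runsS _ _ _ _ (MState (p + 6) (upd (upd N1 1 (m + m)%N) 1 (m + m + (m + m))%N) X)).
    by rewrite /step /= at_ //= -addnS.
  apply: (@runsS _ _ _ _ (MState (p + 7) (upd (upd (upd N1 1 (m + m)%N) 1 (m + m + (m + m))%N) 1 (8 * m)%N) X)).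
    rewrite /step /= at_ //= -addnS; congr (Some (MState _ (upd _ _ _) _)).
    by rewrite /upd /=; lia.
  apply: runs1; rewrite /step /= at_ //= -addnS; congr (Some (MState _ (upd _ _ _) _)).
  by rewrite /upd /= /N1 /upd /= h60.
(* Copying from the last index down makes the end test a comparison with the constant 3, so no
   register has to hold a limit. *)
pose I k s := exists N3, [/\ s = MState (p + 8) N3 X, N3 0%N = (3 + (m - k))%N, N3 1%N = (off + 8 * (m - k))%N,
  (forall l, (m - k <= l)%N -> (l < m)%N -> N3 (3 + l)%N = N (off + 8 * l)%N) &
  forall a, (off <= a)%N -> N3 a = N a].
have init : I 0%N (MState (p + 8) N2 X).
  exists N2; rewrite subn0; split=> //.
  - by rewrite /N2 /N1 /upd /=; lia.
  - by rewrite /N2 /N1 /upd /=; lia.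
  - by move=> l; lia.
  - by move=> a ha; rewrite /N2 /N1 /upd !ifF //; apply/eqP; move: ha; rewrite /off; lia.
have stp k s : (k < m)%N -> I k s -> exists2 s', I k.+1 s' & runs P 9 s s'.
  move=> hk [N3 [-> n0 n1 hl ha]].
  pose j := (m - k.+1)%N.
  pose N4 := upd (upd N3 2 3%N) 2 1%N; pose N5 := upd N4 0 (3 + j)%N; pose N6 := upd N5 2 8.
  pose N7 := upd N6 1 (off + 8 * j)%N; pose N8 := upd N7 2 (N7 (off + 8 * j)%N).
  pose N9 := upd N8 (3 + j)%N (N8 2%N).
  have n8 a : (3 <= a)%N -> N8 a = N3 a.
    by move=> h; rewrite /N8 /N7 /N6 /N5 /N4 /upd !ifF //; apply/eqP; lia.
  have n82 : N8 2%N = N (off + 8 * j)%N.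
    rewrite /N8 /upd /= /N7 /N6 /N5 /N4 /upd !ifF ?ha //; first [lia | apply/eqP; rewrite /off; lia].
  exists (MState (p + 8) N9 X).
    exists N9; split=> //.
    - move=> l h1 h2; rewrite /N9 /upd; case: eqP => [e|ne].
        by rewrite n82; congr N; lia.
      by rewrite n8 ?hl //; lia.
    - by move=> a h; rewrite /N9 /upd ifF ?n8 ?ha //; first [apply/eqP; move: h; rewrite /off /j; lia | move: h; rewrite /off; lia].
  apply: (@runsS _ _ _ _ (MState (p + 9) (upd N3 2 3%N) X)); first by rewrite /step /= at_ //= -addnS.
  apply: (@runsS _ _ _ _ (MState (p + 11) (upd N3 2 3%N) X)).
    by rewrite /step /= at_ //= /upd /= n0 ifT //; lia.
  apply: (@runsS _ _ _ _ (MState (p + 12) N4 X)); first by rewrite /step /= at_ //= -addnS.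
  apply: (@runsS _ _ _ _ (MState (p + 13) N5 X)).
    rewrite /step /= at_ //= -addnS; congr (Some (MState _ (upd _ _ _) _)).
    by rewrite /N4 /upd /= n0 /j; lia.
  apply: (@runsS _ _ _ _ (MState (p + 14) N6 X)); first by rewrite /step /= at_ //= -addnS.
  apply: (@runsS _ _ _ _ (MState (p + 15) N7 X)).
    rewrite /step /= at_ //= -addnS; congr (Some (MState _ (upd _ _ _) _)).
    by rewrite /N6 /N5 /N4 /upd /= n1 /j; lia.
  apply: (@runsS _ _ _ _ (MState (p + 16) N8 X)); first by rewrite /step /= at_ //= -addnS.
  apply: (@runsS _ _ _ _ (MState (p + 17) N9 X)); first by rewrite /step /= at_ //= -addnS.
  by apply: runs1; rewrite /step /= at_.
have [s1 [N3 [-> n0 n1 hl ha]] r1] := runs_loop stp init.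
exists (upd N3 2 3%N); split.
- have -> : (m * 9 + 10 = 8 + (m * 9 + 2))%N by lia.
  apply: runs_trans start _; apply: runs_trans r1 _.
  apply: (@runsS _ _ _ _ (MState (p + 9) (upd N3 2 3%N) X)); first by rewrite /step /= at_ //= -addnS.
  apply: runs1; rewrite /step /= at_ //= {1 2}/upd /= n0 subnn addn0 ltnn.
  by rewrite -addnS.
- by rewrite at_.
- by move=> k hk; rewrite -[upd _ _ _ _]/(N3 (3 + k)%N) hl //; lia.
Qed.

End Loader.

(** * From ordinals to natural-number indices, and the final theorem *)

Section Extend.
Variables (T : Type) (x0 : T).

Definition ext1 n (y : 'I_n -> T) (i : nat) : T := odflt x0 (omap y (insub i)).
Definition ext2 n m (x : 'I_n -> 'I_m -> T) (i j : nat) : T :=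
  odflt x0 (omap (fun i' => ext1 (x i') j) (insub i)).

Lemma ext1E n (y : 'I_n -> T) (i : 'I_n) : ext1 y i = y i.
Proof. by rewrite /ext1 valK. Qed.

Lemma ext2E n m (x : 'I_n -> 'I_m -> T) (i : 'I_n) (j : 'I_m) : ext2 x i j = x i j.
Proof. by rewrite /ext2 valK /= ext1E. Qed.
End Extend.

Definition program : seq instr :=
  prologue ++ comp 18 main ++ epilogue (18 + csize main).

Lemma program_code : [/\ code_at program 0 prologue, code_at program 18 (comp 18 main)
  & code_at program (18 + csize main) (epilogue (18 + csize main))].
Proof.
have h : code_at program 0 program by [].
have [h1 h2] := @code_at_cat _ _ _ _ h.
have [h3 h4] := @code_at_cat _ _ _ _ h2.
by split=> //; move: h4; rewrite size_comp.
Qed.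

Lemma exec_halted (R : realType) P u (s : mstate R) : halted P s -> exec P u s = s.
Proof.
case: u => //= u; rewrite /halted /step; case: (nth _ _ _) => //.
Qed.

Lemma init_xmem_f (R : realType) nF nC r (f : 'I_nF -> R) (c : 'I_nF -> 'I_nC -> R) (i : 'I_nF) :
  xmem (init_state nF nC r f c) i = f i.
Proof. by rewrite /= ltn_ord valK. Qed.

Lemma init_xmem_c (R : realType) nF nC r (f : 'I_nF -> R) (c : 'I_nF -> 'I_nC -> R)
    (i : 'I_nF) (j : 'I_nC) :
  xmem (init_state nF nC r f c) (ix nF nC i j) = c i j.
Proof.
have n0 : (0 < nC)%N by apply: leq_ltn_trans (ltn_ord j).
have lt : (i * nC + j < nF * nC)%N.
  by have := ltn_ord i; have := ltn_ord j; nia.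
have e : (ix nF nC i j - nF = i * nC + j)%N by rewrite /ix -addnA addKn.
rewrite [LHS]/= ifF; last by rewrite /ix; lia.
by rewrite e lt modnMDl modn_small // divnMDl // divn_small // addn0 !valK /= ?valK.
Qed.

Theorem mainTheorem1 (R : realType) :
  exists (P : seq instr) (K : nat),
  forall (nF nC : nat) (f : 'I_nF -> R) (c : 'I_nF -> 'I_nC -> R) (r : nat),
    (0 < nF)%N -> (0 < r)%N ->
    (forall i, 0 <= f i) -> (forall i j, 0 <= c i j) ->
    metric_costs c ->
    let s := exec P (K * (nF + nC) ^ 3 * r)%N (init_state nF nC r f c) in
    [/\ halted P s,
        feasible (fun _ => r) (out_y nF s) (out_x nF nC s)
      & forall (y : 'I_nF -> nat) (x : 'I_nF -> 'I_nC -> nat),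
          feasible (fun _ => r) y x ->
          total_cost f c (out_y nF s) (out_x nF nC s)
            <= (15186%:R / 10000%:R) * total_cost f c y x].
Proof.
exists program, (main_factor + 60)%N => nF nC f c r nF0 r0 f0 c0 cm s.
have [code1 code2 code3] := program_code.
set S0 := init_state nF nC r f c in s *.
pose fn := ext1 0 f; pose cn := ext2 0 c.
pose m := (nF + nF * nC)%N; pose off := (m + 70)%N.
have hz a : (3 <= a)%N -> nmem S0 a = 0%N by case: a => [|[|[|a]]].
have [N1 [X1 [run1 [a0 a1 a2 a60] az ax]]] :=
  @prologue_ok R program nF nC r (nmem S0) (xmem S0) code1 erefl erefl erefl hz.
rewrite -/m in run1 a60 ax.
pose s0 := HS N1 X1 (fun k i => N1 (off + 8 * i + k)%N) (fun k i => X1 (off + 8 * i + k)%N) 0.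
have rp0 : represents off s0 N1 X1 by split.
have fnE i (hi : (i < nF)%N) : fn i = f (Ordinal hi) by rewrite -[LHS]/(fn (Ordinal hi)) /fn ext1E.
have cnE i j (hi : (i < nF)%N) (hj : (j < nC)%N) : cn i j = c (Ordinal hi) (Ordinal hj).
  by rewrite -[LHS]/(cn (Ordinal hi) (Ordinal hj)) /cn ext2E.
have ld : loaded nF nC r fn cn s0.
  split=> //=.
  - move=> i hi; rewrite addn0 ax; last by rewrite /m; lia.
    by rewrite fnE -(@init_xmem_f _ _ _ r f c).
  - move=> i j hi hj; rewrite addn0 ax; last by rewrite /m /ix; nia.
    by rewrite cnE -(@init_xmem_c _ _ _ r f c).
  - by move=> k i hk; rewrite az // /off; lia.
have fn0 i : (i < nF)%N -> 0 <= fn i by move=> hi; rewrite fnE.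
have cn0 i j : (i < nF)%N -> (j < nC)%N -> 0 <= cn i j by move=> hi hj; rewrite cnE.
have cnm i i' j j' : (i < nF)%N -> (i' < nF)%N -> (j < nC)%N -> (j' < nC)%N ->
  cn i j <= cn i j' + cn i' j' + cn i' j by move=> h1 h2 h3 h4; rewrite !cnE; exact: cm.
have [opn [rr [oy ox oc ot]]] := main_correct nF0 r0 fn0 cn0 cnm ld.
have off64 : (64 <= off)%N by rewrite /off; lia.
have [N2 [X2 [T2 [rp2 ck run2]]]] := comp_correct off64 (isT : wf main) code2 rp0.
have [[_ b60] _ bna _] := rp2.
have [N3 [run3 hlt out]] := epilogue_ok X2 code3 b60.
set sf := MState _ N3 X2 in run3.
have sf_halted : halted program sf by rewrite /halted (hlt : nth Halt program (pc sf) = Halt).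
have total : runs program (nF * 4 + m * 6 + 10 + (T2 + (m * 9 + 10))) S0 sf.
  by apply: runs_trans run1 _; apply: runs_trans run2 _.
have es : s = sf.
  set n := (nF + nC)%N in ot; have n1 : (0 < n)%N by rewrite /n; lia.
  have n3 : (n <= n ^ 3)%N by rewrite -{1}[n]expn1 leq_pexp2l.
  have n23 : (n ^ 2 <= n ^ 3)%N by rewrite leq_pexp2l.
  have m2 : (m <= n + n ^ 2)%N by rewrite /m /n; nia.
  (* Loading and storing take [4 * nF + 15 * m + 20] steps, at most [54 * n ^ 3] because
     [m <= n + n ^ 2]. The factor [r] is at least 1. *)
  have le : (nF * 4 + m * 6 + 10 + (T2 + (m * 9 + 10)) <= (main_factor + 60) * n ^ 3 * r)%N.
    apply: (@leq_trans ((main_factor + 60) * n ^ 3)); last by rewrite leq_pmulr.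
    rewrite ck /= add0n in ot; rewrite mulnDl.
    have hF : (nF <= n)%N by rewrite /n; lia.
    move: (main_factor * _)%N ot => q ot; move: n3 n23 m2 hF ot.
    move: (n ^ 3)%N (n ^ 2)%N n1 => q3 q2; lia.
  by rewrite /s -/n -(subnKC le) total exec_halted.
have yE (i : 'I_nF) : out_y nF sf i = if opn i then r else 0%N.
  rewrite /out_y /= out; last by rewrite /m; have := ltn_ord i; lia.
  by have := bna 0%N i isT; rewrite addn0 => ->; rewrite oy.
have xE (i : 'I_nF) (j : 'I_nC) : out_x nF nC sf i j = na (heval main s0) 0%N (ix nF nC i j).
  rewrite /out_x /= -!addnA out; last by rewrite /m; have := ltn_ord i; have := ltn_ord j; nia.
  by have := bna 0%N (ix nF nC i j) isT; rewrite addn0 /ix -addnA => ->.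
rewrite es; split=> //.
  split=> [j|i j].
    have [i0 [h1 h2 h3 h4]] := ox j (ltn_ord j).
    rewrite (bigD1 (Ordinal h1)) // xE h4 // eqxx; exact: leq_addr.
  have [i0 [h1 h2 h3 h4]] := ox j (ltn_ord j).
  by rewrite xE yE h4 //; case: eqP => // ->; rewrite h2.
move=> y x [feas1 feas2].
pose yn := ext1 0%N y; pose xn := ext2 0%N x.
have ynE (i : 'I_nF) : yn i = y i by exact: ext1E.
have xnE (i : 'I_nF) (j : 'I_nC) : xn i j = x i j by exact: ext2E.
have fnI (i : 'I_nF) : fn i = f i by exact: ext1E.
have cnI (i : 'I_nF) (j : 'I_nC) : cn i j = c i j by exact: ext2E.
have nfeas : nat_feasible nF nC r yn xn.
  split=> [j hj|i j hi hj].
    rewrite big_mkord (eq_bigr (fun i => x i (Ordinal hj))) ?feas1 // => i _.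
    by rewrite -(xnE i (Ordinal hj)).
  by rewrite -[i]/(val (Ordinal hi)) -[j]/(val (Ordinal hj)) xnE ynE feas2.
have cost_in : total_cost f c y x = fac_cost nF fn yn + con_cost nF nC cn xn.
  rewrite /total_cost /fac_cost /con_cost !big_mkord; congr (_ + _).
    by apply: eq_bigr => i _; rewrite fnI ynE.
  by apply: eq_bigr => i _; rewrite big_mkord; apply: eq_bigr => j _; rewrite cnI xnE.
rewrite cost_in; apply: le_trans (oc yn xn nfeas).
rewrite /total_cost mulrDr; apply: lerD.
  rewrite /open_cost big_mkord mulr_sumr; apply: ler_sum => i _.
  by rewrite yE fnI; case: ifP => _; rewrite ?mulr0 // mulrC.
(* Client by client: only the site [i0] of [j] contributes, and it costs [r * c i0 j], at most
   [r * rr j]. *)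
rewrite exchange_big /rr_cost big_mkord mulr_sumr; apply: ler_sum => j _.
have [i0 [h1 h2 h3 h4]] := ox j (ltn_ord j).
rewrite (bigD1 (Ordinal h1)) // big1 ?addr0 => [|i hi].
  rewrite xE h4 // eqxx /= addr0 mulrC ler_wpM2l ?ler0n //.
  by rewrite -(cnI (Ordinal h1) j).
by rewrite xE h4 // -val_eqE /= in hi *; rewrite (negPf hi) mulr0.
Qed.
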